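(* Let $(b,u)$ be a unipotent $1$-isopair over a field $\mathbb{F}$ of characteristic different from $2$. For an integer $k\ge 0$, denote by $B_k$ the quadratic Wall invariant $(b,u)_{t-1,2k+1}$. The following conditions are equivalent: (i) $u$ is the product of two $U_2$-elements of $\mathrm{O}(b)$. (ii) For every integer $k\ge 0$, the form $(-1)^kB_k$ Witt-simplifies the orthogonal direct sum $\underset{i>k}{\bot}(-1)^iB_i$.
   Context: All vector spaces are finite-dimensional over $\mathbb{F}$, a field of characteristic $\neq 2$. A $1$-isopair is a pair $(b,u)$ consisting of a non-degenerate symmetric bilinear form $b$ on a vector space $V$ and of an isometry $u\in\mathrm{O}(b)$; it is unipotent when $u-\mathrm{id}$ is nilpotent. A $U_2$-element of $\mathrm{O}(b)$ is an element $w\in \mathrm{O}(b)$ with $(w-\mathrm{id})^2=0$. Quadratic Wall invariants. For odd $r=2k+1\ge1$, $(b,u)_{t-1,r}$ is the non-degenerate symmetric bilinear form induced by $(x,y)\mapsto b\bigl(x,(u+u^{-1}-2\,\mathrm{id})^k(y)\bigr)$ on the quotient space $\mathrm{Ker}(u-\mathrm{id})^r/\bigl(\mathrm{Ker}(u-\mathrm{id})^{r-1}+(\mathrm{Im}(u-\mathrm{id})\cap \mathrm{Ker}(u-\mathrm{id})^r)\bigr)$. (Only finitely many of these spaces are nonzero.) Witt-simplification. For a non-degenerate symmetric bilinear form $B$, the Witt index $\nu(B)$ is the greatest dimension of a totally $B$-isotropic subspace; $B$ is the orthogonal sum of a hyperbolic form of rank $2\nu(B)$ and of a nonisotropic form (one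 with $B(x,x)\ne0$ for all $x\neq0$), unique up to equivalence and called a nonisotropic part of $B$. A subform of $B$ is a restriction of $B$ to $W^2$ for a linear subspace $W$. For non-degenerate symmetric bilinear forms $B,B'$, the following conditions are equivalent, and when they hold $B$ is said to Witt-simplify $B'$: every nonisotropic part of $B'$ is equivalent to a subform of $-B$; $\nu(B')+\nu(B'\bot B)\ge \mathrm{rk}(B')$. *)

(* Defs.v *)
From HB Require Import structures.
From mathcomp Require Import all_boot all_algebra.
From mathcomp Require Import sesquilinear boolp.

Set Implicit Arguments.
Unset Strict Implicit.
Unset Printing Implicit Defensive.

Import GRing.Theory.
Local Open Scope ring_scope.
Local Open Scope quotient_scope.

Section QuotientSpace.
Variables (F : fieldType) (vT : vectType F) (W : {vspace vT}).

Definition vquot : Type := @Quotient.quot vT (pred_of_vspace W).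

HB.instance Definition _ := Choice.on vquot.
HB.instance Definition _ := GRing.Zmodule.on vquot.
HB.instance Definition _ := EqQuotient.on vquot.
HB.instance Definition _ := ZmodQuotient.on vquot.

Lemma vquotE (x y : vT) : (\pi_vquot x == \pi_vquot y) = (x - y \in W).
Proof. by rewrite piE. Qed.

Lemma vquot_reprP (x : vT) : repr (\pi_vquot x) - x \in W.
Proof. by rewrite -vquotE reprK. Qed.

Lemma vquotD (x y : vT) : \pi_vquot (x + y) = \pi_vquot x + \pi_vquot y.
Proof. by rewrite raddfD. Qed.

Definition vquot_scale a (x : vquot) : vquot := \pi_vquot (a *: repr x).

Lemma vquot_scaleE a (x : vT) : vquot_scale a (\pi_vquot x) = \pi_vquot (a *: x).
Proof. by apply/eqP; rewrite vquotE -scalerBr rpredZ ?vquot_reprP. Qed.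

Fact vquot_scaleA a b x : vquot_scale a (vquot_scale b x) = vquot_scale (a * b) x.
Proof. by rewrite -[x]reprK (vquot_scaleE b) !vquot_scaleE scalerA. Qed.
Fact vquot_scale1 : left_id 1 vquot_scale.
Proof. by move=> x; rewrite -[x]reprK !vquot_scaleE scale1r. Qed.
Fact vquot_scaleDr : right_distributive vquot_scale +%R.
Proof.
move=> a x y; rewrite -[x]reprK -[y]reprK.
by rewrite -vquotD !vquot_scaleE scalerDr vquotD.
Qed.
Fact vquot_scaleDl x : {morph vquot_scale^~ x : a b / a + b}.
Proof.
by move=> a b; rewrite -[x]reprK !vquot_scaleE scalerDl vquotD.
Qed.

HB.instance Definition _ := GRing.Zmodule_isLmodule.Build F vquot
  vquot_scaleA vquot_scale1 vquot_scaleDr vquot_scaleDl.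

Fact vquot_vect_iso : Vector.axiom (\dim (W^C)%VS) vquot.
Proof.
have [f f_lin f_bij] := subvs_vect_iso (W^C)%VS.
have capC : (W^C :&: W = 0)%VS by rewrite capvC capv_compl.
pose p := daddv_pi (W^C)%VS W.
have p_add x : p x + daddv_pi W (W^C)%VS x = x.
  by rewrite daddv_pi_add // addvC addv_complf memvf.
have p0 x : x \in W -> p x = 0.
  move=> Wx; have := p_add x; rewrite (daddv_pi_id _ Wx) ?capv_compl //.
  by rewrite -[RHS]add0r => /addIr.
have ppi x : p (repr (\pi_vquot x)) = p x.
  by apply/eqP; rewrite -subr_eq0 -linearB /= p0 ?vquot_reprP.
exists (fun q : vquot => f (vsproj (W^C)%VS (p (repr q)))).
  move=> a x y; rewrite -[x]reprK -[y]reprK.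
  have -> : a *: \pi_vquot (repr x) + \pi_vquot (repr y)
            = \pi_vquot (a *: repr x + repr y).
    by rewrite vquotD -vquot_scaleE.
  by rewrite !ppi linearP /= linearP /= f_lin.
case: f_bij => g fK gK; exists (fun r => \pi_vquot (vsval (g r))).
  move=> x; rewrite -[x]reprK fK vsprojK ?memv_pi //; apply/eqP.
  rewrite ppi vquotE -rpredN opprB -{1}[repr x]p_add addrC addKr.
  exact: memv_pi.
by move=> r; rewrite ppi daddv_pi_id ?subvsP // vsvalK gK.
Qed.

HB.instance Definition _ := Lmodule_hasFinDim.Build F vquot vquot_vect_iso.

End QuotientSpace.

Arguments vquot {F vT} W%_VS.

Section NonDegenerateForms.
Variable F : fieldType.

Record nsform := NSForm {
  fspace : vectType F;
  fform :> {symmetric fspace};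
  fformP : nondegenerate fform
}.

Definition rk (B : nsform) : nat := \dim {: fspace B}.

Lemma nondegenerateP (V : vectType F) (b : {symmetric V}) :
  reflect (forall x, (forall y, b x y = 0) -> x = 0) (nondegenerate b).
Proof.
apply: (iffP eqP) => [b0 x bx0|b0].
  apply/eqP; rewrite -memv0 -b0; apply/mem_orthovP => y _; exact: bx0.
apply/eqP; rewrite -subv0; apply/subvP => x /mem_orthovP bx0.
by rewrite memv0; apply/eqP/b0 => y; apply: bx0; rewrite memvf.
Qed.

Section Perp.
Variables A B : nsform.
Definition perp_fun (x y : fspace A * fspace B) : F := A x.1 y.1 + B x.2 y.2.

Fact perp_bilinear : bilinear_for *%R *%R perp_fun.
Proof.
split=> [z a x y|z a x y]; rewrite /perp_fun /=.
  by rewrite !linearPl /= mulrDr addrACA.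
by rewrite !linearPr /= mulrDr addrACA.
Qed.
HB.instance Definition _ :=
  bilinear_isBilinear.Build F _ _ F *%R (idfun \; *%R) perp_fun perp_bilinear.

Fact perp_sym x y : perp_fun x y = (-1) ^+ false * idfun (perp_fun y x).
Proof. by rewrite /perp_fun [A _ _]hermC [B _ _]hermC !mul1r. Qed.
HB.instance Definition _ :=
  isHermitianSesquilinear.Build F _ false idfun perp_fun perp_sym.

Fact perp_nondegenerate : nondegenerate perp_fun.
Proof.
apply/nondegenerateP => -[x1 x2] x0.
have /nondegenerateP A0 := fformP A; have /nondegenerateP B0 := fformP B.
congr pair; [apply: A0 | apply: B0] => y.
  by have := x0 (y, 0); rewrite /= /perp_fun linear0r addr0.
by have := x0 (0, y); rewrite /= /perp_fun linear0r add0r.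
Qed.
Definition perp := NSForm perp_nondegenerate.
End Perp.

Definition zform_fun (x y : 'rV[F]_0) : F := 0.

Fact zform_bilinear : bilinear_for *%R *%R zform_fun.
Proof. by split=> [z a x y|z a x y]; rewrite /zform_fun /= mulr0 addr0. Qed.
HB.instance Definition _ :=
  bilinear_isBilinear.Build F _ _ F *%R (idfun \; *%R) zform_fun zform_bilinear.

Fact zform_sym x y : zform_fun x y = (-1) ^+ false * idfun (zform_fun y x).
Proof. by rewrite /zform_fun /= mulr0. Qed.
HB.instance Definition _ :=
  isHermitianSesquilinear.Build F _ false idfun zform_fun zform_sym.

Fact zform_nondegenerate : nondegenerate zform_fun.
Proof. by apply/nondegenerateP => x _; apply: thinmx0. Qed.
Definition zform := NSForm zform_nondegenerate.

Section SignedForm.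
Variables (n : nat) (B : nsform).
Definition signed_fun (x y : fspace B) : F := (-1) ^+ n * B x y.

Fact signed_bilinear : bilinear_for *%R *%R signed_fun.
Proof.
split=> [z a x y|z a x y]; rewrite /signed_fun /=.
  by rewrite linearPl /= mulrDr mulrCA.
by rewrite linearPr /= mulrDr mulrCA.
Qed.
HB.instance Definition _ :=
  bilinear_isBilinear.Build F _ _ F *%R (idfun \; *%R) signed_fun signed_bilinear.

Fact signed_sym x y : signed_fun x y = (-1) ^+ false * idfun (signed_fun y x).
Proof. by rewrite /signed_fun [B _ _]hermC !mul1r. Qed.
HB.instance Definition _ :=
  isHermitianSesquilinear.Build F _ false idfun signed_fun signed_sym.

Fact signed_nondegenerate : nondegenerate signed_fun.
Proof.
apply/nondegenerateP => x x0; have /nondegenerateP B0 := fformP B.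
apply: B0 => y; have /eqP := x0 y.
by rewrite /= /signed_fun mulf_eq0 signr_eq0 /= => /eqP.
Qed.
Definition signed := NSForm signed_nondegenerate.
End SignedForm.

Definition totally_isotropic (B : nsform) (W : {vspace fspace B}) : Prop :=
  {in W &, forall x y, B x y = 0}.

Definition witt_index (B : nsform) : nat :=
  \max_(d < (rk B).+1 |
     `[< exists2 W : {vspace fspace B}, totally_isotropic W & \dim W = d >]) d.

(* [B] Witt-simplifies [B'].  This is the rank criterion; the other classical
   form of the condition, equivalent by Witt's theorem in characteristic not 2,
   is that every nonisotropic part of [B'] is isometric to a subform of -[B]. *)
Definition witt_simplifies (B B' : nsform) : Prop :=
  (rk B' <= witt_index B' + witt_index (perp B' B))%N.

End NonDegenerateForms.

Section Subquotient.
Variables (F : fieldType) (vT : vectType F).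
Implicit Types (U W : {vspace vT}) (b : {symmetric vT}).

(* U / (U :&: W), hence U / W when W is a subspace of U. *)
Definition subquot U W : vectType F := vquot (linfun (@vsval _ _ U) @^-1: W).
Definition subquot_pi U W (x : subvs_of U) : subquot U W := \pi_(vquot _) x.
Arguments subquot_pi : clear implicits.

Variables (U W : {vspace vT}) (phi : {symmetric vT}).
Hypothesis phiW : {in U & (U :&: W)%VS, forall x y, phi x y = 0}.

(* The form induced by [phi]: independence of the chosen representatives is
   [subquot_formE]. *)
Definition subquot_fun of {in U & (U :&: W)%VS, forall x y, phi x y = 0} :=
  fun x y : subquot U W => phi (vsval (repr x)) (vsval (repr y)).


Lemma subquot_piK (x : subquot U W) : subquot_pi U W (repr x) = x.
Proof. by rewrite /subquot_pi reprK. Qed.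

Lemma subquot_pi_eq0 (x : subvs_of U) :
  (subquot_pi U W x == 0) = (vsval x \in W).
Proof.
by rewrite -[0](raddf0 \pi_(vquot _)) vquotE subr0 -memv_preim lfunE.
Qed.

Lemma subquot_reprP (x : subvs_of U) :
  vsval (repr (subquot_pi U W x)) - vsval x \in (U :&: W)%VS.
Proof.
rewrite memv_cap -linearB subvsP /=.
have := vquot_reprP (linfun (@vsval _ _ U) @^-1: W)%VS x.
by rewrite -memv_preim lfunE.
Qed.

Lemma subquot_formE (x y : subvs_of U) :
  subquot_fun phiW (subquot_pi U W x) (subquot_pi U W y) = phi (vsval x) (vsval y).
Proof.
rewrite /subquot_fun; set x' := repr _; set y' := repr _.
apply/eqP; rewrite -subr_eq0.
have -> : phi (vsval x') (vsval y') - phi (vsval x) (vsval y)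
   = phi (vsval x' - vsval x) (vsval y') + phi (vsval x) (vsval y' - vsval y).
  by rewrite linearBl linearBr addrA subrK.
rewrite [phi _ (_ - _)]phiW ?subvsP ?subquot_reprP // addr0.
by rewrite hermC phiW ?subvsP ?subquot_reprP //= mulr0.
Qed.

Fact subquot_bilinear : bilinear_for *%R *%R (subquot_fun phiW).
Proof.
have piP a (x y : subquot U W) : a *: x + y = subquot_pi U W (a *: repr x + repr y).
  by rewrite /subquot_pi vquotD -vquot_scaleE !reprK.
split=> [z a x y|z a x y] /=; rewrite piP -(subquot_piK z);
  rewrite -[in RHS](subquot_piK x) -[in RHS](subquot_piK y).
  by rewrite !subquot_formE linearPl.
by rewrite !subquot_formE linearPr.
Qed.
HB.instance Definition _ := bilinear_isBilinear.Build F _ _ F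
  *%R (idfun \; *%R) (subquot_fun phiW) subquot_bilinear.

Fact subquot_sym x y :
  subquot_fun phiW x y = (-1) ^+ false * idfun (subquot_fun phiW y x).
Proof. by rewrite /subquot_fun hermC. Qed.
HB.instance Definition _ := isHermitianSesquilinear.Build F _
  false idfun (subquot_fun phiW) subquot_sym.

Lemma subquot_nondegenerate :
  (forall x, x \in U -> {in U, forall y, phi x y = 0} -> x \in W) ->
  nondegenerate (subquot_fun phiW).
Proof.
move=> UW; apply/nondegenerateP => x; rewrite -(subquot_piK x) => x0.
apply/eqP; rewrite -[0](raddf0 \pi_(vquot _)) vquotE subr0.
rewrite -memv_preim lfunE /= UW ?subvsP // => y Uy.
by have /= := x0 (subquot_pi U W (vsproj U y)); rewrite subquot_formE vsprojK.
Qed.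

End Subquotient.

Section LfunExp.
Variables (F : fieldType) (vT : vectType F).
Implicit Types f g : 'End(vT).

(* 'End(vT) has no canonical ring structure. *)
Definition lfun_exp f k : 'End(vT) := iter k (comp_lfun f) \1%VF.

Lemma lfun_exp0 f x : lfun_exp f 0 x = x. Proof. exact: id_lfunE. Qed.
Lemma lfun_expS f k x : lfun_exp f k.+1 x = f (lfun_exp f k x).
Proof. exact: comp_lfunE. Qed.

Lemma lfun_exp_comm f g k x :
  (forall y, f (g y) = g (f y)) -> lfun_exp f k (g x) = g (lfun_exp f k x).
Proof.
by move=> fg; elim: k => [|k IHk]; rewrite ?lfun_exp0 // !lfun_expS IHk fg.
Qed.

Lemma lfun_expSr f k x : lfun_exp f k.+1 x = lfun_exp f k (f x).
Proof. by rewrite lfun_exp_comm // lfun_expS. Qed.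

Lemma lfun_expD f i j x : lfun_exp f (i + j) x = lfun_exp f i (lfun_exp f j x).
Proof. by elim: i => [|i IHi]; rewrite ?lfun_exp0 // addSn !lfun_expS IHi. Qed.

Lemma lker_exp_sub f i j :
  (i <= j)%N -> (lker (lfun_exp f i) <= lker (lfun_exp f j))%VS.
Proof.
move=> /subnK <-; apply/subvP => x; rewrite !memv_ker lfun_expD => /eqP->.
by rewrite linear0.
Qed.

Lemma lker_exp_stable f k :
  (\dim {:vT} <= k)%N -> lker (lfun_exp f k.+1) = lker (lfun_exp f k).
Proof.
have step i j : (i <= j)%N -> lker (lfun_exp f i.+1) = lker (lfun_exp f i) ->
    lker (lfun_exp f j.+1) = lker (lfun_exp f j).
  move=> /subnK <- eqi; apply/vspaceP => x.
  have := congr1 (fun U : {vspace vT} => lfun_exp f (j - i)%N x \in U) eqi.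
  by rewrite !memv_ker -!lfun_expD addSn !(addnC (j - i)%N).
case: (eqVneq (lker (lfun_exp f k.+1)) (lker (lfun_exp f k))) => // neq le_k.
have lt_dim i : (i <= k.+1)%N -> (i <= \dim (lker (lfun_exp f i)))%N.
  elim: i => // i IHi lt_ik; apply: leq_ltn_trans (IHi (ltnW lt_ik)) _.
  rewrite ltnNge; apply: contra neq => le_dim; apply/eqP/(step i) => //.
  by apply/esym/eqP; rewrite eqEdim lker_exp_sub.
have := leq_trans (lt_dim _ (leqnn _)) (dimvS (subvf _)).
by rewrite ltnNge le_k.
Qed.

End LfunExp.

(* An isometric endomorphism of a finite-dimensional non-degenerate space is
   automatically bijective (see [iaut_inj]), so [isometry B B] is O(B). *)
Record isopair (F : fieldType) := Isopair {
  iform : nsform F;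
  iaut : 'End(fspace iform);
  iautP : isometry iform iform iaut
}.

Definition unipotent (F : fieldType) (p : isopair F) : Prop :=
  exists m, lfun_exp (iaut p - \1%VF) m = 0.

Definition U2_element (F : fieldType) (B : nsform F)
    (w : 'End(fspace B)) : Prop :=
  isometry B B w /\ lfun_exp (w - \1%VF) 2 = 0.

Section Riesz.
Variables (F : fieldType) (B : nsform F).
Local Notation V := (fspace B).

Lemma riesz (h : 'Hom(V, F^o)) : exists t, forall y, h y = B t y.
Proof.
pose T0 (x : V) : 'Hom(V, F^o) := linfun (B x : V -> F^o).
have T0E x y : T0 x y = B x y by rewrite lfunE.
have T0_lin : linear T0.
  by move=> a x y; apply/lfunP => z; rewrite add_lfunE scale_lfunE !T0E linearPl.
pose T := linfun (HB.pack T0 (GRing.isLinear.Build F V _ *:%R T0 T0_lin)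
   : {linear V -> 'Hom(V, F^o)}).
have TE x : T x = T0 x by rewrite lfunE.
have /eqP kT : lker T == 0%VS.
  rewrite -subv0; apply/subvP => x; rewrite memv_ker TE => /eqP x0.
  rewrite memv0; apply/eqP; have /nondegenerateP := fformP B; apply=> y.
  by rewrite -T0E x0 lfunE.
have /eqP imT : limg T == fullv.
  rewrite eqEdim subvf /= limg_dim_eq ?kT ?capv0 // !dimvf /=.
  by rewrite -[X in (_ <= X)%N]muln1.
have /memv_imgP[t _ ->] : h \in limg T by rewrite imT memvf.
by exists t => y; rewrite TE T0E.
Qed.

Lemma orthov_lker (f g : 'End(V)) : (forall x y, B x (f y) = B (g x) y) ->
  forall z, {in lker f, forall y, B z y = 0} -> z \in limg g.
Proof.
move=> adj z z0.
have zE y : B z y = B z ((f^-1)%VF (f y)).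
  apply/eqP; rewrite -subr_eq0 -linearBr; apply/eqP/z0.
  by rewrite memv_ker linearB /= limg_lfunVK ?memv_img ?memvf ?subrr.
have [t tP] := riesz (linfun (B z : V -> F^o) \o f^-1)%VF.
have -> : z = g t.
  apply/eqP; rewrite -subr_eq0; apply/eqP.
  have /nondegenerateP := fformP B; apply=> y.
  transitivity (B z y - B (g t) y); first exact: linearBl.
  by rewrite -adj -tP zE comp_lfunE lfunE /= subrr.
by rewrite memv_img ?memvf.
Qed.

End Riesz.

Section WallInvariants.
Variables (F : fieldType) (p : isopair F).
Local Notation B := (iform p).
Local Notation V := (fspace B).
Local Notation u := (iaut p).
Local Notation n := (u - \1%VF).

Definition wall_op : 'End(V) := u + u^-1%VF - \1%VF *+ 2.

Definition wall_ker r : {vspace V} := lker (lfun_exp n r).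
Definition wall_den r : {vspace V} :=
  (wall_ker r.-1 + (limg n :&: wall_ker r))%VS.

Lemma iaut_inj : lker u == 0%VS.
Proof.
rewrite -subv0; apply/subvP => x; rewrite memv_ker memv0 => /eqP ux0.
apply/eqP; have /nondegenerateP := fformP B; apply=> y.
by rewrite -(iautP x y) ux0 linear0l.
Qed.

Lemma iautK x : u^-1%VF (u x) = x. Proof. exact: lker0_lfunK iaut_inj _. Qed.
Lemma iautVK x : u (u^-1%VF x) = x. Proof. exact: lker0_lfunVK iaut_inj _. Qed.

Lemma iaut_adj x y : B x (u y) = B (u^-1%VF x) y.
Proof. by rewrite -(iautP _ y) iautVK. Qed.
Lemma iautV_adj x y : B x (u^-1%VF y) = B (u x) y.
Proof. by rewrite -(iautP x) iautVK. Qed.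

Lemma wall_opE x : wall_op x = u x + u^-1%VF x - x *+ 2.
Proof.
by rewrite /wall_op !add_lfunE opp_lfunE mulr2n add_lfunE id_lfunE -mulr2n.
Qed.

Let nE x : n x = u x - x.
Proof. by rewrite add_lfunE opp_lfunE id_lfunE. Qed.

Let nV x : n (u^-1%VF x) = u^-1%VF (n x).
Proof. by rewrite !nE linearB /= iautVK iautK. Qed.

Lemma wall_op_adj x y : B x (wall_op y) = B (wall_op x) y.
Proof.
rewrite !wall_opE.
transitivity (B x (u y) + B x (u^-1%VF y) - B x y *+ 2).
  by rewrite linearBr linearDr linearMnr.
rewrite iaut_adj iautV_adj [X in X - _]addrC.
by rewrite linearBl linearDl linearMnl.
Qed.

Lemma wall_op_sqr x : wall_op x = u^-1%VF (n (n x)).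
Proof.
rewrite wall_opE !nE !linearB /= !iautK.
by rewrite mulr2n opprD addrACA opprK [- x + _]addrC.
Qed.

Lemma wall_op_exp k x :
  lfun_exp wall_op k x = lfun_exp u^-1%VF k (lfun_exp n k.*2 x).
Proof.
elim: k => [|k IHk] in x *; first by rewrite !lfun_exp0.
rewrite lfun_expSr IHk wall_op_sqr (lfun_exp_comm _ _ nV).
by rewrite doubleS !lfun_expSr.
Qed.

Lemma wall_op_exp_adj k x y :
  B x (lfun_exp wall_op k y) = B (lfun_exp wall_op k x) y.
Proof.
elim: k => [|k IHk] in x y *; first by rewrite !lfun_exp0.
by rewrite lfun_expS wall_op_adj IHk -lfun_expSr.
Qed.

Definition wall_pre k (x y : V) : F := B x (lfun_exp wall_op k y).

Fact wall_pre_bilinear k : bilinear_for *%R *%R (wall_pre k).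
Proof.
split=> [z a x y|z a x y]; rewrite /wall_pre /=; first exact: linearPl.
by rewrite linearP; apply: linearPr.
Qed.
HB.instance Definition _ k := bilinear_isBilinear.Build F _ _ F
  *%R (idfun \; *%R) (wall_pre k) (wall_pre_bilinear k).

Fact wall_pre_sym k x y :
  wall_pre k x y = (-1) ^+ false * idfun (wall_pre k y x).
Proof. by rewrite /wall_pre wall_op_exp_adj hermC. Qed.
HB.instance Definition _ k := isHermitianSesquilinear.Build F _
  false idfun (wall_pre k) (wall_pre_sym k).

Let n_adj x y : B x (n y) = B (- u^-1%VF (n x)) y.
Proof.
transitivity (B x (u y) - B x y); first by rewrite nE; apply: linearBr.
by rewrite nE linearB /= iautK opprB iaut_adj linearBl.
Qed.

Fact wall_pre_radical k :
  {in wall_ker k.*2.+1 & (wall_ker k.*2.+1 :&: wall_den k.*2.+1)%VS,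
    forall x y, wall_pre k x y = 0}.
Proof.
move=> x y; rewrite memv_ker => /eqP x0 /memv_capP[_].
move=> /memv_addP[y1 y10 [_ /memv_capP[/memv_imgP[z _ ->] _] ->]].
rewrite /wall_pre linearD /=.
have -> : lfun_exp wall_op k y1 = 0.
  by move: y10; rewrite memv_ker /= => /eqP y10; rewrite wall_op_exp y10 linear0.
rewrite add0r wall_op_exp_adj n_adj wall_op_exp -lfun_exp_comm //.
by rewrite -lfun_expS x0 !linear0 linear0l.
Qed.

Lemma wall_pre_nondegenerate k :
  forall x, x \in wall_ker k.*2.+1 ->
    {in wall_ker k.*2.+1, forall y, wall_pre k x y = 0} ->
  x \in wall_den k.*2.+1.
Proof.
move=> x x0 xU.
pose m : 'End(V) := (- (u^-1 \o n))%VF.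
have mE y : m y = - u^-1%VF (n y) by rewrite opp_lfunE comp_lfunE.
have m_adj r y z : B y (lfun_exp n r z) = B (lfun_exp m r y) z.
  elim: r => [|r IHr] in y z *; first by rewrite !lfun_exp0.
  by rewrite lfun_expS n_adj -mE IHr -lfun_expSr.
have : lfun_exp wall_op k x \in limg (lfun_exp m k.*2.+1).
  apply: orthov_lker (m_adj _) _ _ => y Uy.
  by rewrite -wall_op_exp_adj; apply: xU.
case/memv_imgP=> z _; rewrite wall_op_exp.
have [z' ->] : exists z', lfun_exp m k.*2.+1 z = lfun_exp n k.*2.+1 z'.
  elim: k.*2.+1 => [|r [z' IHr]]; first by exists z; rewrite !lfun_exp0.
  exists (u^-1%VF (- z')); rewrite lfun_expS IHr mE.
  by rewrite lfun_expS (lfun_exp_comm _ _ nV) nV !linearN.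
move/(congr1 (lfun_exp u k)).
have uexpK y : lfun_exp u k (lfun_exp u^-1%VF k y) = y.
  elim: k {x x0 xU z z'} y => [|k IHk] y; first by rewrite !lfun_exp0.
  by rewrite lfun_expSr lfun_expS iautVK IHk.
have nu y : u (n y) = n (u y) by rewrite !nE linearB.
have nuk y : lfun_exp u k (n y) = n (lfun_exp u k y) by rewrite lfun_exp_comm.
rewrite uexpK (lfun_expSr _ _ z') => xE.
set t := n (lfun_exp u k z').
have xt : lfun_exp n k.*2 (x - t) = 0.
  apply/eqP; rewrite linearB subr_eq0 /= xE /t -nuk.
  by rewrite (lfun_exp_comm _ _ (fun y => esym (nuk y))).
rewrite -(subrK t x) memv_add ?memv_ker ?xt ?memv_cap //.
rewrite memv_img ?memvf //= memv_ker.
move: x0; rewrite memv_ker -{1}(subrK t x) linearD /=.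
by rewrite (lfun_expS _ _ (x - t)) xt linear0 add0r.
Qed.

Fact wall_nondegenerate k : 
  nondegenerate (subquot_fun (@wall_pre_radical k)).
Proof. exact: subquot_nondegenerate (@wall_pre_nondegenerate k). Qed.

(* (b,u)_{t-1,r} for r = 2k+1, on Ker n^r / (Ker n^(r-1) + (Im n :&: Ker n^r)). *)
Definition wall_invariant k : nsform F := NSForm (wall_nondegenerate k).

Lemma wall_invariant_eq0 k : (\dim {:V} <= k)%N -> rk (wall_invariant k) = 0%N.
Proof.
move=> le_k; apply/eqP; rewrite dimv_eq0 -subv0; apply/subvP => x _.
rewrite memv0 -(subquot_piK x) subquot_pi_eq0.
have sub : (wall_ker k.*2.+1 <= wall_den k.*2.+1)%VS.
  rewrite {1}/wall_ker lker_exp_stable ?addvSl //.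
  by rewrite (leq_trans le_k) // -addnn leq_addr.
exact: (subvP sub) (subvsP _).
Qed.

(* The orthogonal sum of the (-1)^i B_i over all i > k: by
   [wall_invariant_eq0] the omitted summands are zero-dimensional. *)
Definition wall_perp_above k : nsform F :=
  \big[@perp F/zform F]_(k.+1 <= i < \dim {:V}) signed i (wall_invariant i).

End WallInvariants.

(* Main.v *)
Require Import Defs.
From HB Require Import structures.
From mathcomp Require Import all_boot all_algebra.
From mathcomp Require Import sesquilinear boolp.
From mathcomp Require Import zify ring.

(** Write n = u - 1, nb = u^-1 - 1 and v = u + u^-1 - 2, so that nb is the
    b-adjoint of n, v is self-adjoint and v = n + nb = - n nb. Let f_k be the
    degenerate symmetric form b(x, v^k y), and nu_k its Witt index modulo its
    radical Ker v^k. Both conditions of the theorem turn out to be equivalent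
    to the inequalities
        rk n^(2k+1) <= nu_k + nu_(k+1)    for all k,
    which [wall_condition] states without maxima, through the existence of two
    isotropic subspaces.

    Wall invariants. As b(n^k x, n^k y) = (-1)^k f_k(x, y), the form f_k modulo
    its radical is, up to sign, b on Im n^k modulo its radical. Inside Im n^m
    the sum L of the spaces Im n^i :&: Ker n^i (i >= m) is totally isotropic,
    its orthogonal is the sum of the Im n^i :&: Ker n^(i+1), and the quotient
    L^perp / L is the orthogonal sum of the (-1)^i B_i for i >= m
    ([orthov_img_ker], [embeds_wall_perp]). Replacing a form by L^perp / L
    lowers the Witt index by exactly dim L, so nu_k is the Witt index of that
    orthogonal sum up to an explicit dimension; substituting in the rank form
    of Witt-simplification gives [witt_simplifies_wall_condition].

    Necessity. If u = (1 + a)(1 + c) with a and c skew of square zero, then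
    s = a + c satisfies s^2 = v and n = (1 + a) s. On W = Im v^k the subspaces
    a W + (s W :&: Ker s :&: Ker a) and W :&: Ker (c a) correspond to isotropic
    subspaces for f_k and f_(k+1), and counting dimensions
    ([square_zero_dim]) yields the inequality ([U2_product_wall_condition]).

    Sufficiency. With the same notation d = a - c is skew, d^2 = - v and
    d u = u^-1 d; conversely such a d, called here a [twisted_root], gives back
    a = (2 + d)^-1 (d - nb) and c = (2 + d)^-1 (n - d) ([U2_factorization]). So
    it is enough to find a twisted root, and this is done by splitting off
    nondegenerate u-stable subspaces generated by two vectors x and y, where
    d is determined by its values at x and y ([twisted_root_gen]). Let N be
    maximal with n^N <> 0. If N > 0 and some vector outside Ker n^N is isotropic for
    b(x, n^N y), which is automatic for N odd, x and y can be chosen to generate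
    two Jordan blocks of size N + 1 spanning isotropic subspaces, and
    d x = n x, d y = n y or - n y ([hyperbolic_piece]). Otherwise
    N = 0 and u = id, or N = 2K + 2 and the inequality for K provides y
    generating a block of size 2K + 1, orthogonal to the block of x, with
    b(y, v^i y) = b(x, v^(i+1) x) for all i; then d x = y and d y = - v x
    ([linked_piece], [linked_generators]). In both cases the inequalities pass to the
    orthogonal complement ([isotropic_complement], [piece_condition]), and
    induction on the dimension concludes. *)

Set Implicit Arguments.
Unset Strict Implicit.
Unset Printing Implicit Defensive.

Import GRing.Theory.
Local Open Scope ring_scope.

Lemma downward (P : nat -> Prop) N :
  P N -> (forall j, (j < N)%N -> P j.+1 -> P j) -> P 0%N.
Proof.
move=> PN step; suff : forall m, P (N - m)%N by move/(_ N); rewrite subnn.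
elim=> [|m IHm]; first by rewrite subn0.
have [mN|Nm] := ltnP m N; last first.
  by have -> : (N - m.+1 = N - m)%N by move: Nm; lia.
apply: step; first by move: mN; lia.
by have -> : (N - m.+1).+1 = (N - m)%N by move: mN; lia.
Qed.

Lemma eq_subn_of_drop a c e m : (a + c = e.+1 - m)%N -> (a <= 1)%N ->
  ((m <= e)%N -> (1 <= a)%N) -> c = (e - m)%N.
Proof. by case: (leqP m e) => [_ ac a1 /(_ isT)|]; lia. Qed.

(** * Orthogonality and dimension for a symmetric form *)

Section SymmetricForm.
Variables (F : fieldType) (V : vectType F) (f : {symmetric V}).
Implicit Types A L T : {vspace V}.

Lemma symC x y : f x y = f y x.
Proof. by rewrite hermC mul1r. Qed.

Definition isotropic T := {in T &, forall x y, f x y = 0}.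

Lemma orthovD A L : orthov f (A + L)%VS = (orthov f A :&: orthov f L)%VS.
Proof.
apply/vspaceP => x; rewrite memv_cap; apply/mem_orthovP/andP => [x0|].
  split; apply/mem_orthovP => y Hy; apply: x0.
    exact: (subvP (addvSl _ _)).
  exact: (subvP (addvSr _ _)).
case=> /mem_orthovP xA /mem_orthovP xL _ /memv_addP[y Ay [z Lz ->]].
by rewrite linearDr /= xA // xL // addr0.
Qed.

Lemma leq_dim_orthov A L : (\dim A <= \dim (A :&: orthov f L) + \dim L)%N.
Proof.
have step (r : seq V) : (\dim A <= \dim (A :&: orthov f <<r>>) + size r)%N.
  elim: r => [|z r IHr] /=; first by rewrite span_nil orthov0 capvf addn0.
  apply: leq_trans IHr _; rewrite span_cons orthovD [(orthov _ _ :&: _)%VS]capvC capvA.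
  rewrite addnS -addSn.
  rewrite leq_add2r.
  by have := leq_dim_orthov1 f z (A :&: orthov f <<r>>); case: (\dim _).
by have := step (vbasis L); rewrite (span_basis (vbasisP L)) size_tuple.
Qed.

(** The pairing of A with L descends to L modulo the part of L orthogonal to A,
    which bounds the codimension in A of the orthogonal of L. *)
Lemma dim_orthov_leq A L :
  (\dim A + \dim (L :&: orthov f A) <= \dim (A :&: orthov f L) + \dim L)%N.
Proof.
pose L0 := (L :\: orthov f A)%VS.
have orthoL0 : (A :&: orthov f L0 <= A :&: orthov f L)%VS.
  apply/subvP => x /memv_capP[Ax /mem_orthovP x0].
  rewrite memv_cap Ax /=; apply/mem_orthovP => y.
  rewrite -{1}(addv_diff_cap L (orthov f A)) => /memv_addP[y0 Ly0 [y1]].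
  move=> /memv_capP[_ /mem_orthovP y1A] ->.
  by rewrite linearDr /= x0 // add0r symC y1A.
have := leq_dim_orthov A L0; have := dimvS orthoL0.
have := dimv_cap_compl L (orthov f A); rewrite -/L0; lia.
Qed.

(** Both sides compute the rank of the pairing of A with L, so one inequality
    gives the other by exchanging A and L. *)
Lemma dim_orthov_eq A L :
  (\dim A + \dim (L :&: orthov f A) = \dim (A :&: orthov f L) + \dim L)%N.
Proof. by have := dim_orthov_leq A L; have := dim_orthov_leq L A; lia. Qed.

Lemma isotropic_orthov T : isotropic T <-> (T <= orthov f T)%VS.
Proof. by split=> [T0|/orthovP//]; apply/orthovP. Qed.

Lemma isotropicS A T : (A <= T)%VS -> isotropic T -> isotropic A.
Proof. by move=> /subvP AT T0 x y /AT Tx /AT; apply: T0. Qed.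

Lemma isotropicD A T :
  isotropic A -> isotropic T -> (A <= orthov f T)%VS -> isotropic (A + T)%VS.
Proof.
move=> A0 T0 /orthovP AT _ _ /memv_addP[x Ax [y Ty ->]] /memv_addP[z Az [t Tt ->]].
rewrite linearDl !linearDr /= (A0 x z) // (AT x t) // (symC y) (AT z y) //.
by rewrite (T0 y t) // !addr0.
Qed.

(** The classical argument showing that reduction modulo an isotropic L loses
    nothing: any isotropic T can be replaced by one that lies between L and its
    orthogonal, without lowering the dimension. *)
Lemma leq_dim_isotropicD T L : isotropic T -> isotropic L ->
  (\dim T <= \dim (T :&: orthov f L + L))%N.
Proof.
move=> T0 L0; have := dim_orthov_leq T L.
have capT : (T :&: L <= L :&: orthov f T)%VS.
  by rewrite subv_cap capvSr; apply: subv_trans (capvSl _ _) _; apply/isotropic_orthov.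
have capL : (T :&: orthov f L :&: L <= T :&: L)%VS.
  by rewrite subv_cap capvSr andbT; apply: subv_trans (capvSl _ _) (capvSl _ _).
have := dimvS capT; have := dimvS capL; have := dimv_sum_cap (T :&: orthov f L) L.
lia.
Qed.

Lemma isotropic_replace T L : isotropic T -> isotropic L ->
  isotropic (T :&: orthov f L + L)%VS.
Proof.
move=> T0 L0; apply: isotropicD => //; last exact: capvSr.
exact: isotropicS (capvSl _ _) T0.
Qed.

End SymmetricForm.

(** * The operators attached to an isopair *)

Section VectorIdentities.
Variables (F : fieldType) (V : vectType F).

(** Identities between words in non-commuting endomorphisms are normalised on
    vectors; scalar forms then transport the remaining linear identity to F. *)
Lemma scalar_ext (x y : V) : (forall c : {scalar V}, c x = c y) -> x = y.
Proof.
move=> xy; rewrite (coord_vbasis (memvf x)) (coord_vbasis (memvf y)).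
by apply: eq_bigr => i _; rewrite xy.
Qed.

End VectorIdentities.

Section LfunLinear.
Variables (F : fieldType) (V W : vectType F) (f : 'Hom(V, W)).
Lemma lfunD x y : f (x + y) = f x + f y. Proof. exact: linearD. Qed.
Lemma lfunN x : f (- x) = - f x. Proof. exact: linearN. Qed.
Lemma lfunZ a x : f (a *: x) = a *: f x. Proof. exact: linearZ. Qed.
Lemma lfun0 : f 0 = 0. Proof. exact: linear0. Qed.
End LfunLinear.
Definition lfunL := (lfunD, lfunN, lfunZ, lfun0).

Ltac vring := apply: scalar_ext => ?;
  rewrite ?(linearD, linearN, linearZ, linearMn, linear0) /=; ring.

Notation "f ^^ k" := (lfun_exp f k) (at level 30, k at level 9, format "f ^^ k").

Section Operators.
Variables (F : fieldType) (p : isopair F).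
Local Notation b := (iform p).
Local Notation V := (fspace (iform p)).
Local Notation u := (iaut p).
Local Notation u' := ((iaut p)^-1%VF).
Local Notation n := (iaut p - \1%VF).
Local Notation nb := ((iaut p)^-1%VF - \1%VF).
Local Notation v := (wall_op p).
Local Notation w := (iaut p - (iaut p)^-1%VF).
Implicit Types x y z : V.

Lemma b0l y : b 0 y = 0. Proof. exact: linear0l. Qed.
Lemma b0r x : b x 0 = 0. Proof. exact: linear0r. Qed.
Lemma bDl x y z : b (x + y) z = b x z + b y z. Proof. exact: linearDl. Qed.
Lemma bDr x y z : b x (y + z) = b x y + b x z. Proof. exact: linearDr. Qed.
Lemma bNl x y : b (- x) y = - b x y. Proof. exact: linearNl. Qed.
Lemma bNr x y : b x (- y) = - b x y. Proof. exact: linearNr. Qed.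
Lemma bBl x y z : b (x - y) z = b x z - b y z. Proof. exact: linearBl. Qed.
Lemma bBr x y z : b x (y - z) = b x y - b x z. Proof. exact: linearBr. Qed.
Lemma bZl a x y : b (a *: x) y = a * b x y. Proof. exact: linearZl_LR. Qed.
Lemma bZr a x y : b x (a *: y) = a * b x y. Proof. exact: linearZr_LR. Qed.
Lemma bC x y : b x y = b y x. Proof. exact: symC. Qed.

Definition bE := (bDl, bDr, bNl, bNr, bZl, bZr, b0l, b0r).

Lemma nE x : n x = u x - x.
Proof. by rewrite add_lfunE opp_lfunE id_lfunE. Qed.
Lemma nbE x : nb x = u' x - x.
Proof. by rewrite add_lfunE opp_lfunE id_lfunE. Qed.
Lemma wE x : w x = n x - nb x.
Proof. by rewrite nE nbE add_lfunE opp_lfunE opprB addrA subrK. Qed.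
Lemma vE x : v x = n x + nb x.
Proof. by rewrite wall_opE nE nbE; vring. Qed.
Lemma uE x : u x = x + n x. Proof. by rewrite nE addrC subrK. Qed.
Lemma u'E x : u' x = x + nb x. Proof. by rewrite nbE addrC subrK. Qed.

Lemma n_nb x : n (nb x) = - v x.
Proof. by rewrite wall_opE nbE nE !linearB /= iautVK; vring. Qed.
Lemma nb_n x : nb (n x) = - v x.
Proof. by rewrite wall_opE nbE nE !linearB /= iautK; vring. Qed.
Lemma nC_nb x : n (nb x) = nb (n x). Proof. by rewrite n_nb nb_n. Qed.
Lemma nC_v x : n (v x) = v (n x).
Proof. by rewrite !vE linearD /= n_nb nb_n. Qed.
Lemma nbC_v x : nb (v x) = v (nb x).
Proof. by rewrite !vE linearD /= n_nb nb_n. Qed.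
Lemma wC_v x : w (v x) = v (w x).
Proof. by rewrite !wE linearB /= nC_v nbC_v. Qed.
Lemma u'C_n x : u' (n x) = n (u' x).
Proof. by rewrite !u'E linearD /= nC_nb. Qed.
Lemma nn x : n (n x) = v x + v (n x).
Proof. by rewrite [v (n x)]vE nb_n; vring. Qed.
Lemma nbnb x : nb (nb x) = v x + v (nb x).
Proof. by rewrite [v (nb x)]vE n_nb; vring. Qed.
(** Since v is self-adjoint and w is skew, this makes F[u] a quadratic extension
    of F[v], generated by w. *)
Lemma ww x : w (w x) = v (v x) + 4%:R *: v x.
Proof.
by rewrite [w x]wE linearB /= !wE nn nbnb n_nb nb_n [v (v x)]vE -nC_v -nbC_v; vring.
Qed.
Lemma n_u'nb x : nb x = - u' (n x).
Proof. by rewrite u'E nb_n vE; vring. Qed.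

Lemma n_adj x y : b (n x) y = b x (nb y).
Proof. by rewrite nE nbE bBl bBr -iautV_adj. Qed.
Lemma nb_adj x y : b (nb x) y = b x (n y).
Proof. by rewrite nE nbE bBl bBr -iaut_adj. Qed.
Lemma v_adj x y : b (v x) y = b x (v y).
Proof. by rewrite wall_op_adj. Qed.
Lemma vX_adj k x y : b (v^^k x) y = b x (v^^k y).
Proof. by rewrite wall_op_exp_adj. Qed.
Lemma nX_adj k x y : b (n^^k x) y = b x (nb^^k y).
Proof.
elim: k => [|k IHk] in x y *; first by rewrite !lfun_exp0.
by rewrite lfun_expSr lfun_expS IHk n_adj.
Qed.

Lemma vXC_n k x : v^^k (n x) = n (v^^k x).
Proof. by apply: lfun_exp_comm => y; rewrite nC_v. Qed.
Lemma vXC_nb k x : v^^k (nb x) = nb (v^^k x).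
Proof. by apply: lfun_exp_comm => y; rewrite nbC_v. Qed.
Lemma vXC_w k x : v^^k (w x) = w (v^^k x).
Proof. by apply: lfun_exp_comm => y; rewrite wC_v. Qed.
Lemma vXC_nX k j x : v^^k (n^^j x) = n^^j (v^^k x).
Proof. by rewrite -lfun_exp_comm // => y; rewrite vXC_n. Qed.

Lemma u'_inj x : u' x = 0 -> x = 0.
Proof. by move/(congr1 u); rewrite iautVK linear0. Qed.
Lemma u'X_eq0 k x : u'^^k x = 0 -> x = 0.
Proof.
elim: k => [|k IHk]; first by rewrite lfun_exp0.
by rewrite lfun_expS => /u'_inj.
Qed.

Lemma vX_eq0 k x : (v^^k x == 0) = (n^^k.*2 x == 0).
Proof.
rewrite wall_op_exp; apply/eqP/eqP => [/u'X_eq0//|->]; exact: linear0.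
Qed.

Lemma u'X_fix k x : n x = 0 -> u'^^k x = x.
Proof.
move=> x0; have u'x : u' x = x by rewrite -{2}(iautK x) uE x0 addr0.
by elim: k => [|k IHk]; rewrite ?lfun_exp0 // lfun_expS IHk.
Qed.

(** On a vector killed by n, u acts as the identity, so at the top of a Jordan
    block powers of v and of n agree. *)
Lemma vX_top k j x : n^^(k.*2 + j).+1 x = 0 -> v^^k (n^^j x) = n^^(k.*2 + j) x.
Proof. by move=> x0; rewrite wall_op_exp -lfun_expD u'X_fix // -lfun_expS. Qed.

Lemma nbX k x : nb^^k x = (-1) ^+ k *: u'^^k (n^^k x).
Proof.
elim: k => [|k IHk]; first by rewrite !lfun_exp0 expr0 scale1r.
rewrite lfun_expS IHk linearZ /= n_u'nb exprS !lfun_expS -!lfun_expS.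
rewrite (lfun_expS u') (lfun_expS n) mulN1r scaleNr scalerN.
by rewrite (lfun_exp_comm _ _ u'C_n).
Qed.

Lemma nbX_top k j x : n^^(k + j).+1 x = 0 ->
  nb^^k (n^^j x) = (-1) ^+ k *: n^^(k + j) x.
Proof. by move=> x0; rewrite nbX -lfun_expD u'X_fix // -lfun_expS. Qed.

Lemma nX_eq0 k j x : (k <= j)%N -> n^^k x = 0 -> n^^j x = 0.
Proof. by move=> /subnK <- x0; rewrite lfun_expD x0 linear0. Qed.

End Operators.

(** * Necessity *)

Section SquareZeroPair.
Variables (F : fieldType) (V : vectType F).
Implicit Types (f g : 'End(V)) (U W : {vspace V}).

Lemma eq_ker_dim_limg f g U :
  (forall x, (f x == 0) = (g x == 0)) -> \dim (f @: U) = \dim (g @: U).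
Proof.
move=> fg; have fgK : lker f = lker g by apply/vspaceP => x; rewrite !memv_ker fg.
by have := limg_ker_dim f U; have := limg_ker_dim g U; rewrite fgK; lia.
Qed.

(** The dimension count behind necessity. Here s^2 = a c + c a, and R below is
    the kernel of s on s W. The vectors x of W with a x in R satisfy c a x = 0,
    and on Ker s^2 one has a c = - c a, so that c a Ker s^2 = a R. *)
Lemma square_zero_dim (a c : 'End(V)) W (s := a + c)
    (M := (W :&: lker (c \o a))%VS)
    (T := (a @: W + (s @: W :&: lker s :&: lker a))%VS) :
  (forall x, a (a x) = 0) -> (forall x, c (c x) = 0) ->
  (\dim (s @: W) <= \dim T + \dim ((s \o s) @: M))%N.
Proof.
move=> aa cc; pose K := (W :&: lker (s \o s))%VS; pose R := (s @: W :&: lker s)%VS.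
have sE x : s x = a x + c x by rewrite add_lfunE.
have ssE x : s (s x) = a (c x) + c (a x).
  by rewrite !sE !lfunD aa cc; vring.
have acK x : x \in K -> a (c x) = - c (a x).
  move=> /memv_capP[_]; rewrite memv_ker comp_lfunE ssE => /eqP x0.
  by apply/eqP; rewrite -addr_eq0 x0.
have sWR : R = (s @: K)%VS.
  apply/vspaceP => y; apply/memv_capP/memv_imgP => [[]|[x xK ->]].
    case/memv_imgP => x Wx -> sx; exists x => //.
    by rewrite memv_cap Wx memv_ker comp_lfunE -memv_ker.
  move: xK => /memv_capP[Wx]; rewrite memv_ker comp_lfunE => sx.
  by rewrite memv_img // memv_ker.
have dimaR : \dim (a @: R) = \dim ((c \o a) @: K).
  rewrite sWR -limg_comp.
  have -> : ((a \o s) @: K = (- (c \o a)) @: K)%VS.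
    apply: eq_in_limg => x Kx; rewrite !comp_lfunE opp_lfunE comp_lfunE sE lfunD aa.
    by rewrite add0r acK.
  by apply: eq_ker_dim_limg => x; rewrite opp_lfunE oppr_eq0.
(* dim a W - dim (a W :&: R) = dim W - dim X, and X is bounded through M. *)
pose X := (W :&: a @^-1: R)%VS.
have XM : (X <= M)%VS.
  apply/subvP => x /memv_capP[Wx]; rewrite -memv_preim => /memv_capP[_].
  by rewrite memv_cap Wx !memv_ker comp_lfunE sE aa add0r.
have aX : (a @: W :&: (R :&: lker a) <= a @: X)%VS.
  apply/subvP => _ /memv_capP[/memv_imgP[x Wx ->]] /memv_capP[Rx _].
  by rewrite memv_img // memv_cap Wx -memv_preim.
have kX : (X :&: lker a <= W :&: lker a)%VS by rewrite capvS ?capvSl.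
have kX' : (W :&: lker a <= X :&: lker a)%VS.
  apply/subvP => x /memv_capP[Wx ax]; rewrite !memv_cap Wx ax -memv_preim.
  by move: ax; rewrite memv_ker => /eqP->; rewrite mem0v.
have KM : (M :&: lker (s \o s) = K :&: lker (c \o a))%VS.
  by rewrite -!capvA [X in (_ :&: X)%VS]capvC.
have := limg_ker_dim s (s @: W); rewrite -/R -limg_comp.
have := limg_ker_dim a R; have := dimv_sum_cap (a @: W) (R :&: lker a).
have := limg_ker_dim a W; have := limg_ker_dim a X; have := limg_ker_dim (s \o s) M.
have := limg_ker_dim (c \o a) K; have := limg_ker_dim (s \o s) W.
have := dimvS XM; have := dimvS aX; have := dimvS kX; have := dimvS kX'.
rewrite -/K KM -/T; lia.
Qed.

End SquareZeroPair.

Section Necessity.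
Variables (F : fieldType) (p : isopair F).
Local Notation b := (iform p).
Local Notation V := (fspace (iform p)).
Local Notation u := (iaut p).
Local Notation n := (iaut p - \1%VF).
Local Notation nb := ((iaut p)^-1%VF - \1%VF).
Local Notation v := (wall_op p).
Implicit Types x y z : V.

(** The inequality rk n^(2k+1) <= nu_k + nu_(k+1) on U: the largest dimension of
    v^k T over the isotropic subspaces T of f_k is the Witt index of f_k modulo
    its radical. It is relative to U because the converse proceeds by splitting
    off orthogonal summands. *)
Definition wall_condition (U : {vspace V}) (k : nat) : Prop :=
  exists T1 T2 : {vspace V},
    [/\ (T1 <= U)%VS /\ isotropic (@wall_pre F p k) T1,
        (T2 <= U)%VS /\ isotropic (@wall_pre F p k.+1) T2 &
        (\dim (n^^(k.*2.+1) @: U) <= \dim (v^^k @: T1) + \dim (v^^k.+1 @: T2))%N].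

Lemma dim_vX_img k (U : {vspace V}) : \dim (v^^k @: U) = \dim (n^^(k.*2) @: U).
Proof. by apply: eq_ker_dim_limg => x; apply: vX_eq0. Qed.

Lemma dim_nvX_img k (U : {vspace V}) :
  \dim (n @: (v^^k @: U)) = \dim (n^^(k.*2.+1) @: U).
Proof.
rewrite -limg_comp; apply: eq_ker_dim_limg => x.
by rewrite comp_lfunE -vXC_n vX_eq0 -lfun_expSr.
Qed.

(** For w1 = 1 + a the isometry condition reads a + a^* + a^* a = 0; composing
    with a gives a^* a = 0, hence a^* = - a. *)
Lemma U2_element_sub1 w1 (a := w1 - \1%VF) : @U2_element _ (iform p) w1 ->
  (forall x y, b (a x) y = - b x (a y)) /\ (forall x, a (a x) = 0).
Proof.
move=> [w1P w1_2]; have aE x : w1 x = x + a x.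
  by rewrite /a add_lfunE opp_lfunE id_lfunE addrC subrK.
have aa x : a (a x) = 0.
  have := congr1 (fun f : 'End(V) => f x) w1_2.
  by rewrite zero_lfunE !lfun_expS lfun_exp0.
have inv x y : b (a x) y + b x (a y) + b (a x) (a y) = 0.
  by have := w1P x y; rewrite !aE !bE => /eqP; rewrite -subr_eq0 => /eqP <-; ring.
split=> // x y; have := inv x (a y); rewrite aa !b0r !addr0 => aa0.
by have := inv x y; rewrite aa0 addr0 => /eqP; rewrite addr_eq0 => /eqP.
Qed.

(** Adjunction turns u = (1 + a)(1 + c) into v = a c + c a = (a + c)^2, so
    that a, c and s commute with v and restrict to Im v^k. *)
Lemma U2_product_wall_condition w1 w2 k :
  @U2_element _ (iform p) w1 -> @U2_element _ (iform p) w2 ->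
  u = (w1 \o w2)%VF -> wall_condition fullv k.
Proof.
move=> U2w1 U2w2 u_def.
have [] := U2_element_sub1 U2w1; set a := (w1 - _) => a_skew aa.
have [] := U2_element_sub1 U2w2; set c := (w2 - _) => c_skew cc.
have nac x : n x = a x + c x + a (c x).
  have aE y : w1 y = y + a y by rewrite /a add_lfunE opp_lfunE id_lfunE addrC subrK.
  have cE y : w2 y = y + c y by rewrite /c add_lfunE opp_lfunE id_lfunE addrC subrK.
  by rewrite nE u_def comp_lfunE cE aE lfunD; vring.
(* The adjoint of n, computed from n = a + c + a c. *)
have n_adj' x y : b x (nb y) = b x (- a y - c y + c (a y)).
  by rewrite -n_adj nac !bE !a_skew !c_skew; ring.
have nbac y : nb y = - a y - c y + c (a y).
  apply/eqP; rewrite -subr_eq0; apply/eqP.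
  have /nondegenerateP := fformP (iform p); apply=> x.
  by rewrite bC !bE n_adj' !bE; ring.
have vac x : v x = a (c x) + c (a x) by rewrite vE nac nbac; vring.
have va x : v (a x) = a (v x) by rewrite !vac !lfunD !aa lfun0; vring.
have vc x : v (c x) = c (v x) by rewrite !vac !lfunD !cc lfun0; vring.
pose s := a + c; have sE x : s x = a x + c x by rewrite add_lfunE.
have ssE x : s (s x) = v x by rewrite vac !sE !lfunD aa cc; vring.
have s_skew x y : b (s x) y = - b x (s y) by rewrite !sE !bE a_skew c_skew; ring.
have vka x : v^^k (a x) = a (v^^k x) by apply: lfun_exp_comm.
have vkc x : v^^k (c x) = c (v^^k x) by apply: lfun_exp_comm.
have vks x : v^^k (s x) = s (v^^k x) by rewrite !sE lfunD vka vkc.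
have ker_s x : (s x == 0) = (n x == 0).
  apply/eqP/eqP => x0.
    have -> : n x = s x + a (s x) by rewrite nac !sE !lfunD aa; vring.
    by rewrite x0 linear0 addr0.
  have -> : s x = n x - a (n x) by rewrite nac !sE !lfunD !aa; vring.
  by rewrite x0 linear0 subr0.
pose W := limg (v^^k); have Wa x : x \in W -> a x \in W.
  by case/memv_imgP => y _ ->; rewrite -vka memv_img ?memvf.
pose M := (W :&: lker (c \o a))%VS.
pose T := (a @: W + (s @: W :&: lker s :&: lker a))%VS.
have TW : (T <= W)%VS.
  rewrite subv_add; apply/andP; split; apply/subvP => x.
    by case/memv_imgP => y Wy ->; apply: Wa.
  case/memv_capP=> /memv_capP[/memv_imgP[_ /memv_imgP[y _ ->] ->] _ _].
  by rewrite -vks memv_img ?memvf.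
exists ((v^^k) @^-1: T)%VS, ((v^^k) @^-1: M)%VS; split.
- split=> [|x y]; first exact: subvf.
  (* Both kinds of generators of T are orthogonal to T once v^k is moved across b. *)
  have TP x0 : x0 \in (v^^k @^-1: T)%VS -> exists z r,
      [/\ v^^k x0 = a (v^^k z) + s (v^^k r), s (s (v^^k r)) = 0 & a (s (v^^k r)) = 0].
    rewrite -memv_preim => /memv_addP[_ /memv_imgP[_ /memv_imgP[z _ ->] ->]].
    case=> _ /memv_capP[/memv_capP[/memv_imgP[_ /memv_imgP[r _ ->] ->]]].
    by rewrite !memv_ker => /eqP ? /eqP ? ?; exists z, r.
  case/TP=> z [r [xE sr ar]] /TP[z' [r' [yE sr' ar']]].
  change (b x (v^^k y) = 0); rewrite yE bDr -vka -vks -!vX_adj xE !bDl.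
  have bav t t' : b (a (v^^k t)) t' = - b t (a (v^^k t')) by rewrite a_skew vX_adj vka.
  have bsv t t' : b (s (v^^k t)) t' = - b t (s (v^^k t')) by rewrite s_skew vX_adj vks.
  have a_skew' t t' : b t (a t') = - b (a t) t' by rewrite a_skew opprK.
  rewrite !a_skew' aa ar bav bsv !vks ar' sr' !(b0l, b0r); ring.
- split=> [|x y]; first exact: subvf.
  rewrite -!memv_preim !memv_cap !memv_ker !comp_lfunE.
  move=> /andP[_ /eqP cax] /andP[_ /eqP cay].
  change (b x (v^^k.+1 y) = 0); rewrite lfun_expS vac bDr cay b0r addr0.
  have -> : b x (a (c (v^^k y))) = b (c (a (v^^k x))) y.
    by rewrite -vka -[in RHS]vkc vX_adj c_skew a_skew opprK.
  by rewrite cax b0l.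
have imk (S : {vspace V}) : (S <= W)%VS -> (v^^k @: (v^^k @^-1: S) = S)%VS.
  by move=> SW; rewrite lpreimK.
have ssv S : (v @: S = (s \o s) @: S)%VS.
  by apply: eq_in_limg => x _; rewrite comp_lfunE ssE.
have -> : (v^^k.+1 @: (v^^k @^-1: M) = (s \o s) @: M)%VS.
  by rewrite (limg_comp (v^^k) v) imk ?capvSl // ssv.
rewrite imk // -dim_nvX_img -/W.
rewrite -(eq_ker_dim_limg W ker_s).
exact: square_zero_dim.
Qed.

End Necessity.

(** * Factorizations and twisted roots *)

Section Factorization.
Variables (F : fieldType) (p : isopair F).
Local Notation b := (iform p).
Local Notation V := (fspace (iform p)).
Local Notation u := (iaut p).
Local Notation u' := ((iaut p)^-1%VF).
Local Notation n := (iaut p - \1%VF).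
Local Notation nb := ((iaut p)^-1%VF - \1%VF).
Local Notation v := (wall_op p).
Implicit Types x y z : V.
Hypothesis charF : 2%N \notin [pchar F].

Lemma two_neq0 : 2%:R != 0 :> F.
Proof. by apply: contra charF => /eqP F2; rewrite inE /= F2 eqxx. Qed.

Lemma four_neq0 : 4%:R != 0 :> F.
Proof. by rewrite (natrM _ 2 2) mulf_neq0 // two_neq0. Qed.

Lemma U2_element_skew (a : 'End(V)) :
  (forall x y, b (a x) y = - b x (a y)) -> (forall x, a (a x) = 0) ->
  U2_element (\1%VF + a).
Proof.
move=> a_skew aa; split.
  move=> x y; rewrite !add_lfunE !id_lfunE !bE !a_skew aa b0r; ring.
apply/lfunP => x; rewrite !lfun_expS lfun_exp0 addrC addKr aa.
by rewrite zero_lfunE.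
Qed.

Variable d : 'End(V).
Hypothesis u_unipotent : unipotent p.
Hypothesis d_skew : forall x y, b (d x) y = - b x (d y).
Hypothesis dd : forall x, d (d x) = - v x.
Hypothesis dn : forall x, d (n x) = nb (d x).

Let du x : d (u x) = u' (d x).
Proof. by rewrite uE linearD /= dn u'E. Qed.
Let dnb x : d (nb x) = n (d x).
Proof.
have du' : d (u' x) = u (d x) by rewrite -[d (u' x)]iautVK -du iautVK.
by rewrite nbE linearB /= du' nE.
Qed.
Let dv x : d (v x) = v (d x).
Proof. by rewrite !vE linearD /= dn dnb addrC. Qed.

Let g : 'End(V) := 2%:R *: \1%VF + d.
Let h : 'End(V) := 2%:R *: \1%VF - d.
Let gE x : g x = 2%:R *: x + d x.
Proof. by rewrite add_lfunE scale_lfunE id_lfunE. Qed.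
Let hE x : h x = 2%:R *: x - d x.
Proof. by rewrite add_lfunE scale_lfunE id_lfunE opp_lfunE. Qed.

Let v4_inj x : 4%:R *: x + v x = 0 -> x = 0.
Proof.
move=> x0; have vx : v x = (- 4%:R) *: x.
  by apply/eqP; rewrite -subr_eq0 scaleNr opprK addrC x0.
have vkx k : v^^k x = (- 4%:R) ^+ k *: x.
  elim: k => [|k IHk]; first by rewrite lfun_exp0 expr0 scale1r.
  by rewrite lfun_expS IHk linearZ /= vx scalerA -exprSr.
case: u_unipotent => m nm0; apply/eqP; have /eqP := vkx m.
rewrite wall_op_exp -addnn lfun_expD nm0 zero_lfunE linear0 eq_sym scaler_eq0.
by rewrite expf_eq0 oppr_eq0 (negPf four_neq0) andbF.
Qed.

Let ker_g : lker g == 0%VS.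
Proof.
rewrite -subv0; apply/subvP => x; rewrite memv_ker memv0 gE => /eqP x0.
apply/eqP/v4_inj; have := congr1 h x0; rewrite hE linear0 !lfunL dd.
by move=> <-; vring.
Qed.
Let ker_h : lker h == 0%VS.
Proof.
rewrite -subv0; apply/subvP => x; rewrite memv_ker memv0 hE => /eqP x0.
apply/eqP/v4_inj; have := congr1 g x0; rewrite gE linear0 !lfunL dd.
by move=> <-; vring.
Qed.
Let gK x : g^-1%VF (g x) = x. Proof. exact: lker0_lfunK ker_g _. Qed.
Let gVK x : g (g^-1%VF x) = x. Proof. exact: lker0_lfunVK ker_g _. Qed.
Let hVK x : h (h^-1%VF x) = x. Proof. exact: lker0_lfunVK ker_h _. Qed.
Let g_inj x y : g x = g y -> x = y.
Proof. by move/(congr1 g^-1%VF); rewrite !gK. Qed.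

Let a : 'End(V) := (g^-1 \o (d - nb))%VF.
Let c : 'End(V) := (g^-1 \o (n - d))%VF.

Let ga x : g (a x) = d x - nb x.
Proof. by rewrite comp_lfunE gVK add_lfunE opp_lfunE. Qed.
Let gc x : g (c x) = n x - d x.
Proof. by rewrite comp_lfunE gVK [X in X = _]add_lfunE opp_lfunE. Qed.

Let ah x : a (h x) = d x + n x.
Proof.
apply: g_inj; rewrite ga gE hE !lfunL dd dn vE.
vring.
Qed.

Let ch x : c (h x) = - (nb x + d x).
Proof.
apply: g_inj; rewrite gc gE hE !lfunL dd dnb vE.
vring.
Qed.

Let aa x : a (a x) = 0.
Proof.
rewrite -[x]hVK; set z := (h^-1)%VF x; apply: g_inj.
rewrite ah ga !lfunL dd dn nb_n; vring.
Qed.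

Let cc x : c (c x) = 0.
Proof.
rewrite -[x]hVK; set z := (h^-1)%VF x; apply: g_inj.
rewrite ch gc !lfunL dd dnb n_nb; vring.
Qed.

Let h_adj x y : b x (h y) = b (g x) y.
Proof. rewrite hE gE !bE d_skew; ring. Qed.

Let a_skew x y : b (a x) y = - b x (a y).
Proof.
rewrite -[y]hVK; set z := (h^-1)%VF y.
rewrite h_adj ga ah !bE d_skew nb_adj; ring.
Qed.

Let c_skew x y : b (c x) y = - b x (c y).
Proof.
rewrite -[y]hVK; set z := (h^-1)%VF y.
rewrite h_adj gc ch !bE d_skew n_adj; ring.
Qed.

(** With g = 2 + d and h = 2 - d, which are adjoint to each other and
    invertible, a = g^-1 (d - nb) = (d + n) h^-1 and
    c = g^-1 (n - d) = - (nb + d) h^-1. The two expressions for a make both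
    a^2 = 0 and a^* = - a visible, and the same holds for c. *)
Lemma U2_factorization : exists w1 w2 : 'End(V),
  [/\ U2_element w1, U2_element w2 & u = (w1 \o w2)%VF].
Proof.
exists (\1%VF + a), (\1%VF + c).
split; [exact: U2_element_skew | exact: U2_element_skew |].
apply/lfunP => y; rewrite comp_lfunE !add_lfunE !id_lfunE uE.
rewrite -[y]hVK; set x := (h^-1)%VF y; rewrite -[RHS]addrA; congr (_ + _).
apply: g_inj; rewrite [g (_ + _)]lfunD ga gc ch.
rewrite gE hE !lfunL. rewrite !(dd, dn, dnb, n_nb, nbnb, dv).
rewrite lfunN nbC_v [v x]vE; vring.
Qed.

End Factorization.

(** * Wall invariants inside the layers Im n^i *)

Section WittIndex.
Variables (F : fieldType).
Implicit Types A B : nsform F.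

Lemma witt_index_geq A (W : {vspace fspace A}) :
  totally_isotropic W -> (\dim W <= witt_index A)%N.
Proof.
move=> W0; have ltW : (\dim W < (rk A).+1)%N by rewrite ltnS dimvS // subvf.
pose d := Ordinal ltW; rewrite -[\dim W]/(nat_of_ord d) /witt_index.
by apply: leq_bigmax_cond; apply/asboolP; exists W.
Qed.

Lemma witt_index_attained A : exists2 W : {vspace fspace A},
  totally_isotropic W & \dim W = witt_index A.
Proof.
pose P (d : 'I_(rk A).+1) := `[< exists2 W : {vspace fspace A},
  totally_isotropic W & \dim W = d >].
have P0 : P ord0.
  apply/asboolP; exists 0%VS; last by rewrite dimv0.
  by move=> x y; rewrite !memv0 => /eqP-> _; rewrite linear0l.
have card_P : (0 < #|P|)%N by apply/card_gt0P; exists ord0.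
have [d Pd dE] := eq_bigmax_cond (fun d : 'I_(rk A).+1 => nat_of_ord d) card_P.
by rewrite /witt_index (dE : \max_(d < (rk A).+1 | P d) d = d); apply/asboolP.
Qed.

(** Canonical representatives do not depend linearly on the class, but an
    isometric embedding of a Wall invariant into V needs linear ones. *)
Lemma linear_subquot_section (V : vectType F) (U W : {vspace V}) :
  exists h : 'Hom(subquot U W, subvs_of U), forall z, @subquot_pi F V U W (h z) = z.
Proof.
have pi_lin : linear (@subquot_pi F V U W).
  by move=> a x y; rewrite /subquot_pi vquotD -vquot_scaleE.
pose f := linfun (HB.pack (@subquot_pi F V U W)
  (GRing.isLinear.Build F _ _ *:%R (@subquot_pi F V U W) pi_lin)
  : {linear subvs_of U -> subquot U W}).
have fE x : f x = @subquot_pi F V U W x by rewrite lfunE.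
exists (f^-1)%VF => z; rewrite -fE limg_lfunVK //.
by apply/memv_imgP; exists (repr z); rewrite ?memvf // fE subquot_piK.
Qed.

End WittIndex.

Section ImageLayers.
Variables (F : fieldType) (p : isopair F).
Local Notation b := (iform p).
Local Notation V := (fspace (iform p)).
Local Notation u' := ((iaut p)^-1%VF).
Local Notation n := (iaut p - \1%VF).
Local Notation nb := ((iaut p)^-1%VF - \1%VF).
Local Notation v := (wall_op p).
Implicit Types x y z : V.

Local Notation I k := (limg (n^^k)).
Local Notation K k := (lker (n^^k)).
Local Notation D := (\dim {:V}).
Hypothesis u_unipotent : unipotent p.

(** The kernels of the powers of n are stationary from the exponent dim V on. *)
Lemma unipotent_dim x : n^^D x = 0.
Proof.
have stab m : (D <= m)%N -> K m = K D.
  elim: m => [|m IHm]; first by rewrite leqn0 => /eqP->.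
  rewrite leq_eqVlt => /orP[/eqP->//|]; rewrite ltnS => Dm.
  by rewrite -(IHm Dm) lker_exp_stable.
case: u_unipotent => m nm0; apply/eqP; rewrite -memv_ker -(stab (m + D)%N) ?leq_addl //.
by rewrite memv_ker addnC lfun_expD nm0 zero_lfunE linear0.
Qed.

Lemma limg_exp_sub i j : (i <= j)%N -> (I j <= I i)%VS.
Proof.
move=> /subnK <-; apply/subvP => _ /memv_imgP[y _ ->].
by rewrite addnC lfun_expD memv_img ?memvf.
Qed.

Lemma limg_expD : I D = 0%VS.
Proof.
apply/eqP; rewrite -subv0; apply/subvP => _ /memv_imgP[y _ ->].
by rewrite unipotent_dim mem0v.
Qed.

Lemma nbX_eq0 k x : (nb^^k x == 0) = (n^^k x == 0).
Proof.
rewrite nbX scaler_eq0 signr_eq0 /=.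
by apply/eqP/eqP => [/u'X_eq0//|->]; rewrite linear0.
Qed.

Lemma nbX_nX k x : nb^^k (n^^k x) = (-1) ^+ k *: v^^k x.
Proof. by rewrite nbX -lfun_expD addnn -wall_op_exp. Qed.

Lemma nX_form k x y : b (n^^k x) (n^^k y) = (-1) ^+ k * b x (v^^k y).
Proof. by rewrite nX_adj nbX_nX bZr. Qed.

Lemma ker_img_ortho i j s t x y : x \in I i -> y \in I j ->
  n^^s x = 0 -> n^^t y = 0 -> (s <= j)%N || (t <= i)%N -> b x y = 0.
Proof.
move=> /memv_imgP[x' _ ->] /memv_imgP[y' _ ->] sx ty /orP[sj|ti].
  rewrite bC nX_adj; have -> : nb^^j (n^^i x') = 0; last by rewrite b0r.
  by apply/eqP; rewrite nbX_eq0 (nX_eq0 sj).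
rewrite nX_adj; have -> : nb^^i (n^^j y') = 0; last by rewrite b0r.
by apply/eqP; rewrite nbX_eq0 (nX_eq0 ti).
Qed.

Lemma orthov_limg k : orthov b (I k) = K k.
Proof.
apply/vspaceP => x; rewrite memv_ker -nbX_eq0; apply/mem_orthovP/eqP => [x0|x0 y].
  have /nondegenerateP := fformP (iform p); apply=> y.
  by rewrite bC -nX_adj bC x0 // memv_img ?memvf.
by case/memv_imgP => z _ ->; rewrite bC nX_adj x0 b0r.
Qed.

Lemma u'XC_nX j k x : u'^^j (n^^k x) = n^^k (u'^^j x).
Proof.
apply: lfun_exp_comm => y; apply/esym.
by apply: (lfun_exp_comm (f := n) (g := u')) => z; rewrite u'C_n.
Qed.

(** In other words Ker n^k + Im n^k is the whole orthogonal of Im n^k :&: Ker n^k,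
    the latter being n^k (Ker n^(2k)). *)
Lemma orthov_ker_img k x : {in (I k :&: K k)%VS, forall y, b x y = 0} ->
  x \in (K k + I k)%VS.
Proof.
move=> x0; have : nb^^k x \in limg (nb^^(k.*2)).
  apply: (@orthov_lker _ _ (n^^(k.*2))) => [y z|z]; first by rewrite bC nX_adj bC.
  rewrite memv_ker -addnn lfun_expD => /eqP nz; rewrite bC -nX_adj bC x0 //.
  by rewrite memv_cap memv_img ?memvf //= memv_ker nz.
case/memv_imgP => y _; rewrite -addnn lfun_expD => xy.
rewrite -[x](subrK (nb^^k y)) memv_add //.
  by rewrite memv_ker -nbX_eq0 linearB /= xy subrr.
by rewrite nbX memvZ // u'XC_nX memv_img ?memvf.
Qed.

(** The totally isotropic subspace L of Im n^m: in a Jordan basis it is spanned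
    by the vectors of Im n^m that lie strictly below the middle of their block.
    Its companion [img_kerS] also includes the middle vectors of the blocks of
    odd size, on which the Wall invariants live. *)
Definition img_ker m : {vspace V} := (\sum_(m <= i < D) (I i :&: K i))%VS.
Definition img_kerS m : {vspace V} := (\sum_(m <= i < D) (I i :&: K i.+1))%VS.

Lemma img_kerP (e : nat -> nat) m (W : {vspace V}) :
  (forall i, (m <= i < D)%N -> (I i :&: K (e i) <= W)%VS) ->
  (\sum_(m <= i < D) (I i :&: K (e i)) <= W)%VS.
Proof.
move=> sub; rewrite big_seq_cond; apply: (big_ind (fun U => (U <= W)%VS)).
- exact: sub0v.
- by move=> U1 U2 U1W U2W; rewrite subv_add U1W.
- by move=> i; rewrite mem_index_iota andbT; apply: sub.
Qed.

Lemma img_ker_sup (e : nat -> nat) m i : (m <= i < D)%N ->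
  (I i :&: K (e i) <= \sum_(m <= i < D) (I i :&: K (e i)))%VS.
Proof.
move=> mi; rewrite (big_rem i) ?mem_index_iota //=; exact: addvSl.
Qed.

Lemma img_ker_img m : (img_ker m <= I m)%VS.
Proof.
apply: img_kerP => i /andP[mi _]; apply: subv_trans (capvSl _ _) _.
exact: limg_exp_sub.
Qed.

Lemma img_kerS_img m : (img_kerS m <= I m)%VS.
Proof.
apply: (img_kerP (e := succn)) => i /andP[mi _].
apply: subv_trans (capvSl _ _) _; exact: limg_exp_sub.
Qed.

Lemma img_ker_kerS m : (img_ker m <= img_kerS m)%VS.
Proof.
apply: img_kerP => i mi; apply: subv_trans (img_ker_sup succn mi).
by rewrite capvS // lker_exp_sub.
Qed.

Lemma img_kerS_ortho m : (img_kerS m <= orthov b (img_ker m))%VS.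
Proof.
apply: (img_kerP (e := succn)) => i mi; rewrite orthov_sym.
apply: img_kerP => j mj; rewrite orthov_sym; apply/orthovP => x y.
move=> /memv_capP[Ix Kx] /memv_capP[Iy Ky]; apply: ker_img_ortho Ix Iy _ _ _.
- by apply/eqP; rewrite -memv_ker; exact: Kx.
- by apply/eqP; rewrite -memv_ker; exact: Ky.
by case: (ltnP i j) => //= ->.
Qed.

Lemma img_ker_isotropic m : isotropic b (img_ker m).
Proof. exact/isotropic_orthov/subv_trans/img_kerS_ortho/img_ker_kerS. Qed.

(** The orthogonal of L is the intersection of the spaces Ker n^i + Im n^i. By
    the modular law a vector of Im n^m in this intersection lies, by induction on
    j, in the sum of the Im n^i :&: Ker n^(i+1) for i < j, up to Im n^j. *)
Lemma orthov_img_ker m : (m <= D)%N ->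
  (I m :&: orthov b (img_ker m) <= img_kerS m)%VS.
Proof.
move=> mD; apply/subvP => x /memv_capP[Ix /mem_orthovP x0].
have step j : (m <= j <= D)%N ->
    x \in (\sum_(m <= i < j) (I i :&: K i.+1) + I j)%VS.
  elim: j => [|j IHj]; first by rewrite leqn0 => /andP[/eqP <- _]; rewrite big_geq ?add0v.
  case/andP; rewrite leq_eqVlt => /orP[/eqP <-|]; first by rewrite big_geq ?add0v.
  rewrite ltnS => mj jD; rewrite big_nat_recr //=.
  have [|s sS [y Iy xE]] := memv_addP (IHj _); first by rewrite mj ltnW.
  have Ks : s \in K j.+1.
    suff: (\sum_(m <= i < j) (I i :&: K i.+1) <= K j.+1)%VS by move/subvP; apply.
    rewrite big_seq_cond; apply: (big_ind (fun U => (U <= K j.+1)%VS)).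
    - exact: sub0v.
    - by move=> U1 U2 U1W U2W; rewrite subv_add U1W.
    - move=> i; rewrite mem_index_iota andbT => /andP[_ ij].
      by apply: subv_trans (capvSr _ _) _; rewrite lker_exp_sub // ltnW.
  have : x \in (K j.+1 + I j.+1)%VS.
    move: jD; rewrite leq_eqVlt => /orP[/eqP ->|jD].
      by apply: (subvP (addvSl _ _)); rewrite memv_ker unipotent_dim.
    apply: orthov_ker_img => t It; apply: x0.
    by apply: (subvP (img_ker_sup id _)) It; rewrite jD andbT ltnW.
  case/memv_addP=> k Kk [z Iz xE'].
  have -> : x = s + (y - z) + z by rewrite -addrA subrK.
  rewrite memv_add // memv_add // memv_cap rpredB //=; last first.
    exact: (subvP (limg_exp_sub (leqnSn j))).
  have -> : y - z = k - s by apply/eqP; rewrite subr_eq addrAC -xE' xE addrC addKr.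
  by rewrite rpredB.
by have := step D; rewrite mD leqnn limg_expD addv0; apply.
Qed.

End ImageLayers.

Section Embedding.
Variables (F : fieldType) (p : isopair F).
Local Notation b := (iform p).
Local Notation V := (fspace (iform p)).
Local Notation n := (iaut p - \1%VF).

Local Notation I k := (limg (n^^k)).
Local Notation K k := (lker (n^^k)).
Local Notation D := (\dim {:V}).
Hypothesis u_unipotent : unipotent p.

(** A is isometric to a complement of L in its orthogonal relatively to Im n^m,
    that is, to L^perp / L. *)
Definition embeds_in_layers (A : nsform F) (m : nat) : Prop :=
  exists g : 'Hom(fspace A, V),
    [/\ forall x y : fspace A, b (g x) (g y) = A x y, (limg g <= img_kerS p m)%VS &
        (img_kerS p m <= limg g + img_ker p m)%VS].

Lemma embeds_perpC A A' m : embeds_in_layers (perp A A') m ->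
  embeds_in_layers (perp A' A) m.
Proof.
case=> g [g_iso gU Ug].
pose s (x : fspace A' * fspace A) : fspace A * fspace A' := (x.2, x.1).
have s_lin : linear (s : fspace A' * fspace A -> fspace A * fspace A') by [].
pose S := linfun (HB.pack s (GRing.isLinear.Build F _ _ *:%R s s_lin)
  : {linear (fspace A' * fspace A)%type -> (fspace A * fspace A')%type}).
have SE x : S x = (x.2, x.1) by rewrite lfunE.
have imS : (limg (g \o S) = limg g)%VS.
  rewrite limg_comp; suff -> : limg S = fullv by [].
  apply/vspaceP => x; rewrite memvf; apply/memv_imgP; exists (x.2, x.1).
    exact: memvf.
  by rewrite SE; case: x.
exists (g \o S)%VF; split; rewrite ?imS // => x y.
by rewrite !comp_lfunE g_iso !SE [LHS]addrC.
Qed.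

(** The map n^m carries Ker n^(2m+1) onto Im n^m :&: Ker n^(m+1) and
    turns (-1)^m f_m into b; the denominator of the Wall invariant goes
    into L. *)
Lemma wall_layer m : (m < D)%N ->
  exists g : 'Hom(fspace (signed m (wall_invariant p m)), V),
  [/\ forall x y : fspace (wall_invariant p m),
        b (g x) (g y) = signed m (wall_invariant p m) x y,
      (limg g <= I m :&: K m.+1)%VS &
      (I m :&: K m.+1 <= limg g + img_ker p m)%VS].
Proof.
move=> mD.
have [h hK] := linear_subquot_section (wall_ker p m.*2.+1) (wall_den p m.*2.+1).
pose vs : 'Hom(subvs_of (wall_ker p m.*2.+1), V) := linfun (@vsval _ _ _).
have vsE x : vs x = vsval x by rewrite lfunE.
pose G : 'Hom(subquot (wall_ker p m.*2.+1) (wall_den p m.*2.+1), V) :=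
  (n^^m \o vs \o h)%VF.
have GE z : G z = n^^m (vsval (h z)) by rewrite !comp_lfunE vsE.
exists G; split.
- move=> x y; rewrite !GE nX_form.
  rewrite -[x in RHS]hK -[y in RHS]hK; congr (_ * _).
  by rewrite [RHS]subquot_formE.
- apply/subvP => _ /memv_imgP[x _ ->]; rewrite !comp_lfunE memv_cap memv_img ?memvf //=.
  rewrite memv_ker -[(n \o n^^m)%VF]/(n^^m.+1) -lfun_expD vsE addSn addnn -memv_ker.
  exact: subvsP.
apply/subvP => y /memv_capP[/memv_imgP[t _ ->]].
rewrite memv_ker -lfun_expD addSn addnn -memv_ker => Kt.
pose t' : subvs_of (wall_ker p m.*2.+1) := vsproj _ t.
have t'E : vsval t' = t by rewrite vsprojK.
set z := subquot_pi (wall_den p m.*2.+1) t'.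
have : vsval (h z) - t \in wall_den p m.*2.+1.
  have /eqP := hK z; rewrite /z {2}/subquot_pi [X in X == _]/subquot_pi vquotE.
  by rewrite -memv_preim lfunE /= t'E.
case/memv_addP => k Kk [_ /memv_capP[/memv_imgP[r _ ->] Kr] tE].
have -> : n^^m t = G z - (n^^m k + n^^m.+1 r).
  rewrite GE lfun_expSr -linearD /= -tE linearB /=.
  by rewrite opprB addrCA subrr addr0.
apply: memv_add; first by rewrite memv_img ?memvf.
rewrite rpredN rpredD //.
  apply: (subvP (img_ker_sup (p := p) id (m := m) (i := m) _)); first by rewrite leqnn.
  by rewrite memv_cap memv_img ?memvf // andTb memv_ker -lfun_expD addnn -memv_ker.
have [mD'|Dm] := ltnP m.+1 D; last first.
  have /eqP mD' : m.+1 == D by rewrite eqn_leq mD.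
  by rewrite mD' unipotent_dim // mem0v.
apply: (subvP (img_ker_sup (p := p) id (m := m) (i := m.+1) _)); first by rewrite leqnSn.
rewrite memv_cap memv_img ?memvf // andTb memv_ker -lfun_expD addSn addnS.
by rewrite addnn lfun_expSr -memv_ker.
Qed.

Definition signed_wall_perp m : nsform F :=
  \big[@perp F/zform F]_(m <= i < D) signed i (wall_invariant p i).

Lemma img_ker_recl m : (m < D)%N ->
  img_ker p m = (I m :&: K m + img_ker p m.+1)%VS.
Proof. by move=> mD; rewrite /img_ker big_ltn. Qed.

Lemma img_kerS_recl m : (m < D)%N ->
  img_kerS p m = (I m :&: K m.+1 + img_kerS p m.+1)%VS.
Proof. by move=> mD; rewrite /img_kerS big_ltn. Qed.

Lemma embeds_wall_perp m : embeds_in_layers (signed_wall_perp m) m.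
Proof.
have [k] := ubnP (D - m); elim: k m => // k IHk m; rewrite ltnS => Dmk.
have [Dm|mD] := leqP D m.
  rewrite /signed_wall_perp big_geq //; exists 0; split.
  - move=> x y; rewrite zero_lfunE b0l; symmetry; exact: (linear0l (zform F) y).
  - by rewrite lim0g sub0v.
  by rewrite /img_kerS big_geq // sub0v.
have [|g' [g'_iso g'U Ug']] := IHk m.+1; first by lia.
have [g [g_iso gU Ug]] := wall_layer mD.
rewrite /signed_wall_perp big_ltn // -/(signed_wall_perp m.+1).
set A := signed _ _ in g g_iso gU Ug *.
set A' := signed_wall_perp _ in g' g'_iso g'U Ug' *.
pose f (x : fspace A * fspace A') : V := g x.1 + g' x.2.
have f_lin : linear f by move=> a x y; rewrite /f !linearP /= scalerDr addrACA.
pose G := linfun (HB.pack f (GRing.isLinear.Build F _ _ *:%R f f_lin)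
  : {linear (fspace A * fspace A')%type -> V}).
have GE x : G x = g x.1 + g' x.2 by rewrite lfunE.
have imG : limg G = (limg g + limg g')%VS.
  apply/vspaceP => x; apply/memv_imgP/memv_addP => [[y _ ->]|].
    by rewrite GE; exists (g y.1); rewrite ?memv_img ?memvf //; exists (g' y.2);
      rewrite ?memv_img ?memvf.
  case=> _ /memv_imgP[y _ ->] [_ /memv_imgP[z _ ->] ->].
  by exists (y, z); rewrite ?memvf // GE.
have gg' y z : b (g y) (g' z) = 0.
  have /memv_capP[Iy Ky] := subvP gU _ (memv_img g (memvf y)).
  suff /orthovP : (limg g' <= orthov b (limg g))%VS.
    by move=> orth; rewrite bC orth // memv_img ?memvf.
  apply: subv_trans g'U _; apply: (img_kerP (e := succn)) => i /andP[mi iD].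
  apply/orthovP => t r /memv_capP[It Kt] /(subvP gU)/memv_capP[Ir Kr].
  apply: ker_img_ortho It Ir _ _ _; try by apply/eqP; rewrite -memv_ker; eassumption.
  by rewrite mi orbT.
exists G; split.
- move=> x y; rewrite !GE !bE g_iso g'_iso gg' [b (g' _) (g _)]bC gg'.
  by rewrite addr0 add0r.
- by rewrite imG img_kerS_recl // addvS.
rewrite imG img_kerS_recl // img_ker_recl // subv_add; apply/andP; split.
  apply: subv_trans Ug _; rewrite img_ker_recl // addvS ?addvSl //.
apply: subv_trans Ug' _; rewrite addvS ?addvSr //.
Qed.

Section Layers.
Variables (A : nsform F) (m : nat).
Hypothesis (mD : (m <= D)%N) (A_emb : embeds_in_layers A m).

Lemma img_ker_capK : (img_ker p m :&: K m = I m :&: K m)%VS.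
Proof.
apply/eqP; rewrite eqEsubv; apply/andP; split; first by rewrite capvS ?img_ker_img.
rewrite subv_cap capvSr andbT; move: mD; rewrite leq_eqVlt => /orP[/eqP->|mD'].
  by rewrite limg_expD // cap0v sub0v.
by rewrite img_ker_recl // addvSl.
Qed.

(** Im n^m has radical Im n^m :&: Ker n^m, and L is isotropic with orthogonal
    A + L there; the count follows. *)
Lemma dim_layers : (rk A + (\dim (img_ker p m)).*2 = \dim (I m) + \dim (I m :&: K m))%N.
Proof.
case: A_emb => g [g_iso gU Ug].
have kg : lker g == 0%VS.
  rewrite -subv0; apply/subvP => x; rewrite memv_ker memv0 => /eqP gx.
  apply/eqP; have /nondegenerateP := fformP A; apply=> y.
  by rewrite -g_iso gx b0l.
have capg : (limg g :&: img_ker p m = 0)%VS.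
  apply/eqP; rewrite -subv0; apply/subvP => _ /memv_capP[/memv_imgP[x _ ->] gL].
  rewrite memv0; suff -> : x = 0 by rewrite linear0.
  have /nondegenerateP := fformP A; apply=> y.
  rewrite -g_iso bC; have /orthovP := img_kerS_ortho p m; apply=> //.
  by apply: (subvP gU); rewrite memv_img ?memvf.
have UE : (img_kerS p m = limg g + img_ker p m)%VS.
  by apply/eqP; rewrite eqEsubv Ug subv_add gU img_ker_kerS.
have UE' : (img_kerS p m = I m :&: orthov b (img_ker p m))%VS.
  apply/eqP; rewrite eqEsubv orthov_img_ker // andbT subv_cap img_kerS_img.
  exact: img_kerS_ortho.
have := dim_orthov_eq b (I m) (img_ker p m); rewrite orthov_limg img_ker_capK -UE' UE.
rewrite dimv_disjoint_sum // (limg_dim_eq (f := g)) ?(eqP kg) ?capv0 // /rk; lia.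
Qed.

(** Together with [layers_from_isotropic], this is the invariance of the
    anisotropic part of b on Im n^m under reduction modulo L, with Witt indices
    counted modulo the radical on the left. *)
Lemma isotropic_from_layers (S : {vspace V}) : (S <= I m)%VS -> isotropic b S ->
  (\dim (n^^m @: S) + \dim (I m :&: K m) <= witt_index A + \dim (img_ker p m))%N.
Proof.
case: A_emb => g [g_iso gU Ug] SI S0.
pose S1 := (S + (I m :&: K m))%VS; set L := img_ker p m.
have S10 : isotropic b S1.
  apply: isotropicD => // [x y /memv_capP[_ Kx] /memv_capP[Iy _]|].
    by move: Kx; rewrite -orthov_limg => /mem_orthovP; apply.
  rewrite orthov_sym; apply: subv_trans (capvSr _ _) _.
  rewrite -orthov_limg; apply/orthovP => x y Ix Sy.
  by move: Ix => /mem_orthovP; apply; apply: (subvP SI).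
have S1I : (S1 <= I m)%VS by rewrite subv_add SI capvSl.
have dimS1 : (\dim (n^^m @: S) + \dim (I m :&: K m) <= \dim S1)%N.
  rewrite -(limg_ker_dim (n^^m) S1) addnC leq_add //.
    by rewrite dimvS // subv_cap capvSr andbT addvSr.
  by rewrite dimvS // limgS // addvSl.
have L0 : isotropic b L by apply: img_ker_isotropic.
pose S2 := (S1 :&: orthov b L + L)%VS.
have dimS2 := leq_dim_isotropicD S10 L0.
have S20 : isotropic b S2 by apply: isotropic_replace.
have S2U : (S2 <= limg g + L)%VS.
  rewrite subv_add addvSr andbT; apply: subv_trans Ug.
  by apply: subv_trans (orthov_img_ker _ _) => //; rewrite capvS.
pose Z := (g @^-1: S2)%VS.
have Z0 : totally_isotropic Z.
  by move=> x y; rewrite -!memv_preim => Sx Sy; rewrite -g_iso S20.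
have S2E : S2 = (S2 :&: limg g + L)%VS.
  by rewrite vspace_modr ?addvSr //; apply/esym/capv_idPl.
have dimZ : (\dim (S2 :&: limg g) <= \dim Z)%N.
  rewrite -(lpreimK (capvSr S2 (limg g))) lpreim_cap_limg.
  by rewrite -(limg_ker_dim g Z) leq_addl.
have := witt_index_geq Z0; have := dimv_sum_cap (S2 :&: limg g) L.
rewrite -S2E -/S2 in dimS2 *; lia.
Qed.

Lemma layers_from_isotropic : exists S : {vspace V},
  [/\ (S <= I m)%VS, isotropic b S &
   (witt_index A + \dim (img_ker p m) <= \dim (n^^m @: S) + \dim (I m :&: K m))%N].
Proof using A_emb.
case: A_emb => g [g_iso gU Ug]; have [Z Z0 <-] := witt_index_attained A.
set L := img_ker p m; have gZU : (g @: Z <= img_kerS p m)%VS.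
  by apply: subv_trans gU; rewrite limgS ?subvf.
have gZL : (g @: Z <= orthov b L)%VS by apply: subv_trans gZU (img_kerS_ortho p m).
exists (g @: Z + L)%VS; split.
- by rewrite subv_add img_ker_img (subv_trans gZU) ?img_kerS_img.
- apply: isotropicD => //; last exact: img_ker_isotropic.
  by move=> _ _ /memv_imgP[x Zx ->] /memv_imgP[y Zy ->]; rewrite g_iso Z0.
have capg : (g @: Z :&: L = 0)%VS.
  apply/eqP; rewrite -subv0; apply/subvP => _ /memv_capP[/memv_imgP[x _ ->] gL].
  rewrite memv0; suff -> : x = 0 by rewrite linear0.
  have /nondegenerateP := fformP A; apply=> y.
  rewrite -g_iso bC; have /orthovP := img_kerS_ortho p m; apply=> //.
  by apply: (subvP gU); rewrite memv_img ?memvf.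
have kg : (Z :&: lker g = 0)%VS.
  apply/eqP; rewrite -subv0; apply/subvP => x /memv_capP[_].
  rewrite memv_ker memv0 => /eqP gx.
  apply/eqP; have /nondegenerateP := fformP A; apply=> y.
  by rewrite -g_iso gx b0l.
have := limg_ker_dim (n^^m) (g @: Z + L).
rewrite dimv_disjoint_sum // (limg_dim_eq (f := g)) //.
suff /dimvS : ((g @: Z + L) :&: K m <= I m :&: K m)%VS by clear mD; lia.
by rewrite capvS // subv_add img_ker_img (subv_trans gZU) ?img_kerS_img.
Qed.

End Layers.

End Embedding.

Section WittCriterion.
Variables (F : fieldType) (p : isopair F).
Local Notation b := (iform p).
Local Notation V := (fspace (iform p)).
Local Notation n := (iaut p - \1%VF).
Local Notation v := (wall_op p).

Local Notation I k := (limg (n^^k)).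
Local Notation K k := (lker (n^^k)).
Local Notation D := (\dim {:V}).
Hypothesis u_unipotent : unipotent p.

Lemma limg_expD_img i j : (n^^i @: I j = I (i + j))%VS.
Proof.
rewrite -limg_comp; apply: eq_in_limg => x _.
by rewrite comp_lfunE lfun_expD.
Qed.

Lemma dim_img_cap_ker i j : (\dim (I i :&: K j) + \dim (I (j + i)) = \dim (I i))%N.
Proof. by rewrite -limg_expD_img limg_ker_dim. Qed.

(** Consecutive subspaces L differ by Im n^k :&: Ker n^k. Combined with
    [dim_layers] at k+1, this gives the exact correction term in
    [witt_simplifies_wall_condition]. *)
Lemma dim_img_ker_rec k : (k < D)%N ->
  (\dim (img_ker p k) + \dim (I k.+1 :&: K k) =
   \dim (I k :&: K k) + \dim (img_ker p k.+1))%N.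
Proof.
move=> kD; rewrite img_ker_recl // -(dimv_sum_cap (I k :&: K k)); congr (_ + \dim _)%N.
apply/eqP; rewrite eqEsubv; apply/andP; split; last first.
  rewrite subv_cap (subv_trans (capvSr _ _) (img_ker_img p _)).
  exact: subv_trans (capvSl _ _) (capvSr _ _).
rewrite subv_cap capvS ?limg_exp_sub // andTb.
have [kD'|Dk] := ltnP k.+1 D.
  apply: subv_trans (img_ker_sup (p := p) id (m := k.+1) (i := k.+1) _).
    exact: capvS (subvv _) (lker_exp_sub _ (leqnSn k)).
  by rewrite leqnn.
have /eqP kD' : k.+1 == D by rewrite eqn_leq kD.
by rewrite kD' limg_expD // cap0v sub0v.
Qed.

Lemma isotropic_img m (T : {vspace V}) : isotropic (@wall_pre F p m) T ->
  isotropic b (n^^m @: T).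
Proof.
move=> T0 _ _ /memv_imgP[x Tx ->] /memv_imgP[y Ty ->].
by rewrite nX_form [b _ _]T0 // mulr0.
Qed.

Lemma isotropic_preim m (S : {vspace V}) : isotropic b S ->
  isotropic (@wall_pre F p m) (n^^m @^-1: S).
Proof.
move=> S0 x y; rewrite -!memv_preim => Sx Sy; have := S0 _ _ Sx Sy.
by rewrite nX_form => /eqP; rewrite mulf_eq0 signr_eq0 => /eqP.
Qed.

Lemma dim_vX_nX m (T : {vspace V}) : \dim (v^^m @: T) = \dim (n^^m @: (n^^m @: T)).
Proof.
rewrite dim_vX_img -limg_comp; apply: eq_ker_dim_limg => x.
by rewrite comp_lfunE -lfun_expD addnn.
Qed.

Lemma rk_zform : rk (zform F) = 0%N.
Proof.
apply/eqP; rewrite dimv_eq0 -subv0; apply/subvP => x _.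
by rewrite memv0 (thinmx0 (x : 'rV_0)).
Qed.

Lemma witt_simplifies_wall_condition k :
  witt_simplifies (signed k (wall_invariant p k)) (wall_perp_above p k) <->
  @wall_condition F p fullv k.
Proof.
have [Dk|kD] := leqP D k.
  split=> _; last first.
    have -> : wall_perp_above p k = zform F by apply: big_geq; apply: leqW.
    by rewrite /witt_simplifies rk_zform.
  exists 0%VS, 0%VS; split;
    try by split=> [|x y]; rewrite ?sub0v // memv0 => /eqP-> _; exact: b0l.
  have -> : (n^^(k.*2.+1) @: fullv = 0)%VS; last by rewrite dimv0.
  apply/eqP; rewrite -subv0; apply/subvP => _ /memv_imgP[x _ ->].
  rewrite memv0; apply/eqP/(nX_eq0 _ (unipotent_dim u_unipotent x)).
  by rewrite ltnW // ltnS -addnn (leq_trans Dk) ?leq_addr.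
set B := signed _ _; set A1 := wall_perp_above p k.
have emb1 : @embeds_in_layers F p A1 k.+1 by apply: embeds_wall_perp.
have emb0 : @embeds_in_layers F p (perp A1 B) k.
  apply: embeds_perpC; have := embeds_wall_perp u_unipotent k.
  by rewrite /signed_wall_perp big_ltn.
have dims1 := dim_layers u_unipotent kD emb1.
have dimsL := dim_img_ker_rec kD.
have dimsK2 := dim_img_cap_ker k.+1 k.
have rkB : (k + k.+1)%N = k.*2.+1 by lia.
rewrite rkB in dimsK2; split=> [simp | [T0 [T1 [[_ T0i] [_ T1i] dimT]]]].
  have [S0 [S0I S0i dimS0]] := layers_from_isotropic emb0.
  have [S1 [S1I S1i dimS1]] := layers_from_isotropic emb1.
  (* f_k is, up to sign, the pullback of b under n^k. *)
  exists (n^^k @^-1: S0)%VS, (n^^k.+1 @^-1: S1)%VS; split.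
  - by split; [exact: subvf | exact: isotropic_preim].
  - by split; [exact: subvf | exact: isotropic_preim].
  rewrite !dim_vX_nX !lpreimK //; move: simp; rewrite /witt_simplifies; lia.
have S0i := isotropic_img T0i; have S1i := isotropic_img T1i.
have := isotropic_from_layers u_unipotent (ltnW kD) emb0 (limgS _ (subvf T0)) S0i.
have := isotropic_from_layers u_unipotent kD emb1 (limgS _ (subvf T1)) S1i.
rewrite -!dim_vX_nX /witt_simplifies; lia.
Qed.

End WittCriterion.

(** * Orthogonal splitting *)

Section Splitting.
Variables (F : fieldType) (p : isopair F).
Local Notation b := (iform p).
Local Notation V := (fspace (iform p)).
Local Notation u := (iaut p).
Local Notation n := (iaut p - \1%VF).
Local Notation nb := ((iaut p)^-1%VF - \1%VF).
Local Notation v := (wall_op p).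
Local Notation w := (iaut p - (iaut p)^-1%VF).
Implicit Types x y z : V.

Implicit Types U W T M : {vspace V}.

Definition stable U := {in U, forall x, n x \in U}.
Definition nondegenerate_on U := {in U, forall x, {in U, forall y, b x y = 0} -> x = 0}.

(** The operator a - c attached to a factorization (1 + a)(1 + c) of u, on U.
    Commuting past n as n d = d nb is the same as d u = u^-1 d. *)
Definition twisted_root U (d : 'End(V)) :=
  {in U, forall x, d x \in U /\ d (d x) = - v x} /\
  {in U, forall x, d (n x) = nb (d x)} /\
  {in U &, forall x y, b (d x) y = - b x (d y)}.

(** An injective endomorphism preserving U is onto U, so u^-1 preserves U too. *)
Lemma stable_nb U : stable U -> {in U, forall x, nb x \in U}.
Proof.
move=> Un x Ux.
have uU : (u @: U <= U)%VS.
  by apply/subvP => _ /memv_imgP[y Uy ->]; rewrite uE rpredD // Un.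
have /eqP eqU : (u @: U == U)%VS.
  by rewrite eqEdim uU (limg_dim_eq (f := u)) ?(eqP (iaut_inj p)) ?capv0 ?leqnn.
move: (Ux); rewrite -{1}eqU => /memv_imgP[y Uy ->].
by rewrite nbE iautK rpredB // uE rpredD // Un.
Qed.

Lemma stable_v U : stable U -> {in U, forall x, v x \in U}.
Proof. by move=> Un x Ux; rewrite vE rpredD ?stable_nb // Un. Qed.

Lemma stable_w U : stable U -> {in U, forall x, w x \in U}.
Proof. by move=> Un x Ux; rewrite wE rpredB ?stable_nb // Un. Qed.

Lemma stable_exp (f : 'End(V)) U k :
  {in U, forall x, f x \in U} -> {in U, forall x, f^^k x \in U}.
Proof.
move=> Uf x Ux; elim: k => [|k IHk]; first by rewrite lfun_exp0.
by rewrite lfun_expS Uf.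
Qed.

Lemma stable_nX U k : stable U -> {in U, forall x, n^^k x \in U}.
Proof. exact: stable_exp. Qed.
Lemma stable_vX U k : stable U -> {in U, forall x, v^^k x \in U}.
Proof. by move=> Un; apply/stable_exp/stable_v. Qed.

Section Complement.
Variables (U W : {vspace V}).
Hypotheses (Un : stable U) (U_nd : nondegenerate_on U).
Hypotheses (WU : (W <= U)%VS) (Wn : stable W) (W_nd : nondegenerate_on W).
Let U' := (U :&: orthov b W)%VS.

Lemma complement_cap : (W :&: U' = 0)%VS.
Proof.
apply/eqP; rewrite -subv0; apply/subvP => x.
move=> /memv_capP[Wx /memv_capP[_ /mem_orthovP x0]].
by rewrite memv0; apply/eqP/W_nd.
Qed.

Lemma complement_add : (W + U' = U)%VS.
Proof.
apply/eqP; rewrite eqEdim subv_add WU capvSl /=.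
rewrite dimv_disjoint_sum ?complement_cap //.
by have := dim_orthov_eq b U W; rewrite -/U'; lia.
Qed.

Lemma complement_ortho : {in W & U', forall x y, b x y = 0}.
Proof. by move=> x y Wx /memv_capP[_ /mem_orthovP]; rewrite bC; apply. Qed.

Lemma complement_stable : stable U'.
Proof.
move=> x /memv_capP[Ux /mem_orthovP x0]; rewrite memv_cap Un //=.
by apply/mem_orthovP => y Wy; rewrite n_adj x0 // stable_nb.
Qed.

Lemma complement_nondegenerate : nondegenerate_on U'.
Proof.
move=> x U'x x0; have /memv_capP[Ux _] := U'x; apply: U_nd => // y.
rewrite -complement_add => /memv_addP[y1 Wy [y2 Uy ->]].
by rewrite bDr (x0 y2) // bC complement_ortho // addr0.
Qed.

Lemma complement_dim_img (f : 'End(V)) :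
  {in W, forall x, f x \in W} -> {in U', forall x, f x \in U'} ->
  (\dim (f @: U) = \dim (f @: W) + \dim (f @: U'))%N.
Proof.
move=> fW fU; rewrite -complement_add limgD dimv_disjoint_sum //.
apply/eqP; rewrite -subv0 -complement_cap.
by apply: capvS; apply/subvP => _ /memv_imgP[x Hx ->]; [exact: fW | exact: fU].
Qed.

Lemma twisted_root_add d1 d2 : twisted_root W d1 -> twisted_root U' d2 ->
  exists d, twisted_root U d.
Proof.
move=> [d1W [d1n d1s]] [d2U [d2n d2s]].
pose d := (d1 \o daddv_pi W U')%VF + (d2 \o daddv_pi U' W)%VF.
have capUW : (U' :&: W = 0)%VS by rewrite capvC complement_cap.
have piW x : x \in U' -> daddv_pi W U' x = 0.
  move=> U'x; have := daddv_pi_add complement_cap (w := x).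
  rewrite complement_add => /(_ (subvP (capvSl _ _) _ U'x)).
  by rewrite (daddv_pi_id capUW) // => /eqP; rewrite -subr_eq0 addrK => /eqP.
have piU x : x \in W -> daddv_pi U' W x = 0.
  move=> Wx; have := daddv_pi_add complement_cap (w := x).
  rewrite complement_add => /(_ (subvP WU _ Wx)).
  by rewrite (daddv_pi_id complement_cap) // addrC => /eqP; rewrite -subr_eq0 addrK => /eqP.
have dW x : x \in W -> d x = d1 x.
  move=> Wx; rewrite /d add_lfunE !comp_lfunE piU // linear0 addr0.
  by rewrite daddv_pi_id // complement_cap.
have dU x : x \in U' -> d x = d2 x.
  by move=> Ux; rewrite /d add_lfunE !comp_lfunE piW // linear0 add0r daddv_pi_id.
have U'n := complement_stable.
exists d; split; [|split].
- move=> x; rewrite -complement_add => /memv_addP[y Wy [z Uz ->]].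
  have [d1y dd1] := d1W y Wy; have [d2z dd2] := d2U z Uz.
  rewrite lfunD (dW y) // (dU z) // lfunD (dW (d1 y)) // (dU (d2 z)) // dd1 dd2.
  split; last by rewrite lfunD opprD.
  exact: memv_add.
- move=> x; rewrite -complement_add => /memv_addP[y Wy [z Uz ->]].
  rewrite !lfunD (dW y) // (dU z) // (dW (n y)) ?Wn // (dU (n z)) ?U'n //.
  by rewrite d1n // d2n.
move=> x x'; rewrite -complement_add.
move=> /memv_addP[y Wy [z Uz ->]] /memv_addP[y' Wy' [z' Uz' ->]].
have [d1y _] := d1W y Wy; have [d2z _] := d2U z Uz.
have [d1y' _] := d1W y' Wy'; have [d2z' _] := d2U z' Uz'.
rewrite !lfunD (dW y) // (dU z) // (dW y') // (dU z') // !bE (d1s y y') // (d2s z z') //.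
rewrite (complement_ortho d1y Uz') (complement_ortho Wy d2z').
rewrite [b (d2 z) y']bC [b z (d1 y')]bC.
by rewrite (complement_ortho Wy' d2z) (complement_ortho d1y' Uz); ring.
Qed.

(** If M is Lagrangian for f_j in W modulo the radical, an isotropic subspace
    of U can be moved between M and its orthogonal M + U', then projected to
    the complement U' of W; this costs at most dim v^j M. *)
Lemma isotropic_complement j M T :
  (M <= W)%VS -> isotropic (@wall_pre F p j) M ->
  (\dim (v^^j @: W) <= (\dim (v^^j @: M)).*2)%N ->
  (T <= U)%VS -> isotropic (@wall_pre F p j) T ->
  exists T', [/\ (T' <= U')%VS, isotropic (@wall_pre F p j) T' &
    (\dim (v^^j @: T) <= \dim (v^^j @: T') + \dim (v^^j @: M))%N].
Proof.
move=> MW M0 dimM TU T0; pose k := lker (v^^j); pose f : {symmetric V} := @wall_pre F p j.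
have f_ker x y : y \in k -> f x y = 0.
  by rewrite memv_ker => /eqP vy; change (b x (v^^j y) = 0); rewrite vy b0r.
have addk X Y : isotropic f X -> isotropic f (X + (Y :&: k))%VS.
  move=> X0; apply: isotropicD => //.
    by move=> x y _ /memv_capP[_]; apply: f_ker.
  by apply/orthovP => x y _ /memv_capP[_]; apply: f_ker.
pose M' := (M + (W :&: k))%VS; pose T1 := (T + (U :&: k))%VS.
have M'0 : isotropic f M' by apply: addk.
have T10 : isotropic f T1 by apply: addk.
have M'W : (M' <= W)%VS by rewrite subv_add MW capvSl.
have T1U : (T1 <= U)%VS by rewrite subv_add TU capvSl.
have U'n := complement_stable.
have imk X Y : (v^^j @: (X + (Y :&: k)) = v^^j @: X)%VS.
  rewrite limgD; apply/addv_idPl; suff -> : (v^^j @: (Y :&: k) = 0)%VS by rewrite sub0v.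
  by apply/eqP; rewrite -lkerE capvSr.
have capk X Y : (X <= Y)%VS -> ((X + (Y :&: k)) :&: k = Y :&: k)%VS.
  move=> XY; apply/eqP; rewrite eqEsubv; apply/andP; split.
    by rewrite capvS // subv_add XY capvSl.
  by rewrite subv_cap capvSr addvSr.
have dM' := limg_ker_dim (v^^j) M'; rewrite -/k imk capk // in dM'.
have dT1 := limg_ker_dim (v^^j) T1; rewrite -/k imk capk // in dT1.
have dW := limg_ker_dim (v^^j) W; rewrite -/k in dW.
have radW : (M' :&: orthov f W <= W :&: k)%VS.
  apply/subvP => x /memv_capP[/(subvP M'W) Wx /mem_orthovP x0].
  rewrite memv_cap Wx memv_ker; apply/eqP/W_nd; first exact: stable_vX.
  by move=> y Wy; rewrite vX_adj; apply: x0.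
(* M' is isotropic, and the hypothesis on dimensions makes it maximal. *)
have M'E : (W :&: orthov f M' = M')%VS.
  apply/esym/eqP; rewrite eqEdim subv_cap M'W /=.
  have -> /= : (M' <= orthov f M')%VS by apply/isotropic_orthov.
  have := dim_orthov_eq f W M'; have := dimvS radW; lia.
pose q := daddv_pi U' W; pose T2 := (T1 :&: (M' + U'))%VS.
have capUW : (U' :&: W = 0)%VS by rewrite capvC complement_cap.
have qE m z : m \in W -> z \in U' -> q (m + z) = z.
  move=> Wm Uz; have := daddv_pi_add complement_cap (w := m).
  rewrite complement_add => /(_ (subvP WU _ Wm)).
  rewrite (daddv_pi_id complement_cap) // addrC => /eqP; rewrite -subr_eq0 addrK => /eqP qm.
  by rewrite linearD /= [q m]qm add0r [q z]daddv_pi_id.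
have f_WU' m z : m \in W -> z \in U' -> f m z = 0.
  by move=> Wm Uz; apply: complement_ortho => //; apply: stable_vX.
exists (q @: T2)%VS; split.
- by apply/subvP => _ /memv_imgP[x _ ->]; apply: memv_pi.
- move=> _ _ /memv_imgP[x + ->] /memv_imgP[y + ->].
  move=> /memv_capP[Tx /memv_addP[m Mm [z Uz xE]]].
  move=> /memv_capP[Ty /memv_addP[m' Mm' [z' Uz' yE]]].
  have Wm := subvP M'W _ Mm; have Wm' := subvP M'W _ Mm'.
  rewrite xE yE !qE //; have := T10 _ _ Tx Ty.
  rewrite xE yE linearDl !linearDr /= (M'0 m m') // (f_WU' m z') // (symC f z m').
  by rewrite (f_WU' m' z) // !add0r.
(* T2 / (T1 :&: M') embeds into the complement; [dim_orthov_eq] bounds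
   its dimension from below. *)
have kerq : (T2 :&: lker q <= T1 :&: M')%VS.
  apply/subvP => x /memv_capP[/memv_capP[Tx /memv_addP[m Mm [z Uz xE]]]].
  have Wm := subvP M'W _ Mm.
  rewrite memv_ker xE qE // => /eqP z0.
  by rewrite -xE memv_cap Tx xE z0 addr0.
have T2_sub : (T1 :&: orthov f M' <= T2)%VS.
  apply/subvP => x /memv_capP[Tx /mem_orthovP x0]; rewrite memv_cap Tx /=.
  have := subvP T1U _ Tx; rewrite -complement_add => /memv_addP[m Wm [z Uz xE]].
  rewrite xE memv_add // -M'E memv_cap Wm; apply/mem_orthovP => y My.
  have Wy := subvP M'W _ My; have := x0 _ My.
  by rewrite xE linearDl /= (symC f z) (f_WU' y z) // addr0.
have capT1 : (T1 :&: M' <= M' :&: orthov f T1)%VS.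
  rewrite subv_cap capvSr; apply: subv_trans (capvSl _ _) _; exact/isotropic_orthov.
have dimk : (\dim (W :&: k) + \dim (U' :&: k) <= \dim (U :&: k))%N.
  rewrite -dimv_disjoint_sum; last first.
    by apply/eqP; rewrite -subv0 -complement_cap capvS ?capvSl.
  rewrite dimvS // subv_add !capvS //; exact: capvSl.
have qT2 : ((q @: T2) :&: k <= U' :&: k)%VS.
  by rewrite capvS //; apply/subvP => _ /memv_imgP[x _ ->]; apply: memv_pi.
have := dim_orthov_eq f T1 M'; have := dimvS T2_sub; have := dimvS capT1.
have := limg_ker_dim q T2; have := dimvS kerq; have := dimvS qT2.
have := limg_ker_dim (v^^j) (q @: T2); rewrite -/k; lia.
Qed.

End Complement.
End Splitting.

(** * Subspaces generated by one or two vectors *)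

Section Cyclic.
Variables (F : fieldType) (p : isopair F).
Local Notation b := (iform p).
Local Notation V := (fspace (iform p)).
Local Notation u := (iaut p).
Local Notation u' := ((iaut p)^-1%VF).
Local Notation n := (iaut p - \1%VF).
Local Notation nb := ((iaut p)^-1%VF - \1%VF).
Local Notation v := (wall_op p).
Implicit Types x y z : V.

Implicit Types U W T M : {vspace V}.

Lemma u'nX k x : n^^k (u' x) = u' (n^^k x).
Proof. by apply: (lfun_exp_comm (f := n) (g := u')) => y; rewrite u'C_n. Qed.

Lemma nX_nb k x : n^^k (nb x) = - u' (n^^k.+1 x).
Proof. by rewrite n_u'nb linearN /= u'nX lfun_expSr. Qed.

Lemma v_u'nn x : v x = u' (n (n x)). Proof. exact: wall_op_sqr. Qed.

Lemma nX_v k x : n^^k (v x) = u' (n^^k.+2 x).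
Proof. by rewrite v_u'nn u'nX !lfun_expSr. Qed.

Definition cyc x N : {vspace V} := <<mkseq (fun i => n^^i x) N.+1>>%VS.

Lemma cyc_gen x N i : (i <= N)%N -> n^^i x \in cyc x N.
Proof.
by move=> iN; apply/memv_span/mapP; exists i; rewrite // mem_iota.
Qed.

Lemma cycP x N z : z \in cyc x N ->
  exists a : 'I_N.+1 -> F, z = \sum_i a i *: n^^i x.
Proof.
have sz : size (mkseq (fun i => n^^i x) N.+1) == N.+1 by rewrite size_mkseq.
move/(coord_span (X := Tuple sz)) => ->; exists (fun i => coord (Tuple sz) i z).
by apply: eq_bigr => i _; rewrite nth_mkseq.
Qed.

Lemma cyc_ind x N (P : V -> Prop) : P 0 ->
  (forall a y z, P y -> P z -> P (a *: y + z)) ->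
  (forall i, (i <= N)%N -> P (n^^i x)) -> {in cyc x N, forall z, P z}.
Proof.
move=> P0 PD Px z /cycP[a ->]; elim/big_rec: _ => // i y _ Py.
by apply: PD => //; apply: Px; rewrite -ltnS.
Qed.

Lemma cyc_sub U x N : stable U -> x \in U -> (cyc x N <= U)%VS.
Proof.
move=> Un Ux; apply/span_subvP => _ /mapP[i _ ->]; exact: stable_nX.
Qed.

Lemma cyc_stable x N : n^^N.+1 x = 0 -> stable (cyc x N).
Proof.
move=> x0; apply: cyc_ind => [|a y z Xy Xz|i].
- by rewrite linear0 mem0v.
- by rewrite lfunD lfunZ memvD // memvZ.
rewrite leq_eqVlt -lfun_expS => /orP[/eqP->|iN]; first by rewrite x0 mem0v.
exact: cyc_gen.
Qed.

Section Twist.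
Variables (W : {vspace V}) (d : 'End(V)).
Hypotheses (Wn : stable W) (dn : {in W, forall z, d (n z) = nb (d z)}).

(** d u = u^-1 d on a u-stable subspace gives d u^-1 = u d. *)
Lemma twist_nb : {in W, forall z, d (nb z) = n (d z)}.
Proof.
move=> z Wz; have Wu' : u' z \in W by rewrite u'E rpredD // stable_nb.
have du' : d (u' z) = u (d z).
  have e : d (u (u' z)) = u' (d (u' z)) by rewrite [RHS]u'E uE lfunD dn.
  by rewrite iautVK in e; rewrite e iautVK.
by rewrite nbE lfunD lfunN du' nE.
Qed.

Lemma twist_v : {in W, forall z, d (v z) = v (d z)}.
Proof. by move=> z Wz; rewrite !vE lfunD dn // twist_nb // addrC. Qed.

Lemma twist_vX k : {in W, forall z, d (v^^k z) = v^^k (d z)}.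
Proof.
move=> z Wz; elim: k => [|k IHk]; first by rewrite !lfun_exp0.
by rewrite !lfun_expS twist_v ?IHk // stable_vX.
Qed.

End Twist.

Section Pairing.
Variables (x y : V) (N : nat).
Hypotheses (x0 : n^^N.+1 x = 0) (y0 : n^^N.+1 y = 0) (xy : b x (n^^N y) != 0).

(** The matrix of the pairing of the families n^i x and n^j y is triangular with
    respect to i + j, with the nonzero entries +- b(x, n^N y) where i + j = N. *)
Lemma pairing_coef (a : 'I_N.+1 -> F) :
  (forall j, (j <= N)%N -> b (\sum_i a i *: n^^i x) (n^^j y) = 0) -> forall i, a i = 0.
Proof.
move=> z0 i; have [m] := ubnP i; elim: m i => // m IHm i; rewrite ltnS => im.
have := z0 (N - i)%N (leq_subr _ _); rewrite linear_sumlz (bigD1 i) //= big1 ?addr0.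
  have iN : (i <= N)%N by rewrite -ltnS.
  have e : nb^^i (n^^(N - i) y) = (-1) ^+ i *: n^^N y.
    have := @nbX_top _ p i (N - i)%N y; rewrite subnKC //; exact.
  rewrite bZl nX_adj e.
  by rewrite bZr => /eqP; rewrite !mulf_eq0 signr_eq0 (negPf xy) !orbF => /eqP.
move=> j ji; rewrite bZl; have [ij|] := ltnP i j.
  rewrite nX_adj nbX -lfun_expD (@nX_eq0 _ _ N.+1).
    by rewrite linear0 scaler0 b0r mulr0.
    have := ltn_ord i; move: ij; lia.
  exact: y0.
rewrite leq_eqVlt => /orP[/eqP/val_inj eji|lt_ji]; first by rewrite eji eqxx in ji.
by rewrite IHm ?mul0r // (leq_trans lt_ji).
Qed.

Lemma cyc_pairing z : z \in cyc x N ->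
  (forall j, (j <= N)%N -> b z (n^^j y) = 0) -> z = 0.
Proof.
case/cycP => a -> /pairing_coef a0.
by rewrite big1 // => i _; rewrite a0 scale0r.
Qed.

Lemma cyc_free : free (mkseq (fun i => n^^i x) N.+1).
Proof.
have sz : size (mkseq (fun i => n^^i x) N.+1) == N.+1 by rewrite size_mkseq.
change (free (Tuple sz)); apply/freeP => a a0; apply: pairing_coef => j _.
suff -> : \sum_i a i *: n^^i x = 0 by rewrite b0l.
by rewrite -[RHS]a0; apply: eq_bigr => i _; rewrite nth_mkseq.
Qed.

Lemma dim_cyc : \dim (cyc x N) = N.+1.
Proof. by have /eqP := cyc_free; rewrite size_mkseq. Qed.

Lemma cyc_ker z : z \in cyc x N -> n z = 0 -> b z y = 0 -> z = 0.
Proof.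
move=> Xz nz zy; apply: cyc_pairing => // -[|j] _; first by rewrite lfun_exp0.
rewrite lfun_expS bC n_adj.
have -> : nb z = 0 by rewrite n_u'nb nz linear0 oppr0.
by rewrite b0r.
Qed.

(** The form b( . , y) is injective on the kernel of n in the cyclic subspace. *)
Lemma dim_cyc_ker T : (T <= cyc x N)%VS -> (\dim (T :&: lker n) <= 1)%N.
Proof.
move=> TX; have := leq_dim_orthov b (T :&: lker n) <[y]>%VS.
have -> : (T :&: lker n :&: orthov b <[y]> = 0)%VS.
  apply/eqP; rewrite -subv0; apply/subvP => z.
  rewrite !memv_cap memv_ker mem_orthov1 memv0.
  move=> /andP[/andP[/(subvP TX) Xz /eqP nz] /eqP zy].
  by apply/eqP/cyc_ker.
by rewrite dimv0 add0n dim_vline; case: (y != 0) => //; lia.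
Qed.

(** By [dim_cyc_ker] each application of n lowers the dimension by at most one,
    and N + 1 applications bring N + 1 down to zero. *)
Lemma dim_cyc_img i : \dim (n^^i @: cyc x N) = (N.+1 - i)%N.
Proof.
pose a i := \dim (n^^i @: cyc x N).
have Xn := cyc_stable x0.
have step j : (a j <= (a j.+1).+1)%N.
  have sub : (n^^j @: cyc x N <= cyc x N)%VS.
    by apply/subvP => _ /memv_imgP[z Xz ->]; apply: stable_nX.
  have := limg_ker_dim n (n^^j @: cyc x N); have := dim_cyc_ker sub.
  rewrite -limg_comp (_ : \dim ((n \o n^^j) @: _) = a j.+1) // /a; lia.
have a0 : a 0%N = N.+1.
  rewrite -dim_cyc; apply: limg_dim_eq; apply/eqP; rewrite -subv0.
  by apply/subvP => z /memv_capP[_]; rewrite memv_ker lfun_exp0 memv0.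
have aN j : (N < j)%N -> a j = 0%N.
  move=> Nj; apply/eqP; rewrite dimv_eq0 -subv0; apply/subvP.
  move=> _ /memv_imgP[z Xz ->]; rewrite memv0.
  elim/cyc_ind: z / Xz => [|c z t /eqP z0 /eqP t0|k _].
  - by rewrite linear0.
  - by rewrite lfunD lfunZ z0 t0 scaler0 addr0.
  by rewrite -lfun_expD (@nX_eq0 _ _ N.+1) //; apply: leq_trans Nj _; rewrite leq_addr.
have lower j : (N.+1 - j <= a j)%N.
  elim: j => [|j IHj]; first by rewrite a0 subn0.
  by have := step j; lia.
have upper j : (j <= N.+1)%N -> (a (N.+1 - j) <= j)%N.
  elim: j => [|j IHj] jN; first by rewrite subn0 aN.
  have := step (N.+1 - j.+1)%N; have := IHj (ltnW jN).
  have -> : (N.+1 - j.+1).+1 = (N.+1 - j)%N by lia.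
  by lia.
change (a i = (N.+1 - i)%N); have [iN|Ni] := leqP i N.+1; last first.
  by rewrite aN 1?ltnW //; apply/esym/eqP; rewrite subn_eq0 ltnW.
have := upper (N.+1 - i)%N (leq_subr _ _); rewrite subKn //; have := lower i; lia.
Qed.

End Pairing.

Section Generated.
Variables (x y : V) (N M : nat).
Hypotheses (x0 : n^^N.+1 x = 0) (y0 : n^^M.+1 y = 0).
Hypotheses (freex : free (mkseq (fun i => n^^i x) N.+1))
           (freey : free (mkseq (fun i => n^^i y) M.+1)).
Let X := cyc x N.
Let Y := cyc y M.
Let W := (X + Y)%VS.
Hypothesis XY0 : (X :&: Y = 0)%VS.

Lemma gen_stable : stable W.
Proof.
move=> _ /memv_addP[z Xz [t Yt ->]]; rewrite lfunD.
by apply: memv_add; apply: cyc_stable.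
Qed.

Lemma gen_ind (P : V -> Prop) : P 0 ->
  (forall a y z, P y -> P z -> P (a *: y + z)) ->
  (forall i, P (n^^i x)) -> (forall i, P (n^^i y)) -> {in W, forall z, P z}.
Proof.
move=> P0 PD Px Py zt /memv_addP[z Xz [t Yt ->]] {zt}.
rewrite -[z]scale1r; apply: (PD).
  exact: (cyc_ind P0 PD (fun i _ => Px i)) Xz.
exact: (cyc_ind P0 PD (fun i _ => Py i)) Yt.
Qed.

(** d is defined semilinearly, as p(u) x |-> p(u^-1) x1. *)
Lemma twisted_gen x1 y1 : n^^N.+1 x1 = 0 -> n^^M.+1 y1 = 0 ->
  exists d : 'End(V),
    (forall i, d (n^^i x) = nb^^i x1) /\ (forall i, d (n^^i y) = nb^^i y1).
Proof.
move=> x10 y10.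
pose s := mkseq (fun i => n^^i x) N.+1 ++ mkseq (fun i => n^^i y) M.+1.
pose t := mkseq (fun i => nb^^i x1) N.+1 ++ mkseq (fun i => nb^^i y1) M.+1.
have [f fP] := linear_of_free s t.
have free_s : free s.
  by rewrite cat_free freex freey; apply/directv_addP.
have szE : size t = size s by rewrite !size_cat !size_mkseq.
have /eqP := fP free_s szE; rewrite map_cat eqseq_cat ?size_map ?size_iota //.
move=> /andP[/eqP fx /eqP fy].
have nb0 z K i : n^^K z = 0 -> (K <= i)%N -> nb^^i z = 0.
  by move=> z0 Ki; apply/eqP; rewrite nbX (nX_eq0 Ki z0) linear0 scaler0.
exists (linfun f); split=> i; rewrite lfunE /=.
  have [iN|Ni] := ltnP i N.+1; last by rewrite (nX_eq0 Ni x0) linear0 (nb0 _ N.+1).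
  have := congr1 (fun r => nth 0 r i) fx; rewrite (nth_map 0) ?size_mkseq //.
  by rewrite !nth_mkseq.
have [iN|Ni] := ltnP i M.+1; last by rewrite (nX_eq0 Ni y0) linear0 (nb0 _ M.+1).
have := congr1 (fun r => nth 0 r i) fy; rewrite (nth_map 0) ?size_mkseq //.
by rewrite !nth_mkseq.
Qed.

(** Let S(z, t) = b(d z, t) + b(z, d t). As d n = nb d, one has
    S(n z, t) = S(z, n t), so skewness need only be tested on the pairs (x, n^j x),
    (x, n^j y) and (y, n^j y). Likewise d^2 commutes with n, so d^2 = - v may
    be tested on x and y; it is expressed through x1 = d x and y1 = d y, and
    their images may be computed with the help of d v = v d. *)
Lemma twisted_root_gen x1 y1 (d : 'End(V)) : x1 \in W -> y1 \in W ->
  (forall i, d (n^^i x) = nb^^i x1) -> (forall i, d (n^^i y) = nb^^i y1) ->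
  ({in W, forall z, d (v z) = v (d z)} -> d x1 = - v x /\ d y1 = - v y) ->
  (forall j, b x1 (n^^j x) + b x (nb^^j x1) = 0) ->
  (forall j, b x1 (n^^j y) + b x (nb^^j y1) = 0) ->
  (forall j, b y1 (n^^j y) + b y (nb^^j y1) = 0) -> twisted_root W d.
Proof.
move=> Wx1 Wy1 dx dy dd1 Sxx Sxy Syy; have Wn := gen_stable.
have Wnb := stable_nb Wn; have Wv := stable_v Wn.
have x1E : d x = x1 by have := dx 0%N; rewrite !lfun_exp0.
have y1E : d y = y1 by have := dy 0%N; rewrite !lfun_exp0.
have dW z : z \in W -> d z \in W.
  move: z; apply: gen_ind => [|a z t dz dt|i|i].
  - by rewrite linear0 mem0v.
  - by rewrite lfunD lfunZ memvD // memvZ.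
  - by rewrite dx; apply: stable_exp.
  - by rewrite dy; apply: stable_exp.
have dn z : z \in W -> d (n z) = nb (d z).
  move: z; apply: gen_ind => [|a z t dz dt|i|i].
  - by rewrite !linear0.
  - by rewrite !(lfunD, lfunZ) dz dt.
  - by rewrite -lfun_expS !dx lfun_expS.
  - by rewrite -lfun_expS !dy lfun_expS.
have dnb z : z \in W -> d (nb z) = n (d z) by apply: twist_nb.
have dv z : z \in W -> d (v z) = v (d z) by apply: twist_v.
have [dx1 dy1] := dd1 dv.
have dnX i z : z \in W -> d (n^^i z) = nb^^i (d z).
  move=> Wz; elim: i => [|i IHi]; first by rewrite !lfun_exp0.
  by rewrite !lfun_expS dn ?IHi // stable_nX.
have dnbX i z : z \in W -> d (nb^^i z) = n^^i (d z).
  move=> Wz; elim: i => [|i IHi]; first by rewrite !lfun_exp0.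
  by rewrite !lfun_expS dnb ?IHi // stable_exp.
have nXv i z : v (n^^i z) = n^^i (v z).
  by apply/esym/lfun_exp_comm => t; rewrite nC_v.
have dd z : z \in W -> d (d z) = - v z.
  move: z; apply: gen_ind => [|a z t dz dt|i|i].
  - by rewrite !lfun0 oppr0.
  - by rewrite !(lfunD, lfunZ) dz dt scalerN opprD.
  - by rewrite dx dnbX // dx1 linearN /= nXv.
  - by rewrite dy dnbX // dy1 linearN /= nXv.
pose S z t := b (d z) t + b z (d t).
have SC z t : S z t = S t z by rewrite /S addrC [b z (d t)]bC [b (d z) t]bC.
have S0l z : S 0 z = 0 by rewrite /S linear0 !b0l addr0.
have SPl a z1 z2 t : S (a *: z1 + z2) t = a * S z1 t + S z2 t.
  by rewrite /S lfunD lfunZ !bE; ring.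
have Sn z t : z \in W -> t \in W -> S (n z) t = S z (n t).
  by move=> Wz Wt; rewrite /S !dn // nb_adj n_adj.
have SnX i z t : z \in W -> t \in W -> S (n^^i z) t = S z (n^^i t).
  move=> Wz Wt; elim: i => [|i IHi] in t Wt *; first by rewrite !lfun_exp0.
  by rewrite lfun_expS Sn ?stable_nX // IHi ?Wn // -lfun_expSr.
have Wx : x \in W.
  by apply: (subvP (addvSl _ _)); have := @cyc_gen x N 0; rewrite lfun_exp0; apply.
have Wy : y \in W.
  by apply: (subvP (addvSr _ _)); have := @cyc_gen y M 0; rewrite lfun_exp0; apply.
have Sx t : t \in W -> forall i, S (n^^i x) t = 0.
  move: t; apply: gen_ind => [i|a z t Hz Ht i|j i|j i]; rewrite SC.
  - exact: S0l.
  - by rewrite SPl ![S _ (n^^i x)]SC Hz Ht mulr0 addr0.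
  - by rewrite SC SnX ?stable_nX // -lfun_expD /S x1E dx Sxx.
  - by rewrite SC SnX ?stable_nX // -lfun_expD /S x1E dy Sxy.
have Sy t : t \in W -> forall i, S (n^^i y) t = 0.
  move: t; apply: gen_ind => [i|a z t Hz Ht i|j i|j i]; rewrite SC.
  - exact: S0l.
  - by rewrite SPl ![S _ (n^^i y)]SC Hz Ht mulr0 addr0.
  - by rewrite Sx // stable_nX.
  - by rewrite SC SnX ?stable_nX // -lfun_expD /S y1E dy Syy.
split; [|split] => // [z Wz|z t Wz Wt]; first by split; [exact: dW | exact: dd].
suff : S z t = 0 by move/eqP; rewrite addr_eq0 => /eqP.
move: z Wz; apply: gen_ind => [|a z1 z2 S1 S2|i|i].
- exact: S0l.
- by rewrite SPl S1 S2 mulr0 addr0.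
- exact: Sx.
exact: Sy.
Qed.

End Generated.
End Cyclic.

(** * Two blocks of the same size *)

Section HyperbolicPiece.
Variables (F : fieldType) (p : isopair F).
Local Notation b := (iform p).
Local Notation V := (fspace (iform p)).
Local Notation n := (iaut p - \1%VF).
Local Notation nb := ((iaut p)^-1%VF - \1%VF).
Local Notation v := (wall_op p).
Implicit Types x y z : V.

Implicit Types U W T M : {vspace V}.
Hypothesis charF : 2%N \notin [pchar F].

Lemma nn_exp j x : n^^j.+2 x = v (n^^j x) + v (n^^j.+1 x).
Proof. by rewrite !lfun_expS nn. Qed.

Lemma nbnb_exp j x : nb^^j.+2 x = v (nb^^j x) + v (nb^^j.+1 x).
Proof. by rewrite !lfun_expS nbnb. Qed.

(** b(x, v^i n x) = b(x, v^i nb x) by symmetry, and n + nb = v. *)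
Lemma form_vn x i : b x (v^^i (n x)) *+ 2 = b x (v^^i.+1 x).
Proof.
rewrite lfun_expSr vE lfunD bDr mulr2n; congr (_ + _).
by rewrite -vX_adj bC n_adj -vXC_nb.
Qed.

Lemma mulr2n_inj (a c : F) : a *+ 2 = c *+ 2 -> a = c.
Proof.
move/eqP; rewrite -subr_eq0 -mulrnBl -mulr_natl mulf_eq0 (negPf (two_neq0 charF)) /=.
by rewrite subr_eq0 => /eqP.
Qed.

(** Because n^2 = v + v n, the values b(y, v^i y) determine all the
    b(y, v^i n^j y), in characteristic different from 2. *)
Lemma form_vn_eq x y c : (forall i, b y (v^^i y) = b x (v^^(i + c) x)) ->
  forall j i, b y (v^^i (n^^j y)) = b x (v^^(i + c) (n^^j x)).
Proof.
move=> eq_v j; suff: (forall i, b y (v^^i (n^^j y)) = b x (v^^(i + c) (n^^j x))) /\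
  (forall i, b y (v^^i (n^^j.+1 y)) = b x (v^^(i + c) (n^^j.+1 x))) by case.
elim: j => [|j [IH0 IH1]]; split=> // i.
- by rewrite !lfun_exp0.
- rewrite !(lfun_expS n 0) !lfun_exp0; apply: mulr2n_inj.
  by rewrite !form_vn -addSn.
by rewrite !nn_exp !lfunD !bDr -!lfun_expSr IH0 IH1.
Qed.

Lemma form_vnb0 x y : (forall i j, b x (v^^i (n^^j y)) = 0) ->
  forall k i j, b x (v^^i (nb^^k (n^^j y))) = 0.
Proof.
move=> xy0; elim=> [|k IHk] i j; first by rewrite lfun_exp0.
have -> : nb^^k.+1 (n^^j y) = nb^^k (v (n^^j y)) - nb^^k (n^^j.+1 y).
  by rewrite lfun_expSr lfun_expS -lfunN -lfunD vE [_ + nb _]addrC addrK.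
rewrite lfunD lfunN bDr bNr IHk subr0.
have -> : nb^^k (v (n^^j y)) = v (nb^^k (n^^j y)).
  by apply: lfun_exp_comm => z; rewrite nbC_v.
by rewrite -lfun_expSr.
Qed.

Lemma cyc_ortho x y (N M : nat) : (forall i j, b x (v^^i (n^^j y)) = 0) ->
  {in cyc x N & cyc y M, forall z t, b z t = 0}.
Proof.
move=> xy0 z t Xz; move: t; apply: cyc_ind => [|a t t' Ht Ht'|j _].
- exact: b0r.
- by rewrite bDr bZr Ht Ht' mulr0 addr0.
move: z Xz; apply: cyc_ind => [|a t t' Ht Ht'|i _].
- exact: b0l.
- by rewrite bDl bZl Ht Ht' mulr0 addr0.
by rewrite nX_adj; have := form_vnb0 xy0 i 0%N j; rewrite lfun_exp0.
Qed.

Lemma form_n_sym N x y : n^^N.+1 x = 0 -> n^^N.+1 y = 0 ->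
  b y (n^^N x) = (-1) ^+ N * b x (n^^N y).
Proof.
move=> x0 y0; rewrite bC nX_adj; have := @nbX_top _ p N 0%N y.
by rewrite lfun_exp0 addn0 => ->; rewrite ?bZr.
Qed.

(** A summand of U with two Jordan blocks, of sizes N1 + 1 and N2 + 1, on which u
    has a twisted root. The subspace M serves as a Lagrangian for all the forms f_j
    at once, and m j records the dimension of v^j M; this is what
    [isotropic_complement] consumes. *)
Definition piece U (N1 N2 : nat) (m : nat -> nat) W :=
  [/\ [/\ (W <= U)%VS, stable W & nondegenerate_on W],
      exists d, twisted_root W d,
      forall i, \dim (n^^i @: W) = ((N1.+1 - i) + (N2.+1 - i))%N &
      exists2 M : {vspace V}, (M <= W)%VS &
        forall j, isotropic (@wall_pre F p j) M /\ \dim (v^^j @: M) = m j].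

(** The twisted root is d x = n x, d y = - s n y. It is skew exactly when the
    functional p |-> b(x, p(u) y) on F[u] satisfies phi(p(u^-1)) = s phi(p(u)),
    which the last two hypotheses express on generators of F[u] over F[v]. As
    n^N and (u^-1 - 1)^N differ by the sign (-1)^N on top vectors, s is
    (-1)^N in the applications. *)
Lemma hyperbolic_piece U x y N (s : F) : stable U -> x \in U -> y \in U ->
  n^^N.+1 x = 0 -> n^^N.+1 y = 0 -> b x (n^^N y) != 0 ->
  (forall i, b x (v^^i x) = 0) -> (forall i, b y (v^^i y) = 0) ->
  s * s = 1 ->
  (forall i, b x (v^^i y) = s * b x (v^^i y)) ->
  (forall i, b x (v^^i (n y)) = s * b x (v^^i (nb y))) ->
  exists W, piece U N N (fun j => N.+1 - j.*2)%N W.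
Proof.
move=> Un Ux Uy x0 y0 xy isox isoy ss psi0 psi1.
have yx : b y (n^^N x) != 0.
  by rewrite form_n_sym // mulf_eq0 signr_eq0 (negPf xy).
pose X := cyc x N; pose Y := cyc y N; pose W := (X + Y)%VS.
have iso_cyc z (z_iso : forall i, b z (v^^i z) = 0) :
    {in cyc z N &, forall t t', b t t' = 0}.
  apply: cyc_ortho => i j.
  by rewrite (@form_vn_eq 0 z 0) ?b0l // => k; rewrite z_iso b0l.
have isoX := iso_cyc x isox; have isoY := iso_cyc y isoy.
have Xx : x \in X by have := @cyc_gen _ p x N 0; rewrite lfun_exp0; apply.
have Yy : y \in Y by have := @cyc_gen _ p y N 0; rewrite lfun_exp0; apply.
have Xn : stable X by apply: cyc_stable.
have Yn : stable Y by apply: cyc_stable.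
have XY0 : (X :&: Y = 0)%VS.
  apply/eqP; rewrite -subv0; apply/subvP => z /memv_capP[Xz Yz]; rewrite memv0.
  apply/eqP; apply: (cyc_pairing y0 xy Xz) => j jN.
  by apply: isoY => //; apply: cyc_gen.
have W_nd : nondegenerate_on W.
  move=> _ /memv_addP[zx Xz [zy Yz ->]] z0.
  have zx0 : zx = 0.
    apply: (cyc_pairing y0 xy Xz) => j jN.
    have Yj : n^^j y \in Y by apply: cyc_gen.
    have := z0 _ (subvP (addvSr X Y) _ Yj).
    by rewrite bDl (isoY zy) // addr0.
  have zy0 : zy = 0.
    apply: (cyc_pairing x0 yx Yz) => j jN.
    have Xj : n^^j x \in X by apply: cyc_gen.
    have := z0 _ (subvP (addvSl X Y) _ Xj).
    by rewrite bDl (isoX zx) // add0r.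
  by rewrite zx0 zy0 addr0.
have psi j i : b x (v^^i (n^^j y)) = s * b x (v^^i (nb^^j y)).
  suff: (forall i, b x (v^^i (n^^j y)) = s * b x (v^^i (nb^^j y))) /\
    (forall i, b x (v^^i (n^^j.+1 y)) = s * b x (v^^i (nb^^j.+1 y))) by case.
  elim: j {i} => [|j [IH0 IH1]]; split=> // i.
  - by rewrite !lfun_exp0.
  - by rewrite (lfun_expS n 0) (lfun_expS nb 0) !lfun_exp0.
  by rewrite nn_exp nbnb_exp !lfunD !bDr -!lfun_expSr IH0 IH1 mulrDr.
have free_x := cyc_free y0 xy; have free_y := cyc_free x0 yx.
exists W; split; [split=> // | | move=> i | ].
- by rewrite subv_add !cyc_sub.
- exact: gen_stable.
- pose y1 := - s *: n y.
  have x10 : n^^N.+1 (n x) = 0 by rewrite -lfun_expSr lfun_expS x0 linear0.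
  have y10 : n^^N.+1 y1 = 0.
    by rewrite lfunZ -lfun_expSr lfun_expS y0 linear0 scaler0.
  have [d [dx dy]] := twisted_gen x0 y0 free_x free_y XY0 x10 y10.
  have Yy1 : y1 \in Y by rewrite memvZ // Yn.
  exists d; apply: (twisted_root_gen x0 y0 _ _ dx dy).
  + by apply: (subvP (addvSl _ _)); apply: Xn.
  + exact: (subvP (addvSr _ _)).
  + move=> _; split.
      by have := dx 1%N; rewrite !lfun_expS !lfun_exp0 nb_n.
    have := dy 1%N; rewrite !lfun_expS !lfun_exp0 /y1 !lfunZ => ->.
    by rewrite nb_n scalerA mulrNN ss scale1r.
  + move=> j; rewrite !isoX ?addr0 ?Xn ?stable_nX //.
    by apply: stable_exp; [exact: stable_nb | exact: Xn].
  + case=> [|j].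
      rewrite !lfun_exp0 n_adj bZr; have := psi1 0%N; rewrite !lfun_exp0 => ->.
      by rewrite mulrA mulNr ss mulN1r subrr.
    rewrite n_adj lfun_expS nb_n lfun_expSr /y1 lfunZ nb_n !lfunZ !lfunN !bE.
    have -> : nb^^j (v y) = v (nb^^j y) by apply: lfun_exp_comm => z; rewrite nbC_v.
    by have := psi j 1%N; rewrite !lfun_expS !lfun_exp0 => ->; ring.
  + move=> j; rewrite !isoY ?addr0 ?stable_nX //.
    by apply: stable_exp; [exact: stable_nb | exact: Yy1].
- rewrite limgD dimv_disjoint_sum.
    by rewrite (dim_cyc_img x0 y0 xy) (dim_cyc_img y0 x0 yx).
  apply/eqP; rewrite -subv0 -XY0; apply: capvS; apply/subvP => _ /memv_imgP[z Hz ->].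
    exact: stable_nX.
  exact: stable_nX.
exists X; first exact: addvSl.
move=> j; split; last by rewrite dim_vX_img (dim_cyc_img x0 y0 xy).
by move=> z t Xz Xt; apply: isoX => //; apply: stable_vX.
Qed.

End HyperbolicPiece.

(** * Two blocks of sizes 2K+3 and 2K+1 *)

Section LinkedPiece.
Variables (F : fieldType) (p : isopair F).
Local Notation b := (iform p).
Local Notation V := (fspace (iform p)).
Local Notation n := (iaut p - \1%VF).
Local Notation v := (wall_op p).
Implicit Types x y z : V.

Implicit Types U W T : {vspace V}.
Hypothesis charF : 2%N \notin [pchar F].

(** The twisted root is d x = y, d y = - v x. The hypothesis relating
    b(y, v^i y) to b(x, v^(i+1) x) is skewness. As Lagrangian one takes (n + d) X,
    where X is generated by x: the adjoint of n + d is nb - d, and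
    (nb - d)(n + d) = 0. *)
Lemma linked_piece U x y K (N := K.+1.*2) (M := K.*2) : stable U -> x \in U -> y \in U ->
  n^^N.+1 x = 0 -> n^^M.+1 y = 0 -> b x (n^^N x) != 0 -> b y (n^^M y) != 0 ->
  (forall i j, b x (v^^i (n^^j y)) = 0) ->
  (forall i, b y (v^^i y) = b x (v^^i.+1 x)) ->
  exists W, piece U N M (fun j => N - j.*2)%N W.
Proof.
move=> Un Ux Uy x0 y0 xx yy xy0 phi.
pose X := cyc x N; pose Y := cyc y M; pose W := (X + Y)%VS.
have XYo : {in X & Y, forall z t, b z t = 0} by apply: cyc_ortho.
have Xx : x \in X by have := @cyc_gen _ p x N 0; rewrite lfun_exp0; apply.
have Yy : y \in Y by have := @cyc_gen _ p y M 0; rewrite lfun_exp0; apply.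
have Xn : stable X by apply: cyc_stable.
have Yn : stable Y by apply: cyc_stable.
have XW : (X <= W)%VS by apply: addvSl.
have YW : (Y <= W)%VS by apply: addvSr.
have XY0 : (X :&: Y = 0)%VS.
  apply/eqP; rewrite -subv0; apply/subvP => z /memv_capP[Xz Yz]; rewrite memv0.
  apply/eqP; apply: (cyc_pairing x0 xx Xz) => j jN.
  by rewrite bC; apply: XYo => //; apply: cyc_gen.
have W_nd : nondegenerate_on W.
  move=> _ /memv_addP[zx Xz [zy Yz ->]] z0.
  have zx0 : zx = 0.
    apply: (cyc_pairing x0 xx Xz) => j jN.
    have Xj : n^^j x \in X by apply: cyc_gen.
    by have := z0 _ (subvP XW _ Xj); rewrite bDl [b zy _]bC (XYo _ zy) // addr0.
  have zy0 : zy = 0.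
    apply: (cyc_pairing y0 yy Yz) => j jM.
    have Yj : n^^j y \in Y by apply: cyc_gen.
    by have := z0 _ (subvP YW _ Yj); rewrite bDl (XYo zx) // add0r.
  by rewrite zx0 zy0 addr0.
have Wn : stable W by apply: gen_stable.
have free_x := cyc_free x0 xx; have free_y := cyc_free y0 yy.
have MN : (M.+1 <= N)%N by rewrite /N /M doubleS.
have yN : n^^N y = 0 by exact: (@nX_eq0 _ p M.+1 N y MN y0).
have x10 : n^^N.+1 y = 0 by exact: (@nX_eq0 _ p N N.+1 y (leqnSn N) yN).
have y10 : n^^M.+1 (- v x) = 0.
  by rewrite lfunN nX_v -[M.+3]/(N.+1) x0 linear0 oppr0.
have [d [dx dy]] := twisted_gen x0 y0 free_x free_y XY0 x10 y10.
have dW : twisted_root W d.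
  apply: (twisted_root_gen x0 y0 _ _ dx dy).
  - exact: (subvP YW).
  - by rewrite rpredN stable_v // (subvP XW).
  - move=> dv; have dx0 := dx 0%N; have dy0 := dy 0%N; rewrite !lfun_exp0 in dx0 dy0.
    by rewrite lfunN dv ?dx0 ?(subvP XW).
  - move=> j; rewrite bC (XYo (n^^j x)) ?stable_nX // add0r (XYo x) //.
    by apply: stable_exp Yy; apply: stable_nb.
  - move=> j; have := form_vn_eq charF (c := 1) (x := x) (y := y) _ j 0%N.
    rewrite !lfun_expS !lfun_exp0 => -> => [|i]; last by rewrite phi addn1.
    by rewrite -nX_adj bNr [b (n^^j x) _]bC v_adj subrr.
  - move=> j; rewrite bNl -nX_adj bNr [b (n^^j y) _]bC.
    by rewrite !(XYo (v x)) ?stable_nX ?stable_v // oppr0 addr0.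
pose h : 'End(V) := n + d; have hE z : h z = n z + d z by rewrite /h [LHS]add_lfunE.
have [dW2 [dWn dWs]] := dW.
have hW : {in W, forall z, h z \in W}.
  by move=> z Wz; rewrite hE rpredD ?Wn //; case: (dW2 z Wz).
have vh j z : z \in W -> v^^j (h z) = h (v^^j z).
  by move=> Wz; rewrite !hE lfunD vXC_n (twist_vX Wn dWn).
have dXY z : z \in X -> d z \in Y.
  move: z; apply: cyc_ind => [|a z t dz dt|i _].
  - by rewrite linear0 mem0v.
  - by rewrite lfunD lfunZ memvD // memvZ.
  by rewrite dx; apply: stable_exp Yy; apply: stable_nb.
have kerh z : z \in X -> (h z == 0) = (n z == 0) && (d z == 0).
  move=> Xz; apply/eqP/andP => [|[/eqP nz /eqP dz]]; last by rewrite hE nz dz addr0.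
  rewrite hE => /eqP; rewrite addr_eq0 => /eqP nd.
  have : n z \in (X :&: Y)%VS by rewrite memv_cap Xn // nd rpredN dXY.
  rewrite XY0 memv0 => nz0; split=> //.
  by rewrite -oppr_eq0 -nd.
have dimM j : \dim (v^^j @: (h @: X)) = (N - j.*2)%N.
  have -> : (v^^j @: (h @: X) = h @: (v^^j @: X))%VS.
    rewrite -!limg_comp; apply: eq_in_limg => z Xz.
    by rewrite ![(_ \o _)%VF _]comp_lfunE vh // (subvP XW).
  have vX : (v^^j @: X <= X)%VS.
    by apply/subvP => _ /memv_imgP[z Xz ->]; apply: stable_vX.
  have le1 : (\dim (v^^j @: X :&: lker h) <= 1)%N.
    apply: leq_trans (dim_cyc_ker x0 xx vX); apply: dimvS.
    rewrite subv_cap capvSl; apply/subvP => z /memv_capP[/(subvP vX) Xz].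
    by rewrite !memv_ker kerh // => /andP[].
  have ge1 : (j.*2 <= N)%N -> (1 <= \dim (v^^j @: X :&: lker h))%N.
    move=> jN; have nz : n^^N x != 0 by apply: contraNneq xx => ->; rewrite b0r.
    have <- : \dim <[n^^N x]>%VS = 1%N by rewrite dim_vline nz.
    apply: dimvS; rewrite -memvE memv_cap; apply/andP; split.
      rewrite -{1}(subnKC jN) -vX_top ?subnKC // memv_img // stable_nX //.
    rewrite memv_ker kerh ?stable_nX // -lfun_expS x0 eqxx andTb dx.
    by rewrite nbX_eq0 yN.
  have := limg_ker_dim h (v^^j @: X); rewrite dim_vX_img (dim_cyc_img x0 x0 xx).
  by move/eq_subn_of_drop; apply.
exists W; split; [split=> // | by exists d | move=> i | ].
- by rewrite subv_add !cyc_sub.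
- rewrite limgD dimv_disjoint_sum.
    by rewrite (dim_cyc_img x0 x0 xx) (dim_cyc_img y0 y0 yy).
  apply/eqP; rewrite -subv0 -XY0; apply: capvS; apply/subvP => _ /memv_imgP[z Hz ->].
    exact: stable_nX.
  exact: stable_nX.
exists (h @: X)%VS.
  by apply/subvP => _ /memv_imgP[z Xz ->]; apply/hW/(subvP XW).
move=> j; split=> // _ _ /memv_imgP[z Xz ->] /memv_imgP[t Xt ->].
have Wz := subvP XW _ Xz; have Wt := subvP XW _ Xt.
change (b (h z) (v^^j (h t)) = 0); rewrite vh //.
have {Xt Wt} := stable_vX j Wn Wt; move: (v^^j t) => {}t Wt.
have [_ ddt] := dW2 t Wt; have [dt _] := dW2 t Wt.
rewrite !hE !bE !n_adj !dWs // ?Wn // ddt dWn // nb_n !bE; ring.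
Qed.

End LinkedPiece.

(** * Generators of hyperbolic pieces *)

Section Generators.
Variables (F : fieldType) (p : isopair F).
Local Notation b := (iform p).
Local Notation V := (fspace (iform p)).
Local Notation n := (iaut p - \1%VF).
Local Notation v := (wall_op p).
Local Notation w := (iaut p - (iaut p)^-1%VF).
Implicit Types x y z : V.

Implicit Types U W T : {vspace V}.
Hypothesis charF : 2%N \notin [pchar F].

Lemma vX_tail k j N x : n^^N.+1 x = 0 -> (N < k.*2 + j)%N -> v^^k (n^^j x) = 0.
Proof.
move=> x0 Nkj; apply/eqP; rewrite vX_eq0 -lfun_expD; apply/eqP.
exact: (nX_eq0 Nkj).
Qed.

(** The values b(x, v^j x) are cancelled for decreasing j: adding a multiple of
    n^(N - 2j) y changes b(x, v^j x) through the term b(x, n^N y) and leaves those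
    with larger index unchanged. *)
Lemma isotropize U N x y : stable U -> x \in U -> y \in U ->
  {in U, forall z, n^^N.+1 z = 0} -> b x (n^^N y) != 0 ->
  (forall i, (N <= i.*2)%N -> b x (v^^i x) = 0) ->
  exists x', [/\ x' \in U, b x' (n^^N y) != 0 & forall i, b x' (v^^i x') = 0].
Proof.
move=> Un Ux Uy U0 xy top; have y0 := U0 y Uy.
pose P j := exists x', [/\ x' \in U, b x' (n^^N y) != 0 &
    forall i, (N <= i.*2)%N || (j <= i)%N -> b x' (v^^i x') = 0].
suff [x' [Ux' xy' iso']] : P 0%N.
  by exists x'; split=> // i; apply: iso'; rewrite orbT.
apply: (@downward P N) => [|j _ [z [Uz zy isoz]]].
  exists x; split=> // i /orP[/top//|Ni]; apply: top.
  by rewrite -addnn (leq_trans Ni) ?leq_addl.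
have [Nj|jN] := leqP N j.*2.
  exists z; split=> // i /orP[Ni|]; first by apply: isoz; rewrite Ni.
  rewrite leq_eqVlt => /orP[/eqP <-|ji]; first by apply: isoz; rewrite Nj.
  by apply: isoz; rewrite ji orbT.
pose e := (N - j.*2)%N; have je : (j.*2 + e = N)%N by rewrite subnKC // ltnW.
have e_gt0 : (0 < e)%N by rewrite subn_gt0.
(* The quadratic term in t vanishes, so t solves a linear equation. *)
pose t := - (b z (v^^j z)) / (2%:R * b z (n^^N y)).
have cross : b (n^^e y) (n^^N y) = 0.
  rewrite -(prednK e_gt0) lfun_expS n_adj.
  by rewrite n_u'nb -lfun_expS y0 linear0 oppr0 b0r.
have crossj : b (n^^e y) (v^^j (n^^e y)) = 0 by rewrite vX_top je.
exists (z + t *: n^^e y); split.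
- by rewrite rpredD // memvZ // stable_nX.
- by rewrite bDl bZl cross mulr0 addr0.
move=> i Hi; rewrite lfunD lfunZ !bE.
have -> : b (n^^e y) (v^^i z) = b z (v^^i (n^^e y)) by rewrite bC vX_adj.
have [->|ne_ij] := eqVneq i j.
  rewrite crossj vX_top je //.
  by rewrite /t; field; rewrite zy (two_neq0 charF).
have ji : (j < i)%N.
  by case/orP: Hi => Hi; [move: Hi jN; rewrite -!addnn; lia | rewrite ltn_neqAle eq_sym ne_ij].
have -> : v^^i (n^^e y) = 0.
  by apply: (vX_tail y0); rewrite -je ltn_add2r ltn_double.
rewrite isoz ?ji ?orbT // !b0r; ring.
Qed.

Lemma nX_w0 N z : n^^N.+1 z = 0 -> n^^N (w z) = 0.
Proof.
move=> z0; rewrite wE lfunD lfunN nX_nb -lfun_expSr z0 linear0.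
by rewrite !oppr0 addr0.
Qed.

Lemma w_top z : n (n z) = 0 -> w z = 2%:R *: n z.
Proof.
move=> nnz; have := @u'X_fix _ p 1 (n z) nnz; rewrite lfun_expS lfun_exp0 => u'n.
by rewrite wE n_u'nb u'n; vring.
Qed.

(** All of F[u] y is isotropic once y is orthogonal to F[v] y. *)
Lemma isotropic_shift N y t e : n^^N.+1 y = 0 -> (forall i, b y (v^^i y) = 0) ->
  forall i, b (y + t *: w (v^^e y)) (v^^i (y + t *: w (v^^e y))) = 0.
Proof.
move=> y0 isoy i; pose Y := cyc y N.
have Yn : stable Y by apply: cyc_stable.
have isoY : {in Y &, forall s r, b s r = 0}.
  apply: cyc_ortho => k j.
  by rewrite (@form_vn_eq _ p charF 0 y 0) ?b0l // => l; rewrite isoy b0l.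
have Yy : y \in Y by have := @cyc_gen _ p y N 0; rewrite lfun_exp0; apply.
have Yy' : y + t *: w (v^^e y) \in Y.
  by rewrite rpredD // memvZ // stable_w // stable_vX.
by apply: isoY => //; apply: stable_vX.
Qed.

Section Normalise.
Variables (U : {vspace V}) (N : nat) (x y : V).
Hypotheses (Un : stable U) (Uy : y \in U) (U0 : {in U, forall z, n^^N.+1 z = 0}).
Hypotheses (xy : b x (n^^N y) != 0) (isoy : forall i, b y (v^^i y) = 0).

Let admissible y' := [/\ y' \in U, b x (n^^N y') != 0 & forall i, b y' (v^^i y') = 0].

(** Room for normalising y: adding t w v^e y changes neither the isotropy of
    F[u] y nor, because w raises the depth in the Jordan block, b(x, n^N y). *)
Lemma admissible_shift t e y' : admissible y' -> admissible (y' + t *: w (v^^e y')).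
Proof.
case=> Uy' xy' iso'; have Uve : v^^e y' \in U by apply: stable_vX.
split; last by apply: isotropic_shift iso'; apply: U0.
- by rewrite rpredD // memvZ // stable_w.
- by rewrite lfunD lfunZ nX_w0 ?scaler0 ?addr0 // U0.
Qed.

(** The values b(x, v^i w y) are cancelled for decreasing i, using
    w^2 = v^2 + 4 v and the fact that b(x, v^K y) is nonzero. *)
Lemma normalise_even K : N = K.*2 ->
  exists y', admissible y' /\ forall i, b x (v^^i (w y')) = 0.
Proof.
move=> NK; pose P j := exists y', admissible y' /\
  forall i, (j <= i)%N -> b x (v^^i (w y')) = 0.
suff [y' [adm y'0]] : P 0%N by exists y'; split=> // i; apply: y'0.
apply: (@downward P K) => [|j jK [z [adm_z z0]]].
  exists y; split=> // i Ki; have -> : v^^i (w y) = 0; last by rewrite b0r.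
  apply/eqP; rewrite vX_eq0; apply/eqP/(nX_eq0 (k := N)); last by rewrite nX_w0 ?U0.
  by rewrite NK leq_double.
have [Uz xz isoz] := adm_z; pose e := (K - j.+1)%N.
have je : (j + e).+1 = K by rewrite -addSn subnKC.
pose t := - b x (v^^j (w z)) / (4%:R * b x (n^^N z)).
exists (z + t *: w (v^^e z)); split; first exact: admissible_shift.
move=> i ji; rewrite !(lfunD, lfunZ) ww !(lfunD, lfunZ) !bE -!lfun_expS -!lfun_expD.
have tail k : (K < k)%N -> v^^k z = 0.
  move=> Kk; have := @vX_tail k 0 N z (U0 Uz); rewrite lfun_exp0 => -> //.
  by rewrite addn0 NK ltn_double.
have -> : v^^(i + e.+2) z = 0 by rewrite tail // -je !addnS !ltnS leq_add2r.
have [->|ne_ij] := eqVneq i j.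
  have -> : v^^(j + e.+1) z = n^^N z.
    rewrite addnS je; have := @vX_top _ p K 0 z; rewrite lfun_exp0 addn0 -NK.
    by apply; apply: U0.
  by rewrite b0r /t; field; rewrite xz (four_neq0 charF).
have lt_ji : (j < i)%N by rewrite ltn_neqAle eq_sym ne_ij.
rewrite (tail (i + e.+1)%N) ?z0 // ?b0r; first by ring.
by rewrite -je addnS ltnS ltn_add2r.
Qed.

(** The values b(x, v^i y) are cancelled for decreasing i, using that
    b(x, v^K w y) = 2 b(x, n^N y) is nonzero. *)
Lemma normalise_odd K : N = K.*2.+1 ->
  exists y', admissible y' /\ forall i, b x (v^^i y') = 0.
Proof.
move=> NK; pose P j := exists y', admissible y' /\
  forall i, (j <= i)%N -> b x (v^^i y') = 0.
suff [y' [adm y'0]] : P 0%N by exists y'; split=> // i; apply: y'0.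
have tail k z : z \in U -> (K < k)%N -> v^^k z = 0.
  move=> Uz Kk; have := @vX_tail k 0 N z (U0 Uz); rewrite lfun_exp0 => -> //.
  by rewrite addn0 NK -doubleS leq_double.
apply: (@downward P K.+1) => [|j jK [z [adm_z z0]]].
  by exists y; split=> // i Ki; rewrite tail // b0r.
have [Uz xz isoz] := adm_z; pose e := (K - j)%N.
have je : (j + e)%N = K by rewrite subnKC.
pose t := - b x (v^^j z) / (2%:R * b x (n^^N z)).
exists (z + t *: w (v^^e z)); split; first exact: admissible_shift.
move=> i ji; rewrite lfunD lfunZ vXC_w -lfun_expD !bE.
have [->|ne_ij] := eqVneq i j.
  have nvK : n (v^^K z) = n^^N z.
    have := @vX_top _ p K 1 z; rewrite addn1 -NK (lfun_expS n 0) lfun_exp0 vXC_n.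
    by apply; apply: U0.
  rewrite je w_top nvK -?lfun_expS ?U0 // bZr.
  by rewrite /t; field; rewrite xz (two_neq0 charF).
have lt_ji : (j < i)%N by rewrite ltn_neqAle eq_sym ne_ij.
rewrite (tail (i + e)%N) ?z0 // ?linear0 ?b0r; first by ring.
by rewrite -je ltn_add2r.
Qed.

End Normalise.

(** For N odd, N <= 2i implies N < 2i, and then v^i vanishes. *)
Lemma iso_top_odd U N x K : N = K.*2.+1 -> {in U, forall z, n^^N.+1 z = 0} ->
  x \in U -> forall i, (N <= i.*2)%N -> b x (v^^i x) = 0.
Proof.
move=> NK U0 Ux i Ni; have -> : v^^i x = 0; last by rewrite b0r.
have := @vX_tail i 0 N x (U0 x Ux); rewrite lfun_exp0 => -> //.
rewrite addn0 ltn_neqAle Ni andbT NK -eqSS.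
by apply/negP => /eqP/(congr1 odd); rewrite /= !odd_double.
Qed.

(** Both x and y are made isotropic, each with the help of the other, and then y
    is normalised with respect to x. *)
Lemma hyperbolic_generators U N x y : stable U -> x \in U -> y \in U ->
  {in U, forall z, n^^N.+1 z = 0} -> b x (n^^N y) != 0 ->
  (forall i, (N <= i.*2)%N -> b x (v^^i x) = 0) ->
  (forall i, (N <= i.*2)%N -> b y (v^^i y) = 0) ->
  exists W, piece U N N (fun j => N.+1 - j.*2)%N W.
Proof.
move=> Un Ux Uy U0 xy topx topy.
have [x' [Ux' xy' isox]] := isotropize Un Ux Uy U0 xy topx.
have yx' : b y (n^^N x') != 0.
  by rewrite (form_n_sym (x := x')) ?U0 // mulf_eq0 signr_eq0 (negPf xy').
have [y' [Uy' yx isoy]] := isotropize Un Uy Ux' U0 yx' topy.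
have xy2 : b x' (n^^N y') != 0.
  by rewrite (form_n_sym (x := y')) ?U0 // mulf_eq0 signr_eq0 (negPf yx).
have NE : N = (odd N + N./2.*2)%N by rewrite odd_double_half.
case oddN: (odd N) NE => NE.
  have [z [[Uz xz isoz] z0]] := normalise_odd Un Uy' U0 xy2 isoy NE.
  apply: (@hyperbolic_piece _ p charF U x' z N (- 1)); rewrite ?U0 //.
  - by rewrite mulrNN mulr1.
  - by move=> i; rewrite z0 mulr0.
  move=> i; apply/eqP; rewrite mulN1r -addr_eq0 -bDr -lfunD -vE -lfun_expSr.
  by rewrite z0.
have [z [[Uz xz isoz] z0]] := normalise_even Un Uy' U0 xy2 isoy NE.
apply: (@hyperbolic_piece _ p charF U x' z N 1); rewrite ?U0 //.
- by rewrite mulr1.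
- by move=> i; rewrite mul1r.
move=> i; apply/eqP; rewrite mul1r -subr_eq0 -bBr -lfunN -lfunD -wE.
by rewrite z0.
Qed.

End Generators.

(** * Generators of linked pieces *)

Section LinkedGenerators.
Variables (F : fieldType) (p : isopair F).
Local Notation b := (iform p).
Local Notation V := (fspace (iform p)).
Local Notation u' := ((iaut p)^-1%VF).
Local Notation n := (iaut p - \1%VF).
Local Notation nb := ((iaut p)^-1%VF - \1%VF).
Local Notation v := (wall_op p).
Implicit Types x y z : V.

Implicit Types U W T : {vspace V}.
Hypothesis charF : 2%N \notin [pchar F].

(** A closed range statement in the nondegenerate subspace U, by equality of
    dimensions. *)
Lemma orthov_ker_limg U (g g' : 'End(V)) : nondegenerate_on U ->
  {in U, forall x, g x \in U} -> {in U, forall x, g' x \in U} ->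
  (forall x y, b (g x) y = b x (g' y)) ->
  {in U, forall z, {in U, forall t, g t = 0 -> b z t = 0} ->
   exists2 r, r \in U & z = g' r}.
Proof.
move=> U_nd gU g'U adj z Uz z0.
have Und0 (T : {vspace V}) : (T <= U)%VS -> (T :&: orthov b U = 0)%VS.
  move=> TU; apply/eqP; rewrite -subv0; apply/subvP => x.
  move=> /memv_capP[/(subvP TU) Ux /mem_orthovP x0].
  by rewrite memv0; apply/eqP/U_nd.
have kerE : (U :&: lker g = U :&: orthov b (g' @: U))%VS.
  apply/vspaceP => x; rewrite !memv_cap; case Ux: (x \in U) => //=.
  rewrite memv_ker; apply/eqP/mem_orthovP => [gx y /memv_imgP[t Ut ->]|x0].
    by rewrite -adj gx b0l.
  by apply: U_nd => [|y Uy]; rewrite ?gU // adj x0 // memv_img.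
suff : z \in (g' @: U)%VS by case/memv_imgP => r Ur ->; exists r.
have sub : (g' @: U <= U :&: orthov b (U :&: lker g))%VS.
  apply/subvP => _ /memv_imgP[t Ut ->]; rewrite memv_cap g'U //=.
  apply/mem_orthovP => y /memv_capP[_]; rewrite memv_ker => /eqP gy.
  by rewrite bC -adj gy b0l.
have imU : (g' @: U <= U)%VS by apply/subvP => _ /memv_imgP[t Ut ->]; apply: g'U.
have -> : (g' @: U = U :&: orthov b (U :&: lker g))%VS.
  apply/eqP; rewrite eqEdim sub /=.
  have := dim_orthov_eq b U (U :&: lker g); rewrite Und0 ?capvSl // dimv0.
  have := dim_orthov_eq b U (g' @: U); rewrite Und0 // dimv0 -kerE.
  by lia.
rewrite memv_cap Uz; apply/mem_orthovP => t /memv_capP[Ut].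
by rewrite memv_ker => /eqP; apply: z0.
Qed.

Section Level.
Variables (U : {vspace V}) (K N : nat).
Hypothesis NK : N = K.*2.+2.
Hypotheses (Un : stable U) (U_nd : nondegenerate_on U).
Hypothesis U0 : {in U, forall z, n^^N.+1 z = 0}.
Hypothesis aniso : {in U, forall x, b x (v^^K.+1 x) = 0 -> v^^K.+1 x = 0}.
Hypothesis U_N : exists2 x, x \in U & n^^N x != 0.

Lemma nX_N_eq0 z : (n^^N z == 0) = (v^^K.+1 z == 0).
Proof. by rewrite vX_eq0 NK doubleS. Qed.

(** The f_K-isotropic subspace R below has orthogonal n U + (U :&: Ker n^(2K+1)).
    The hypothesis on T makes T larger than R, so some t in T is orthogonal
    to R without lying in it. Writing t = n x' + y', isotropy of t reads
    b(y', v^K y') = b(x', v^(K+1) x'). If this common value is zero then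
    v^(K+1) x' = 0 by anisotropy, y' is an isotropic vector outside R, hence
    part of a hyperbolic plane, which represents every scalar. *)
Lemma linked_pair T : (T <= U)%VS -> isotropic (@wall_pre F p K) T ->
  (\dim (n^^(K.*2.+1) @: U) <= \dim (v^^K @: T))%N ->
  exists x y, [/\ x \in U, y \in U, n^^(K.*2.+1) y = 0,
    b x (v^^K.+1 x) != 0 & b y (v^^K y) = b x (v^^K.+1 x)].
Proof.
move=> TU T0 dimT; pose f : {symmetric V} := @wall_pre F p K.
have fE z t : f z t = b z (v^^K t) by [].
have ker_vn z : (v^^K (n z) == 0) = (n^^(K.*2.+1) z == 0) by rewrite vX_eq0 -lfun_expSr.
have vS z : v^^K.+1 z = - v^^K (nb (n z)) by rewrite nb_n lfunN opprK lfun_expSr.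
pose k := lker (v^^K); pose T1 := (T + (U :&: k))%VS.
(* The radical of f_K on n U, enlarged by the radical of f_K on U. *)
pose R := (n @: (U :&: lker (n^^N)) + (U :&: k))%VS.
have Uk_f z t : t \in (U :&: k)%VS -> f z t = 0.
  by move=> /memv_capP[_]; rewrite memv_ker fE => /eqP->; rewrite b0r.
have T1U : (T1 <= U)%VS by rewrite subv_add TU capvSl.
have T10 : isotropic f T1.
  apply: isotropicD => //; first by move=> z t _; apply: Uk_f.
  by apply/orthovP => z t _; apply: Uk_f.
have dimT1 : (\dim (v^^K @: T) + \dim (U :&: k) <= \dim T1)%N.
  have := limg_ker_dim (v^^K) T1; rewrite -/k.
  have : (v^^K @: T <= v^^K @: T1)%VS by rewrite limgS // addvSl.
  have : (U :&: k <= T1 :&: k)%VS by rewrite subv_cap capvSr addvSr.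
  by move=> /dimvS d1 /dimvS d2 d3; clear -d1 d2 d3; lia.
have dimR : (\dim R < \dim T1)%N.
  have RU : (R :&: k <= U :&: k)%VS.
    apply: capvS => //; rewrite subv_add capvSl andbT.
    by apply/subvP => _ /memv_imgP[z /memv_capP[Uz _] ->]; apply: Un.
  have imR : (v^^K @: R <= (v^^K \o n) @: (U :&: lker (n^^N)))%VS.
    rewrite limgD subv_add -limg_comp subvv /=.
    by apply/subvP => _ /memv_imgP[z /memv_capP[_ kz] ->];
      move: kz; rewrite memv_ker => /eqP->; rewrite mem0v.
  have e1 : \dim ((v^^K \o n) @: (U :&: lker (n^^N))) =
            \dim (n^^(K.*2.+1) @: (U :&: lker (n^^N))).
    by apply: eq_ker_dim_limg => z; rewrite comp_lfunE ker_vn.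
  have e2 := limg_ker_dim (n^^(K.*2.+1)) (U :&: lker (n^^N)).
  have e3 := limg_ker_dim (n^^(K.*2.+1)) U.
  have e4 := limg_ker_dim (n^^N) U.
  have e5 : (U :&: lker (n^^(K.*2.+1)) <= U :&: lker (n^^N) :&: lker (n^^(K.*2.+1)))%VS.
    have leN : (K.*2.+1 <= N)%N by rewrite NK.
    by rewrite !subv_cap capvSl capvSr (subv_trans (capvSr _ _) (lker_exp_sub _ leN)).
  have e6 : (0 < \dim (n^^N @: U))%N.
    rewrite lt0n dimv_eq0; case: U_N => x Ux; apply: contraNneq => im0.
    by rewrite -memv0 -im0 memv_img.
  have e7 := limg_ker_dim (v^^K) R; rewrite -/k in e7.
  move: (dimvS RU) (dimvS imR) (dimvS e5); rewrite e1.
  by move: dimT dimT1 e2 e3 e4 e6 e7; clear; lia.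
have [t] : exists2 t, t \in (T1 :&: orthov f R)%VS & t \notin R.
  apply/subvPn/negP => sub; move: dimR; rewrite ltnNge => /negP; apply.
  have sub2 : (T1 :&: orthov f R <= R :&: orthov f T1)%VS.
    rewrite subv_cap sub; apply: subv_trans (capvSl _ _) _.
    exact/isotropic_orthov.
  have := dim_orthov_eq f T1 R; have := dimvS sub2.
  by clear; lia.
move=> /memv_capP[Tt /mem_orthovP tR] tNR; have Ut := subvP T1U _ Tt.
have [r Ur tr] : exists2 r, r \in U & nb (v^^K t) = v^^K.+1 r.
  apply: (orthov_ker_limg (g := v^^K.+1)) => //.
  - by move=> z; apply: stable_vX.
  - by move=> z; apply: stable_vX.
  - by move=> z s; rewrite vX_adj.
  - by apply: stable_nb => //; apply: stable_vX.
  move=> z Uz vz; rewrite nb_adj vX_adj -fE; apply: tR.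
  apply: (subvP (addvSl _ _)); rewrite memv_img // memv_cap Uz memv_ker.
  by rewrite nX_N_eq0 vz eqxx.
pose x := - r; pose y := t + n r.
have Ux : x \in U by rewrite rpredN.
have Uy : y \in U by rewrite rpredD // Un.
have vny : v^^K (nb y) = 0 by rewrite lfunD lfunD vXC_nb tr vS addNr.
have t_def : t = n x + y by rewrite /x /y lfunN addrC addrK.
clearbody x y.
have y0 : n^^(K.*2.+1) y = 0.
  apply/eqP; rewrite -ker_vn; have : nb (v^^K y) = 0 by rewrite -vXC_nb.
  by rewrite n_u'nb => /eqP; rewrite oppr_eq0 => /eqP/u'_inj; rewrite vXC_n => ->.
have cross z : b y (v^^K (n z)) = 0.
  by rewrite -vX_adj -nb_adj -vXC_nb vny b0l.
have yx : b y (v^^K y) = b x (v^^K.+1 x).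
  have := T10 _ _ Tt Tt; rewrite fE t_def !(lfunD, bDl) !bDr cross.
  have -> : b (n x) (v^^K y) = 0 by rewrite -vX_adj bC cross.
  have -> : b (n x) (v^^K (n x)) = - b x (v^^K.+1 x).
    by rewrite n_adj -vXC_nb vS bNr opprK.
  by rewrite addr0 add0r => /eqP; rewrite addrC subr_eq0 => /eqP.
have [x_iso|x_aniso] := eqVneq (b x (v^^K.+1 x)) 0; last by exists x, y.
have yNR : y \notin R.
  apply: contra tNR => Ry; rewrite t_def rpredD // (subvP (addvSl _ _)) //.
  rewrite memv_img // memv_cap Ux memv_ker.
  by rewrite nX_N_eq0 aniso // eqxx.
have [z [Uz z0 yz]] : exists z, [/\ z \in U, n^^(K.*2.+1) z = 0 & b y (v^^K z) != 0].
  suff /mem_orthovPn[z /memv_capP[Uz kz] yz] :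
      v^^K y \notin orthov b (U :&: lker (n^^(K.*2.+1)))%VS.
    exists z; split=> //; last by rewrite -vX_adj.
    by apply/eqP; rewrite -memv_ker.
  apply: contra yNR => /mem_orthovP vy.
  have [q Uq yq] : exists2 q, q \in U & v^^K y = (v^^K \o nb)%VF q.
    apply: (orthov_ker_limg (g := (v^^K \o n)%VF)) => //.
    - by move=> z Uz; rewrite comp_lfunE; apply: stable_vX => //; apply: Un.
    - by move=> z Uz; rewrite comp_lfunE; apply: stable_vX => //; apply: stable_nb.
    - by move=> z s; rewrite !comp_lfunE vX_adj n_adj vXC_nb.
    - exact: stable_vX.
    move=> z Uz; rewrite comp_lfunE => /eqP; rewrite ker_vn => z0.
    by apply: vy; rewrite memv_cap Uz memv_ker.
  rewrite comp_lfunE n_u'nb u'C_n -lfunN -linearN /= in yq.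
  have Uq' : u' (- q) \in U by rewrite u'E rpredD ?rpredN ?stable_nb // rpredN.
  (* Here v^K y = v^K nb q = v^K n (- u^-1 q), as nb = - u^-1 n. *)
  have -> : y = n (u' (- q)) + (y - n (u' (- q))) by rewrite addrC subrK.
  apply: memv_add; last first.
    rewrite memv_cap memv_ker rpredB ?Un //=.
    by rewrite lfunD lfunN -yq subrr.
  rewrite memv_img // memv_cap Uq' memv_ker nX_N_eq0 vS vXC_nb -yq -vXC_nb vny.
  by rewrite oppr0 eqxx.
pose l := (b x (v^^K.+1 x) : F).
have [x' Ux' x'N] := U_N.
have x'0 : b x' (v^^K.+1 x') != 0.
  by apply: contraNneq x'N => /(aniso Ux'); rewrite nX_N_eq0 => ->.
(* c solves b(z + c y, v^K (z + c y)) = b(x', v^(K+1) x'), y being isotropic for f_K. *)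
pose c := (b x' (v^^K.+1 x') - b z (v^^K z)) / (2%:R * b y (v^^K z)).
exists x', (z + c *: y); split=> //.
- by rewrite rpredD // memvZ.
- by rewrite lfunD lfunZ z0 y0 scaler0 addr0.
rewrite lfunD lfunZ !bE yx x_iso [b z (v^^K y)]bC vX_adj.
by rewrite /c; field; rewrite yz (two_neq0 charF).
Qed.

(** The vector y given by [linked_pair] is made orthogonal to F[u] x, then
    corrected by multiples of v^e y to match b(y, v^i y) with b(x, v^(i+1) x) for
    all i; this amounts to extracting the square root of a unit of F[v]. *)
Lemma linked_generators T : (T <= U)%VS -> isotropic (@wall_pre F p K) T ->
  (\dim (n^^(K.*2.+1) @: U) <= \dim (v^^K @: T))%N ->
  exists W, piece U N K.*2 (fun j => N - j.*2)%N W.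
Proof.
move=> TU T0 dimT; have [x [y [Ux Uy y0 x_aniso yx]]] := linked_pair TU T0 dimT.
have topx : v^^K.+1 x = n^^N x.
  have := @vX_top _ p K.+1 0 x; rewrite lfun_exp0 addn0 doubleS -NK; apply; exact: U0.
pose X := cyc x N; have x0 := U0 Ux.
have xx : b x (n^^N x) != 0 by rewrite -topx.
have Xn : stable X by apply: cyc_stable.
have XU : (X <= U)%VS by apply: cyc_sub.
have Xx : x \in X by have := @cyc_gen _ p x N 0; rewrite lfun_exp0; apply.
have X_nd : nondegenerate_on X.
  move=> z Xz z0; apply: (cyc_pairing x0 xx Xz) => j jN.
  by apply: z0; apply: cyc_gen.
pose X' := (U :&: orthov b X)%VS.
have X'n : stable X' by apply: complement_stable.
have XX' : {in X & X', forall z t, b z t = 0} by apply: complement_ortho.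
have vS z : v^^K z = 0 -> v^^K.+1 z = 0 by rewrite lfun_expS => ->; rewrite linear0.
(* The component y1 of y along X does not contribute: v^K y1 is killed
   by n, hence a multiple of n^N x, and n^N y1 = 0. *)
have [y' [X'y' y'0 yy']] : exists y', [/\ y' \in X', n^^(K.*2.+1) y' = 0 &
    b y' (v^^K y') = b x (v^^K.+1 x)].
  have := Uy; rewrite -(complement_add XU X_nd) => /memv_addP[y1 Xy1 [y' X'y' yE]].
  have [y10 y'0] : n^^(K.*2.+1) y1 = 0 /\ n^^(K.*2.+1) y' = 0.
    have n0 : n^^(K.*2.+1) y1 + n^^(K.*2.+1) y' = 0 by rewrite -lfunD -yE.
    have y10 : n^^(K.*2.+1) y1 = 0.
      apply/eqP; rewrite -memv0 -(complement_cap U X_nd) memv_cap stable_nX //=.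
      have /eqP := n0; rewrite addr_eq0 => /eqP ->; rewrite rpredN; exact: stable_nX.
    by split=> //; move: n0; rewrite y10 add0r.
  have [c vy1] : exists c, v^^K y1 = c *: n^^N x.
    pose c := b (v^^K y1) x / b (n^^N x) x; exists c; apply/eqP; rewrite -subr_eq0.
    apply/eqP; apply: (cyc_ker x0 xx).
    - by rewrite rpredB ?memvZ ?stable_nX ?stable_vX.
    - rewrite lfunD lfunN lfunZ -lfun_expS x0 scaler0 subr0.
      by apply/eqP; rewrite -vXC_n vX_eq0 -lfun_expSr y10.
    by rewrite bDl bNl bZl /c mulfVK ?subrr // bC.
  have y1y1 : b y1 (v^^K y1) = 0.
    rewrite vy1 bZr bC nX_adj; have -> : nb^^N y1 = 0; last by rewrite b0r mulr0.
    by apply/eqP; rewrite nbX_eq0 NK lfun_expS y10 linear0.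
  have y1y' : b y1 (v^^K y') = 0 by rewrite XX' // stable_vX.
  have y'y1 : b y' (v^^K y1) = 0 by rewrite bC XX' // stable_vX.
  exists y'; split=> //; rewrite -yx yE lfunD !bE y1y1 y1y' y'y1; ring.
pose P j := exists z, [/\ z \in X', n^^(K.*2.+1) z = 0 &
  forall i, (j <= i)%N -> b z (v^^i z) = b x (v^^i.+1 x)].
have tailz z i : n^^(K.*2.+1) z = 0 -> (K < i)%N -> v^^i z = 0.
  move=> z0 Ki; have := @vX_tail _ p i 0 K.*2 z z0; rewrite lfun_exp0 => -> //.
  by rewrite addn0 ltn_double.
have tailx i : (K < i)%N -> v^^i.+1 x = 0.
  move=> Ki; have := @vX_tail _ p i.+1 0 N x x0; rewrite lfun_exp0 => -> //.
  by rewrite addn0 NK -doubleS ltn_double.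
have [z [X'z z0 zP]] : P 0%N.
  apply: (@downward P K) => [|j jK [z [X'z z0 zP]]].
    exists y'; split=> // i; rewrite leq_eqVlt => /orP[/eqP <- //|Ki].
    by rewrite tailz // tailx // !b0r.
  pose e := (K - j)%N; have je : (j + e = K)%N by rewrite subnKC // ltnW.
  have e0 : (0 < e)%N by rewrite subn_gt0.
  have zK := zP K jK.
  pose c := (b x (v^^j.+1 x) - b z (v^^j z)) / (2%:R * b x (v^^K.+1 x)).
  exists (z + c *: v^^e z); split.
  - by rewrite rpredD // memvZ // stable_vX.
  - have -> : n^^(K.*2.+1) (z + c *: v^^e z) = 0 + c *: v^^e (n^^(K.*2.+1) z).
      by rewrite vXC_nX lfunD lfunZ z0.
    by rewrite z0 linear0 scaler0 addr0.
  move=> i ji; rewrite lfunD lfunZ !bE.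
  have -> : b (v^^e z) (v^^i z) = b z (v^^(i + e) z) by rewrite vX_adj -lfun_expD addnC.
  have -> : b (v^^e z) (v^^i (v^^e z)) = 0.
    rewrite vX_adj -[v^^i _]lfun_expD -lfun_expD tailz ?b0r //.
    by rewrite -je; move: ji e0; clear; lia.
  rewrite -lfun_expD; have [->|ne_ij] := eqVneq i j.
    by rewrite je zK /c; field; rewrite x_aniso (two_neq0 charF).
  have lt_ji : (j < i)%N by rewrite ltn_neqAle eq_sym ne_ij.
  by rewrite (tailz z (i + e)%N) ?zP // ?b0r -?je ?ltn_add2r //; ring.
have Uz : z \in U by have /memv_capP[] := X'z.
have NE : N = K.+1.*2 by rewrite NK doubleS.
rewrite NE; apply: (@linked_piece _ p charF U x z K) => //; rewrite -?NE //.
- have := @vX_top _ p K 0 z; rewrite lfun_exp0 addn0 => <- //.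
  by rewrite zP.
- by move=> i j; rewrite XX' // stable_vX // stable_nX.
by move=> i; apply: zP.
Qed.

End Level.
End LinkedGenerators.

(** * Sufficiency *)

Section Sufficiency.
Variables (F : fieldType) (p : isopair F).
Local Notation b := (iform p).
Local Notation V := (fspace (iform p)).
Local Notation n := (iaut p - \1%VF).
Local Notation nb := ((iaut p)^-1%VF - \1%VF).
Local Notation v := (wall_op p).
Implicit Types x y z : V.

Implicit Types U W T : {vspace V}.
Hypothesis charF : 2%N \notin [pchar F].
Hypothesis u_unipotent : unipotent p.

(** The numerical hypotheses say that M is Lagrangian for f_k and f_(k+1) on
    the piece, and that splitting off the piece lowers the left-hand side of the
    inequality at least as much as the right-hand side. The alternative for k+1
    is meant for the level where f_(k+1) is anisotropic, so that T2 contributes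
    nothing. *)
Lemma piece_condition U W N1 N2 m k : stable U -> nondegenerate_on U ->
  piece U N1 N2 m W ->
  (N1.+1 - k.*2 + (N2.+1 - k.*2) <= (m k).*2)%N ->
  (m k + m k.+1 <= N1.+1 - k.*2.+1 + (N2.+1 - k.*2.+1))%N ->
  (N1.+1 - k.+1.*2 + (N2.+1 - k.+1.*2) <= (m k.+1).*2)%N \/
  (forall T, (T <= U)%VS -> isotropic (@wall_pre F p k.+1) T ->
    \dim (v^^k.+1 @: T) = 0%N) ->
  wall_condition U k -> wall_condition (U :&: orthov b W)%VS k.
Proof.
move=> Un U_nd [[WU Wn W_nd] _ dimW [M MW MP]] mk mkk mk1.
case=> T1 [T2 [[T1U T1i] [T2U T2i] dimT]].
have iso_j j T : (N1.+1 - j.*2 + (N2.+1 - j.*2) <= (m j).*2)%N ->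
    (T <= U)%VS -> isotropic (@wall_pre F p j) T ->
    exists T', [/\ (T' <= U :&: orthov b W)%VS, isotropic (@wall_pre F p j) T' &
      (\dim (v^^j @: T) <= \dim (v^^j @: T') + m j)%N].
  move=> mj TU T0; have [Mi Mj] := MP j; rewrite -Mj.
  apply: (isotropic_complement Un WU Wn W_nd MW Mi _ TU T0).
  by rewrite dim_vX_img dimW Mj.
have [T1' [T1U' T1i' dimT1]] := iso_j k T1 mk T1U T1i.
have [T2' [T2U' T2i' dimT2]] : exists T', [/\ (T' <= U :&: orthov b W)%VS,
    isotropic (@wall_pre F p k.+1) T' &
    (\dim (v^^k.+1 @: T2) <= \dim (v^^k.+1 @: T') + m k.+1)%N].
  case: mk1 => [mk1|/(_ T2 T2U T2i) ->]; first exact: iso_j.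
  exists 0%VS; split; rewrite ?sub0v // => x y.
  by rewrite memv0 => /eqP-> _; exact: b0l.
exists T1', T2'; split=> //.
have dimU : \dim (n^^(k.*2.+1) @: U) = (\dim (n^^(k.*2.+1) @: W) +
    \dim (n^^(k.*2.+1) @: (U :&: orthov b W)))%N.
  apply: complement_dim_img => // x; first exact: stable_nX.
  exact/stable_nX/complement_stable.
rewrite dimU dimW in dimT.
by move: dimT dimT1 dimT2 mkk; clear; lia.
Qed.

(** Above the top level the inequality is void. *)
Lemma wall_condition_zero U k : {in U, forall z, n^^(k.*2.+1) z = 0} ->
  wall_condition U k.
Proof.
move=> U0; exists 0%VS, 0%VS.
have iso0 j : isotropic (@wall_pre F p j) 0%VS.
  by move=> x y; rewrite memv0 => /eqP-> _; exact: b0l.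
split; try by split; rewrite ?sub0v.
suff -> : (n^^(k.*2.+1) @: U = 0)%VS by rewrite dimv0.
apply/eqP; rewrite -subv0; apply/subvP => _ /memv_imgP[x Ux ->].
by rewrite U0 // mem0v.
Qed.

Lemma top_pairing U N : nondegenerate_on U -> stable U ->
  ~~ (U <= lker (n^^N))%VS ->
  exists x y, [/\ x \in U, y \in U & b x (n^^N y) != 0].
Proof.
move=> U_nd Un /subvPn[y Uy]; rewrite memv_ker => yN.
have /mem_orthovPn[x Ux xy] : n^^N y \notin orthov b U.
  apply: contra yN => /mem_orthovP y0; apply/eqP/U_nd => //; exact: stable_nX.
by exists x, y; rewrite bC.
Qed.

(** For a hyperbolic piece the inequality could only be lost at the level k with
    2k = N, where it is void on the complement. For a linked piece, level
    K + 1 is void too, and at level K the form f_(K+1) is anisotropic on U. *)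
Lemma piece_exists U N : stable U -> nondegenerate_on U ->
  {in U, forall z, n^^N.+1 z = 0} -> ~~ (U <= lker (n^^N))%VS -> (0 < N)%N ->
  (forall k, wall_condition U k) ->
  exists N1 N2 m W, piece U N1 N2 m W /\
    forall k, wall_condition (U :&: orthov b W)%VS k.
Proof.
move=> Un U_nd U0 U_N N_gt0 U_cond.
have cond0 W k : (N <= k.*2)%N -> wall_condition (U :&: orthov b W)%VS k.
  move=> Nk; apply: wall_condition_zero => z /memv_capP[Uz _].
  by apply: (nX_eq0 (k := N.+1)); [rewrite ltnS | apply: U0].
have hyper W : piece U N N (fun j => N.+1 - j.*2)%N W ->
    forall k, wall_condition (U :&: orthov b W)%VS k.
  move=> pW k; have [/cond0//|kN] := leqP N k.*2.
  apply: (piece_condition Un U_nd pW) (U_cond k).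
  - by clear; lia.
  - by move: kN; clear; lia.
  by left; clear; lia.
have [x [y [Ux Uy xy]]] := top_pairing U_nd Un U_N.
have NE : N = (odd N + N./2.*2)%N by rewrite odd_double_half.
case oddN: (odd N) NE => NE.
  have [W pW] := hyperbolic_generators charF Un Ux Uy U0 xy
    (iso_top_odd NE U0 Ux) (iso_top_odd NE U0 Uy).
  by exists N, N, (fun j => N.+1 - j.*2)%N, W; split=> //; apply: hyper.
set K := N./2 in NE; rewrite add0n in NE.
have vN z : z \in U -> v^^K z = n^^N z.
  move=> Uz; have := @vX_top _ p K 0 z; rewrite lfun_exp0 addn0 -NE; apply; exact: U0.
have tail z i : z \in U -> (K < i)%N -> v^^i z = 0.
  move=> Uz Ki; have := @vX_tail _ p i 0 N z (U0 z Uz); rewrite lfun_exp0 => -> //.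
  by rewrite addn0 NE ltn_double.
have top z : z \in U -> b z (v^^K z) = 0 -> forall i, (N <= i.*2)%N -> b z (v^^i z) = 0.
  move=> Uz z0 i; rewrite NE leq_double leq_eqVlt => /orP[/eqP <- //|Ki].
  by rewrite tail // b0r.
have [[z [Uz z0 vz]]|aniso] := boolp.pselect
    (exists z, [/\ z \in U, b z (v^^K z) = 0 & v^^K z != 0]).
  have /mem_orthovPn[t Ut zt] : v^^K z \notin orthov b U.
    apply: contra vz => /mem_orthovP vz; apply/eqP/U_nd => //; exact: stable_vX.
  rewrite vX_adj in zt; pose c := - b t (v^^K t) / (2%:R * b z (v^^K t)).
  have tz : b t (v^^K z) = b z (v^^K t) by rewrite bC vX_adj.
  have Ut' : t + c *: z \in U by rewrite rpredD // memvZ.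
  have zt' : b z (n^^N (t + c *: z)) != 0.
    by rewrite -vN // lfunD lfunZ bDr bZr z0 mulr0 addr0.
  have t'0 : b (t + c *: z) (v^^K (t + c *: z)) = 0.
    rewrite lfunD lfunZ !bE z0 tz /c; field.
    by rewrite zt (two_neq0 charF).
  have [W pW] := hyperbolic_generators charF Un Uz Ut' U0 zt'
    (top z Uz z0) (top _ Ut' t'0).
  by exists N, N, (fun j => N.+1 - j.*2)%N, W; split=> //; apply: hyper.
have {}aniso : {in U, forall z, b z (v^^K z) = 0 -> v^^K z = 0}.
  move=> z Uz z0; apply/eqP; case: eqP => // /eqP vz.
  by case: aniso; exists z.
have K_gt0 : (0 < K)%N by move: N_gt0; rewrite NE double_gt0.
case: K K_gt0 => // K _ in NE vN tail top aniso *.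
have anisoT T : (T <= U)%VS -> isotropic (@wall_pre F p K.+1) T ->
    \dim (v^^K.+1 @: T) = 0%N.
  move=> TU T0; apply/eqP; rewrite dimv_eq0 -subv0; apply/subvP => _ /memv_imgP[z Tz ->].
  rewrite memv0; apply/eqP/aniso; first exact: (subvP TU).
  exact: T0.
have [T1 [T2 [[T1U T1i] [T2U T2i] dimT]]] := U_cond K.
rewrite (anisoT T2) // addn0 in dimT.
have NK : N = K.*2.+2 by rewrite NE doubleS.
have U_N' : exists2 x, x \in U & n^^N x != 0.
  by case/subvPn: U_N => z Uz; rewrite memv_ker; exists z.
have [W pW] := linked_generators charF NK Un U_nd U0 aniso U_N' T1U T1i dimT.
exists N, K.*2, (fun j => N - j.*2)%N, W; split=> // k.
have [/cond0//|kN] := leqP N k.*2.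
apply: (piece_condition Un U_nd pW) (U_cond k).
- by move: kN; rewrite NK; clear; lia.
- by move: kN; rewrite NK; clear; lia.
move: kN; rewrite NK -doubleS ltn_double ltnS leq_eqVlt => /orP[/eqP ->|kK].
  by right; apply: anisoT.
by left; move: kK; clear; lia.
Qed.

Lemma twisted_root_exists U : stable U -> nondegenerate_on U ->
  (forall k, wall_condition U k) -> exists d, twisted_root U d.
Proof.
have [m] := ubnP (\dim U); elim: m U => // m IHm U; rewrite ltnS => dimU Un U_nd U_cond.
have ex_N : exists N, (U <= lker (n^^N))%VS.
  by exists (\dim {:V}); apply/subvP => z _; rewrite memv_ker unipotent_dim.
case: (ex_minnP ex_N) => N UN minN.
have [N_le1|N_gt1] := leqP N 1.
  have n0 z : z \in U -> n z = 0.
    move=> Uz; have /subvP/(_ z Uz) := subv_trans UN (lker_exp_sub n N_le1).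
    by rewrite memv_ker lfun_expS lfun_exp0 => /eqP.
  have nb0 z : z \in U -> nb z = 0 by move=> Uz; rewrite n_u'nb n0 // linear0 oppr0.
  exists 0; split; [|split] => [z Uz|z Uz|z t Uz Ut]; rewrite !zero_lfunE.
  - by rewrite mem0v vE n0 // nb0 // addr0 oppr0.
  - by rewrite linear0.
  by rewrite b0l b0r oppr0.
case: N => // N in UN minN N_gt1 *.
have U0 : {in U, forall z, n^^N.+1 z = 0}.
  by move=> z Uz; apply/eqP; rewrite -memv_ker (subvP UN).
have U_N : ~~ (U <= lker (n^^N))%VS by apply/negP => /minN; rewrite ltnn.
have [N1 [N2 [f [W [pW cW]]]]] := piece_exists Un U_nd U0 U_N N_gt1 U_cond.
have [[WU Wn W_nd] [d1 dW] dimW _] := pW.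
have [|||d2 dU'] := IHm (U :&: orthov b W)%VS _ _ _ cW.
- have W_gt0 : (0 < \dim W)%N.
    have := dimW 0%N; rewrite subn0 => dW0.
    by have := limg_ker_dim (n^^0) W; rewrite dW0; clear; lia.
  have := dimv_disjoint_sum (complement_cap U W_nd); rewrite (complement_add WU W_nd).
  by move: dimU W_gt0; clear; lia.
- exact: complement_stable.
- exact: complement_nondegenerate.
by have := @twisted_root_add F p U W Un WU Wn W_nd d1 d2 dW dU'.
Qed.

End Sufficiency.

Theorem theorem1p11 (F : fieldType) (charF : 2%N \notin [pchar F])
    (p : isopair F) (u_unipotent : unipotent p) :
  (exists w1 w2 : 'End(fspace (iform p)),
     [/\ U2_element w1, U2_element w2 & iaut p = (w1 \o w2)%VF])
  <->
  (forall k : nat,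
     witt_simplifies (signed k (wall_invariant p k)) (wall_perp_above p k)).
Proof.
split=> [[w1 [w2 [U2w1 U2w2 u_def]]] k|simp].
  apply/(witt_simplifies_wall_condition u_unipotent).
  exact: U2_product_wall_condition U2w1 U2w2 u_def.
have full_nd : nondegenerate_on (fullv : {vspace fspace (iform p)}).
  move=> x _ x0; have /nondegenerateP := fformP (iform p); apply=> y.
  by apply: x0; rewrite memvf.
have full_n : stable (fullv : {vspace fspace (iform p)}) by move=> x _; apply: memvf.
have [|d [dd [dn d_skew]]] := twisted_root_exists charF u_unipotent full_n full_nd.
  by move=> k; apply/(witt_simplifies_wall_condition u_unipotent).
apply: (U2_factorization charF (d := d) u_unipotent) => [x y|x|x].
- exact: (d_skew _ _ (memvf x) (memvf y)).
- by case: (dd _ (memvf x)).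
- exact: (dn _ (memvf x)).
Qed.
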